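(* Let $S$ be a Kulikov surface with Kulikov morphism $F_S:S\to\mathbb{C}^2$ (defined in the context), let $B$ be the ring of regular functions on $S$, let $\phi_S:\mathbb{C}[\mathbb{C}^2]\to B$ be the ring morphism induced by $F_S$, let $A$ be the image of $\phi_S$, and let $p$ be any element of $B$ which is a primitive element of the field extension $\mathrm{Frac}(A)\subset\mathrm{Frac}(B)$ induced by $\phi_S$. Then $A[p]$, the $A$-subalgebra of $B$ generated by $p$, is not normal (i.e. not integrally closed), hence not unramified over $A$.
   Context: **Kulikov surfaces and morphisms.** Let $\mathbb{P}_2=\mathbb{P}_2(\mathbb{C})$ with homogeneous coordinates $X_1,X_2,X_3$, let $P=(1:1:1)$, and for $1\le i\le 3$ let $Q_i = 3X_i^2 - X_1X_2 - X_1X_3 - X_2X_3$ (three conics passing through $P$). Let $\phi : \mathbb{P}_2 - \{P\} \to \mathbb{P}_2$ be the morphism $x \mapsto (Q_1(x):Q_2(x):Q_3(x))$. Let $R$ be the Zariski closure in $\mathbb{P}_2$ of the set of ramification points of $\phi$; it is the cubic with a node at $P$ defined by $\sum_{i\ne j} X_i^2X_j - 6X_1X_2X_3$. Let $Q = a_1Q_1+a_2Q_2+a_3Q_3$ be a generic linear combination with complex coefficients, and let $C$ be the conic defined by $Q$. It passes through $P$ and meets $R$ transversely at each point of their intersection (at the node $P$: transversely to both branches of $R$), and $\phi$ maps the complement of $C$ in $\mathbb{P}_2$ into the complement of a line $L$ of $\mathbb{P}_2$ (namely $L : a_1Y_1+a_2Y_2+a_3Y_3=0$ in the target coordinates $Y_1,Y_2,Y_3$).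 Let $\sigma : \tilde{\mathbb{P}}_2 \to \mathbb{P}_2$ be the blowing-up of $P$, $E=\sigma^{-1}(P)$ the exceptional curve, and $\tilde R$, $\tilde C$ the strict transforms of $R$, $C$ by $\sigma$ (the irreducible curves with $\sigma^{-1}(R)=E\cup\tilde R$ and $\sigma^{-1}(C)=E\cup\tilde C$). The surface $S = \tilde{\mathbb{P}}_2 - (\tilde R\cup\tilde C)$ is called a Kulikov surface. The map $\phi\circ\sigma$ extends to $\tilde{\mathbb{P}}_2$ and induces an unramified morphism $F_S : S \to \mathbb{P}_2 - L \cong \mathbb{C}^2$ of geometric degree $3$, called the Kulikov morphism on $S$. *)

(* Defs.v *)
From HB Require Import structures.
From mathcomp Require Import all_boot all_order all_algebra.
From mathcomp Require Import boolp classical_sets functions reals complex mpoly.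
From mathcomp Require Import ring.

Set Implicit Arguments.
Unset Strict Implicit.
Unset Printing Implicit Defensive.

Import GRing.Theory.
Local Open Scope ring_scope.

(* Rings are allowed to be trivial (comPzRingType), because a ring of         *)
(* functions on a set is trivial when the set happens to be empty.            *)

Definition is_fraction_field (D : comPzRingType) (K : fieldType)
    (iota : {rmorphism D -> K}) : Prop :=
  injective iota /\
  forall x : K, exists d e : D, iota e != 0 /\ x = iota d / iota e.

(* The analogue of integralOver for a possibly trivial ring D.                *)
Definition integral_over (D : comPzRingType) (K : fieldType)
    (iota : D -> K) (x : K) : Prop :=
  exists q : {poly K},
    [/\ q \is monic, (forall i, exists d : D, q`_i = iota d) & root q x].

Definition normal_domain (D : comPzRingType) : Prop :=
  exists (K : fieldType) (iota : {rmorphism D -> K}),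
    is_fraction_field iota /\
    forall x : K, integral_over iota x -> exists d : D, x = iota d.

Definition finite_type (A D : comPzRingType) (f : {rmorphism A -> D}) : Prop :=
  exists s : seq D, forall E : {pred D}, subring_closed E ->
    (forall x : A, f x \in E) -> {subset s <= E} -> forall y : D, y \in E.

(* Uniqueness of the lifting of D -> T / I to D -> T over A, for every ideal  *)
(* I of T with I ^ 2 = 0; two morphisms agree modulo I when their difference  *)
(* takes its values in I.                                                     *)
Definition formally_unramified (A D : comPzRingType) (f : {rmorphism A -> D}) :
    Prop :=
  forall (T : comPzRingType) (I : {pred T}),
    0 \in I -> (forall t, {in I &, forall u v, t * u + v \in I}) ->
    {in I &, forall u v, u * v = 0} ->
  forall g1 g2 : {rmorphism D -> T},
    (forall x : A, g1 (f x) = g2 (f x)) ->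
    (forall y : D, g1 y - g2 y \in I) ->
  forall y : D, g1 y = g2 y.

Definition unramified (A D : comPzRingType) (f : {rmorphism A -> D}) : Prop :=
  finite_type f /\ formally_unramified f.

Definition subring_of (B : comPzRingType) (D : subringClosed B) : Type :=
  {b : B | b \in D}.

HB.instance Definition _ (B : comPzRingType) (D : subringClosed B) :=
  Choice.on (subring_of D).
HB.instance Definition _ (B : comPzRingType) (D : subringClosed B) :=
  SubChoice.on (subring_of D).
HB.instance Definition _ (B : comPzRingType) (D : subringClosed B) :=
  GRing.SubChoice_isSubComPzRing.Build _ _ (subring_of D) (subringClosedP _).

Section Adjoin.
Variables (B : comPzRingType) (A : subringClosed B) (p : B).

Definition adjoin : {pred B} := fun b =>
  `[< forall D : {pred B}, subring_closed D -> {subset A <= D} -> p \in D ->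
      b \in D >].

Fact adjoin_subring_closed : subring_closed adjoin.
Proof.
split=> [|x y|x y].
- by apply/asboolP => D [].
- move=> /asboolP Dx /asboolP Dy; apply/asboolP => D cD AD pD.
  by case: (cD) => _ sub _; apply: sub; [exact: Dx | exact: Dy].
move=> /asboolP Dx /asboolP Dy; apply/asboolP => D cD AD pD.
by case: (cD) => _ _ mul; apply: mul; [exact: Dx | exact: Dy].
Qed.

HB.instance Definition _ := GRing.isSubringClosed.Build B adjoin
  adjoin_subring_closed.

Fact adjoin_sub (x : subring_of A) : val x \in adjoin.
Proof. by apply/asboolP => D _ AD _; apply/AD/(valP x). Qed.

Definition adjoin_incl (x : subring_of A) : subring_of adjoin :=
  Sub (val x) (adjoin_sub x).

Fact adjoin_incl_is_zmod_morphism : zmod_morphism adjoin_incl.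
Proof. by move=> x y; apply: val_inj. Qed.

Fact adjoin_incl_is_monoid_morphism : monoid_morphism adjoin_incl.
Proof. by split=> [|x y]; apply: val_inj. Qed.

HB.instance Definition _ := GRing.isZmodMorphism.Build _ _ adjoin_incl
  adjoin_incl_is_zmod_morphism.
HB.instance Definition _ := GRing.isMonoidMorphism.Build _ _ adjoin_incl
  adjoin_incl_is_monoid_morphism.

End Adjoin.

Arguments adjoin {B} A p.
Arguments adjoin_incl {B} A p.

(* Inside a field of fractions K of B, the field Frac(A) consists of the      *)
(* quotients of elements of A.                                                *)
Definition primitive_element (B : comPzRingType) (A : {pred B})
    (K : fieldType) (iota : {rmorphism B -> K}) (p : B) : Prop :=
  forall F : {pred K}, divring_closed F ->
    (forall b c : B, b \in A -> c \in A -> iota c != 0 ->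
       iota b / iota c \in F) ->
    iota p \in F -> forall x : K, x \in F.

(* A point of a product of k projective spaces is given by a row v of         *)
(* homogeneous coordinates, the i-th one belonging to the factor gr i. The    *)
(* subsets U below are meant to be stable by rescaling each factor; a         *)
(* function on U that is locally a quotient of two forms of the same          *)
(* multidegree is automatically invariant by rescaling.                       *)
Section RegularFunctions.
Variables (F : fieldType) (n k : nat) (gr : 'I_n -> 'I_k).

Definition multihomog (d : 'I_k -> nat) (G : {mpoly F[n]}) : Prop :=
  forall m, m \in msupp G -> forall j, (\sum_(i < n | gr i == j) m i)%N = d j.

Definition zariski_closure (Z : set 'rV[F]_n) : set 'rV[F]_n :=
  [set v | forall d G, multihomog d G ->
             (forall w, Z w -> G.@[w 0] = 0) -> G.@[v 0] = 0].

Variable U : set 'rV[F]_n.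

(* The neighbourhood of v is the basic open subset H != 0 of U.               *)
Definition regular : {pred {v | U v} -> F} := fun f =>
  `[< forall v : {v | U v}, exists d G H,
        [/\ multihomog d G, multihomog d H, H.@[(sval v) 0] != 0 &
            forall w : {v | U v}, H.@[(sval w) 0] != 0 ->
              f w = G.@[(sval w) 0] / H.@[(sval w) 0]] >].

Lemma multihomogM d e G H : multihomog d G -> multihomog e H ->
  multihomog (fun j => d j + e j)%N (G * H).
Proof.
move=> hG hH m /msuppM_le /allpairsP [[m1 m2] /= [m1G m2H ->]] j.
rewrite -(hG _ m1G) -(hH _ m2H) -big_split /=.
by apply: eq_bigr => i _; rewrite mnmDE.
Qed.

Lemma multihomogB d G H : multihomog d G -> multihomog d H ->
  multihomog d (G - H).
Proof.
by move=> hG hH m /msuppB_le; rewrite mem_cat => /orP [/hG|/hH].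
Qed.

Lemma multihomog1 : multihomog (fun=> 0)%N 1.
Proof.
move=> m; rewrite msupp1 inE => /eqP -> j.
by rewrite big1 // => i _; rewrite mnm0E.
Qed.

Lemma regular_subring_closed : subring_closed regular.
Proof.
split=> [|f g|f g].
- apply/asboolP => v; exists (fun=> 0)%N, 1, 1.
  by split=> [|||w _]; rewrite ?meval1 ?oner_neq0 ?divr1 //;
    exact: multihomog1.
- move=> /asboolP rf /asboolP rg; apply/asboolP => v.
  have [d [G [H [hG hH Hv fE]]]] := rf v.
  have [d' [G' [H' [hG' hH' Hv' gE]]]] := rg v.
  exists (fun j => d j + d' j)%N, (G * H' - H * G'), (H * H').
  split; first by apply: multihomogB; apply: multihomogM.
  - exact: multihomogM.
  - by rewrite mevalM mulf_neq0.
  move=> w; rewrite mevalM mulf_eq0 negb_or => /andP [Hw Hw'].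
  rewrite -[(f - g) w]/(f w - g w) fE // gE // mevalB !mevalM.
  by field; rewrite Hw Hw'.
move=> /asboolP rf /asboolP rg; apply/asboolP => v.
have [d [G [H [hG hH Hv fE]]]] := rf v.
have [d' [G' [H' [hG' hH' Hv' gE]]]] := rg v.
exists (fun j => d j + d' j)%N, (G * G'), (H * H').
split; [exact: multihomogM | exact: multihomogM | by rewrite mevalM mulf_neq0|].
move=> w; rewrite mevalM mulf_eq0 negb_or => /andP [Hw Hw'].
rewrite -[(f * g) w]/(f w * g w) fE // gE // !mevalM.
by field; rewrite Hw Hw'.
Qed.

HB.instance Definition _ := GRing.isSubringClosed.Build _ regular
  regular_subring_closed.

Definition regular_ring : comPzRingType := subring_of regular.

Lemma regular_ringB (f g : regular_ring) v : val (f - g) v = val f v - val g v.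
Proof. by []. Qed.

Lemma regular_ringM (f g : regular_ring) v : val (f * g) v = val f v * val g v.
Proof. by []. Qed.

End RegularFunctions.

Lemma det_mx33 (A : comNzRingType) (M : 'M[A]_3) :
  \det M = M 0 0 * (M 1 1 * M 2 2 - M 1 2 * M 2 1)
         - M 0 1 * (M 1 0 * M 2 2 - M 1 2 * M 2 0)
         + M 0 2 * (M 1 0 * M 2 1 - M 1 1 * M 2 0).
Proof.
pose f (i j : nat) := M (inord i) (inord j).
have -> : M = \matrix_(i, j) f i j.
  by apply/matrixP => i j; rewrite mxE /f !inord_val.
rewrite (expand_det_row _ 0) !big_ord_recl big_ord0 /cofactor.
do 3!rewrite (expand_det_row _ 0) !big_ord_recl big_ord0 /cofactor !det_mx11.
rewrite !mxE; move: f => f.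
rewrite /= /bump /= !addr0 !addn0 !add0n !expr0 !expr1 sqrrN !expr1n.
rewrite !mul1r !mulN1r !mulrN !addn1.
by ring.
Qed.


Section Kulikov.
Variable R : realType.
Local Notation C := R[i].

Definition P2_grading (i : 'I_3) : 'I_1 := ord0.

(* P_2 x P_1, in which the blowing-up of (1 : 1 : 1) is embedded.             *)
Definition P2xP1_grading (i : 'I_(3 + 2)) : 'I_2 :=
  if fintype.split i is inl _ then 0 else 1.

(* The homogeneous coordinates X_1, X_2, X_3 are indexed by 0, 1, 2 : 'I_3.   *)
Definition kulikov_Q (i : 'I_3) : {mpoly C[3]} :=
  3 *: 'X_i ^+ 2 - 'X_0 * 'X_1 - 'X_0 * 'X_2 - 'X_1 * 'X_2.

(* Up to a constant, the Jacobian determinant of (Q_1, Q_2, Q_3), which        *)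
(* vanishes exactly where (Q_1 : Q_2 : Q_3) is ramified.                      *)
Definition kulikov_R : {mpoly C[3]} :=
  \sum_(i < 3) \sum_(j < 3 | i != j) 'X_i ^+ 2 * 'X_j - 6 *: ('X_0 * 'X_1 * 'X_2).

Lemma kulikov_jacobian :
  \det (\matrix_(i < 3, j < 3) (kulikov_Q i)^`M(j)) = - 36 *: kulikov_R.
Proof.
have DX (i j : 'I_3) : ('X_i : {mpoly C[3]})^`M(j) = (i == j)%:R.
  rewrite mderivX mnm1E; case: eqP => [->|_]; last by rewrite scale0r.
  rewrite scale1r -[RHS]mpolyX0; congr 'X_[_].
  by apply/mnmP => k; rewrite mnmBE subnn mnm0E.
have DQ i j : (kulikov_Q i)^`M(j) =
    6 * 'X_i * (i == j)%:R - ((0 == j)%:R * 'X_1 + 'X_0 * (1 == j)%:R)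
      - ((0 == j)%:R * 'X_2 + 'X_0 * (2 == j)%:R)
      - ((1 == j)%:R * 'X_2 + 'X_1 * (2 == j)%:R).
  rewrite /kulikov_Q !mderivB mderivZ.
  rewrite expr2 !mderivM.
  rewrite !DX.
  rewrite scaler_nat -mulr_natl; ring.
have alg (A : comNzRingType) (x y z : A) (M : 'M[A]_3) :
    (forall i j, M i j = 6 * [:: x; y; z]`_i * (i == j)%:R
      - ((0 == j)%:R * y + x * (1 == j)%:R)
      - ((0 == j)%:R * z + x * (2 == j)%:R)
      - ((1 == j)%:R * z + y * (2 == j)%:R)) ->
    \det M = - (x ^+ 2 * y + x ^+ 2 * z + (y ^+ 2 * x + y ^+ 2 * z)
               + (z ^+ 2 * x + z ^+ 2 * y) - x * y * z *+ 6) *+ 36.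
  by move=> ME; rewrite det_mx33 !ME /=; ring.
have nthX (i : 'I_3) : [:: 'X_0; 'X_1; 'X_2]`_i = 'X_i :> {mpoly C[3]}.
  case: i => [[|[|[|//]]] ?] /=; congr 'X_[_]; congr mnm1; exact: val_inj.
rewrite (alg _ 'X_0 'X_1 'X_2) => [|i j]; last by rewrite mxE DQ nthX.
rewrite scaleNr scaler_nat mulNrn; congr (- (_ *+ _)).
rewrite /kulikov_R scaler_nat; congr (_ - _).
have E1 : lift ord0 (ord0 : 'I_2) = 1 :> 'I_3 by exact: val_inj.
have E2 : lift ord0 (lift ord0 (ord0 : 'I_1)) = 2 :> 'I_3 by exact: val_inj.
have big3 (P : pred 'I_3) (G : 'I_3 -> {mpoly C[3]}) : \sum_(j < 3 | P j) G j =
    (if P 0 then G 0 else 0) + (if P 1 then G 1 else 0)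
      + (if P 2 then G 2 else 0).
  rewrite big_mkcond !big_ord_recl big_ord0 E1 E2.
  by rewrite -addrA; congr (_ + (_ + _)); apply: addr0.
rewrite !big3 /=; congr (_ + _ + (_ + _) + _); symmetry;
  [exact: add0r | exact: addr0 | exact: addr0].
Qed.

Definition kulikov_conic (a : 'I_3 -> C) : {mpoly C[3]} :=
  \sum_(i < 3) a i *: kulikov_Q i.

(* A nonzero row x represents the point P = (1 : 1 : 1).                      *)
Definition is_P (x : 'rV[C]_3) : Prop := x 0 0 = x 0 1 /\ x 0 1 = x 0 2.

Definition gradient (G : {mpoly C[3]}) (x : 'rV[C]_3) : 'rV[C]_3 :=
  \row_j (G^`M(j)).@[x 0].

(* Genericity of the linear combination: the conic meets the cubic            *)
(* transversely. At the node P, the tangents to the two branches of the cubic *)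
(* are the lines spanned by P and the isotropic vectors v of its Hessian      *)
(* form, and the tangent to the conic must be neither of them.                *)
Definition transverse_away_from_node (a : 'I_3 -> C) : Prop :=
  forall x : 'rV[C]_3, x != 0 -> ~ is_P x ->
    (kulikov_conic a).@[x 0] = 0 -> kulikov_R.@[x 0] = 0 ->
    row_free (col_mx (gradient (kulikov_conic a) x) (gradient kulikov_R x)).

Definition transverse_at_node (a : 'I_3 -> C) : Prop :=
  let P := const_mx 1 : 'rV[C]_3 in
  gradient (kulikov_conic a) P != 0 /\
  forall v : 'rV[C]_3, ~ is_P v ->
    \sum_(i < 3) gradient (kulikov_conic a) P 0 i * v 0 i = 0 ->
    \sum_(i < 3) \sum_(j < 3)
      (kulikov_R^`M(i)^`M(j)).@[P 0] * v 0 i * v 0 j != 0.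

Definition kulikov_generic (a : 'I_3 -> C) : Prop :=
  transverse_away_from_node a /\ transverse_at_node a.

(* The pairs of x in P_2 and u in P_1 such that                               *)
(* (x_1 - x_3 : x_2 - x_3) = (u_1 : u_2) whenever the left-hand side makes    *)
(* sense. The projection to x is the blowing-up of P.                         *)
Definition blowup : set 'rV[C]_(3 + 2) :=
  [set v | let x := lsubmx v in let u := rsubmx v in
    [/\ x != 0, u != 0 & (x 0 0 - x 0 2) * u 0 1 = (x 0 1 - x 0 2) * u 0 0]].

Definition strict_transform (G : {mpoly C[3]}) : set 'rV[C]_(3 + 2) :=
  zariski_closure P2xP1_grading
    [set v | [/\ blowup v, ~ is_P (lsubmx v) & G.@[lsubmx v 0] = 0]].

Definition kulikov_surface (a : 'I_3 -> C) : set 'rV[C]_(3 + 2) :=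
  [set v | [/\ blowup v, ~ strict_transform kulikov_R v &
               ~ strict_transform (kulikov_conic a) v]].

Definition kulikov_ring (a : 'I_3 -> C) : comPzRingType :=
  regular_ring P2xP1_grading (kulikov_surface a).

(* The complement of the line L in P_2, which is an affine plane.             *)
Definition kulikov_plane (a : 'I_3 -> C) : set 'rV[C]_3 :=
  [set y | y != 0 /\ \sum_(i < 3) a i * y 0 i != 0].

Definition plane_ring (a : 'I_3 -> C) : comPzRingType :=
  regular_ring P2_grading (kulikov_plane a).

(* The extension to the blowing-up of (Q_1 : Q_2 : Q_3). For some lambda, the *)
(* vector w = (u_1, u_2, 0) satisfies x_i - x_j = lambda (w_i - w_j), with    *)
(* lambda != 0 outside the exceptional curve; the i-th coordinate comes       *)
(* from Q_i = (X_i - X_j) (X_i + X_k) + 2 X_i (X_i - X_k), {i, j, k} = {1, 2, *)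
(* 3}, after division by lambda; see kulikov_mapE. Indices are modulo 3.      *)
Definition kulikov_map (v : 'rV[C]_(3 + 2)) : 'rV[C]_3 :=
  let x := lsubmx v in
  let w := row_mx (rsubmx v) 0 : 'rV[C]_(2 + 1) in
  \row_(i < 3) ((w 0 i - w 0 (i + 1)) * (x 0 i + x 0 (i + 2)) +
                2 * x 0 i * (w 0 i - w 0 (i + 2))).

Lemma kulikov_mapE (v : 'rV[C]_(3 + 2)) (i : 'I_3) (c : C) :
  let x := lsubmx v in let u := rsubmx v in
  x 0 0 - x 0 2 = c * u 0 0 -> x 0 1 - x 0 2 = c * u 0 1 ->
  (kulikov_Q i).@[x 0] = c * kulikov_map v 0 i.
Proof.
move=> x u h0 h1; rewrite /kulikov_map [in RHS]mxE -/x -/u.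
set w : 'rV_(2 + 1) := row_mx u 0.
have w0 : w 0 0 = u 0 0.
  by rewrite -[RHS](row_mxEl u (0 : 'rV_1)); congr (w 0 _); exact: val_inj.
have w1 : w 0 1 = u 0 1.
  by rewrite -[RHS](row_mxEl u (0 : 'rV_1)); congr (w 0 _); exact: val_inj.
have w2 : w 0 2 = 0.
  by rewrite -[RHS](mxE const_mx_key (fun _ _ => 0 : C) (0 : 'I_1) (0 : 'I_1))
    -[RHS](row_mxEr u (0 : 'rV_1)); congr (w 0 _); exact: val_inj.
have e0 : x 0 0 = x 0 2 + c * u 0 0 by rewrite -h0 addrC subrK.
have e1 : x 0 1 = x 0 2 + c * u 0 1 by rewrite -h1 addrC subrK.
clear h0 h1; move: x u w w0 w1 w2 e0 e1 => x u w w0 w1 w2 e0 e1.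
rewrite /kulikov_Q !mevalB mevalZ expr2 !mevalM !mevalXU.
have : [\/ i = 0, i = 1 | i = 2].
  by case: i => [[|[|[|//]]] ?]; [apply: Or31 | apply: Or32 | apply: Or33];
    exact: val_inj.
case=> ->.
- rewrite !add0r w0 w1 w2 e0 e1; ring.
- rewrite (_ : 1 + 1 = 2) // (_ : 1 + 2 = 0); last exact: val_inj.
  rewrite w0 w1 w2 e0 e1; ring.
- rewrite (_ : 2 + 1 = 0); last exact: val_inj.
  rewrite (_ : 2 + 2 = 1); last exact: val_inj.
  rewrite w0 w1 w2 e0 e1; ring.
Qed.

(* The image A of the ring morphism induced by the Kulikov morphism: the      *)
(* functions b such that b = g o F_S for a regular function g on the plane.   *)
(* Here y ranges over the plane, so y = F_S(s).                               *)
Definition kulikov_image (a : 'I_3 -> C) : {pred kulikov_ring a} := fun b =>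
  `[< exists g : plane_ring a,
        forall (s : {v | kulikov_surface a v}) (y : {y | kulikov_plane a y}),
          sval y = kulikov_map (sval s) -> val b s = val g y >].

Arguments kulikov_image : clear implicits.

Fact kulikov_image_subring_closed a : subring_closed (kulikov_image a).
Proof.
split=> [|b c|b c].
- by apply/asboolP; exists 1 => s y _.
- move=> /asboolP [g gE] /asboolP [h hE]; apply/asboolP; exists (g - h).
  by move=> s y sy; rewrite !regular_ringB (gE s y sy) (hE s y sy).
move=> /asboolP [g gE] /asboolP [h hE]; apply/asboolP; exists (g * h).
by move=> s y sy; rewrite !regular_ringM (gE s y sy) (hE s y sy).
Qed.

HB.instance Definition _ a := GRing.isSubringClosed.Build _ (kulikov_image a)
  (kulikov_image_subring_closed a).

End Kulikov.

Arguments kulikov_image {R} a.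

(* Main.v *)
From HB Require Import structures.
Require Import Defs.
From mathcomp Require Import all_boot all_order all_algebra.
From mathcomp Require Import boolp classical_sets functions reals complex mpoly.
From mathcomp Require Import ring.

(** Let X and Y be affine coordinates of the plane, viewed as functions on the
    surface. The ring A[p] is the image of the evaluation phi of polynomials in
    three variables at (X, Y, p), with A the image of the polynomials in X and Y
    alone. Three facts about the surface are needed.

    - The Kulikov map is unramified on S (chart_jacobian): its Jacobian
      determinant is the equation of the strict transform of the nodal cubic,
      which has been removed.
    - It is generically finite (phi_algebraic), because the direction of the line
      through P on which a point of the fibre lies is a root of a cubic
      polynomial; and it is not birational (phi_not_birational), because it
      identifies the points of explicit pairs.
    - A regular function without zeros on S is constant (unit_constant): on an
      affine chart it is a product of powers of the equations of the two removed
      curves, and two more curves, on which it has neither zeros nor poles, force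
      the exponents to be zero. This uses that both curves are irreducible, which
      for the conic follows from its genericity.

    By the second fact and the lemma of Gauss, the kernel of phi is generated by a
    primitive polynomial f of degree d > 1 in its last variable, and p satisfies
    no equation of smaller degree (kernel_generator). Hence the derivative f'(p)
    is not constant, and by the third fact it vanishes at a point v of S
    (ramification_point).

    Then q |-> q'(p)(v) is a well-defined derivation of A[p] over A at the point v,
    as it kills f; and it maps p to 1. So A[p] is ramified over A
    (adjoin_ramified).

    For normality, take an irreducible curve through v on which f'(p) vanishes.
    As the Kulikov map is unramified, the image of this curve is a curve of the
    plane, and its equation h vanishes to the order 1 along the curve of S. The
    polynomials q such that q(p) vanishes on the curve form an ideal QQ, and f'
    belongs to it. It follows that f is in the square of QQ, hence that the
    hypersurface f = 0, whose ring of functions is A[p], is singular in codimension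
    one. This is made explicit by an element of the fraction field which is
    quadratic over A[p] and does not belong to A[p] (ramified_not_normal). *)

Set Implicit Arguments.
Unset Strict Implicit.
Unset Printing Implicit Defensive.

Import GRing.Theory.
Local Open Scope ring_scope.

(** * Factorial domains *)

Section Divisibility.
Variable D : idomainType.
Implicit Types (a b c p q : D) (s : seq D).

Definition divides a b := exists c, b = c * a.

Definition prime_elt p : Prop :=
  [/\ p != 0, p \isn't a GRing.unit &
      forall a b, divides p (a * b) -> divides p a \/ divides p b].

Definition factorial : Prop :=
  forall a, a != 0 -> exists u s,
    [/\ u \is a GRing.unit, (forall p, p \in s -> prime_elt p) &
        a = u * \prod_(p <- s) p].

Lemma divides_refl a : divides a a.
Proof. by exists 1; rewrite mul1r. Qed.

Lemma divides0 a : divides a 0.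
Proof. by exists 0; rewrite mul0r. Qed.

Lemma divides_mull a b c : divides a b -> divides a (c * b).
Proof. by case=> d ->; exists (c * d); rewrite mulrA. Qed.

Lemma divides_mulr a b c : divides a b -> divides a (b * c).
Proof. by rewrite mulrC; apply: divides_mull. Qed.

Lemma dividesD a b c : divides a b -> divides a c -> divides a (b + c).
Proof. by case=> d -> [e ->]; exists (d + e); rewrite mulrDl. Qed.

Lemma dividesB a b c : divides a b -> divides a c -> divides a (b - c).
Proof. by case=> d -> [e ->]; exists (d - e); rewrite mulrBl. Qed.

Lemma divides_trans a b c : divides a b -> divides b c -> divides a c.
Proof. by case=> d -> [e ->]; exists (e * d); rewrite mulrA. Qed.

Lemma prime_ndiv_unit p u : prime_elt p -> u \is a GRing.unit -> ~ divides p u.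
Proof.
case=> _ pnu _ uu [c uE]; move: uu; rewrite uE unitrM => /andP [_ pu].
by rewrite pu in pnu.
Qed.

Lemma prime_ndivM p a b :
  prime_elt p -> ~ divides p a -> ~ divides p b -> ~ divides p (a * b).
Proof. by case=> _ _ h na nb /h []. Qed.

Lemma prime_ndivX p a n : prime_elt p -> ~ divides p a -> ~ divides p (a ^+ n).
Proof.
move=> pp na; elim: n => [|n IH]; first exact: prime_ndiv_unit (unitr1 _).
by rewrite exprS; apply: prime_ndivM.
Qed.

Lemma prime_div_prod p u s :
    prime_elt p -> u \is a GRing.unit -> (forall q, q \in s -> prime_elt q) ->
    divides p (u * \prod_(q <- s) q) ->
  exists q v, [/\ q \in s, v \is a GRing.unit & q = v * p].
Proof.
move=> pp uu; elim: s => [|q s IH] sp.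
  by rewrite big_nil mulr1 => /(prime_ndiv_unit pp uu).
rewrite big_cons mulrCA; case: (pp) => _ pnu pP /pP [[v qE]|].
  exists q, v; split=> //; first by rewrite inE eqxx.
  have [q0 qnu qP] := sp q (mem_head _ _).
  have /qP : divides q (v * p) by rewrite -qE; apply: divides_refl.
  case=> [[w vE]|[w pE]].
    have : q * (w * p) = q * 1 by rewrite mulr1 mulrA [q * w]mulrC -vE -qE.
    move/(mulfI q0) => wp1; case/negP: pnu.
    by apply/unitrP; exists w; split=> //; rewrite mulrC.
  have : q * (v * w) = q * 1 by rewrite mulr1 mulrA [q * v]mulrC -mulrA [q * w]mulrC -pE.
  move/(mulfI q0) => vw1; apply/unitrP; exists w; split=> //.
  by rewrite mulrC.
move/(IH (fun r rs => sp r (mem_behead (s := q :: s) rs))).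
by case=> r [v [rs vu rE]]; exists r, v; split=> //; rewrite inE rs orbT.
Qed.

Lemma prime_associate p q : prime_elt p -> prime_elt q -> divides p q ->
  exists2 v, v \is a GRing.unit & q = v * p.
Proof.
move=> pp qp pq; have [||r [v]] := @prime_div_prod p 1 [:: q] pp (unitr1 _).
- by move=> r; rewrite inE => /eqP ->.
- by rewrite big_seq1 mul1r.
by case; rewrite inE => /eqP -> vu qE; exists v.
Qed.

Hypothesis fD : factorial.

Lemma exists_prime_divisor a : a != 0 -> a \isn't a GRing.unit ->
  exists2 p, prime_elt p & divides p a.
Proof.
move=> a0 anu; have [u [[|p s] [uu sp aE]]] := fD a0.
  by rewrite aE big_nil mulr1 uu in anu.
exists p; first by apply: sp; rewrite mem_head.
by rewrite aE big_cons mulrCA; apply: divides_mulr; apply: divides_refl.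
Qed.

(** The prime factors of the denominator are cancelled one at a time. *)
Lemma reduced_fraction n m : m != 0 -> exists g n' m',
  [/\ n = n' * g, m = m' * g, g != 0 &
      forall p, prime_elt p -> divides p n' -> ~ divides p m'].
Proof.
move=> m0; have [u [s [uu sp mE]]] := fD m0.
elim: {s}(size s) {-2}s (erefl (size s)) sp m n u uu m0 mE => [|k IH] s sk sp m n u uu m0 mE.
  exists 1, n, m; rewrite !mulr1; split=> // [|p pp _ pm].
    exact: oner_neq0.
  move: mE; rewrite (size0nil sk) big_nil mulr1 => mE.
  by rewrite mE in pm; case: (prime_ndiv_unit pp uu).
have [[p [pp [n1 nE] pm]]|noP] :=
    EM (exists p, [/\ prime_elt p, divides p n & divides p m]); last first.
  exists 1, n, m; rewrite !mulr1; split=> // [|p pp pn pm].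
    exact: oner_neq0.
  by apply: noP; exists p.
have [q [v [qs vu qE]]] : exists q v, [/\ q \in s, v \is a GRing.unit & q = v * p].
  by apply: (prime_div_prod pp uu sp); rewrite -mE.
have p0 : p != 0 by case: pp.
pose s' := rem q s; pose m1 := u * v * \prod_(r <- s') r.
have mE1 : m = m1 * p.
  by rewrite mE (perm_big _ (perm_to_rem qs)) big_cons /= -/s' /m1 qE; ring.
have m10 : m1 != 0 by apply: contraNneq m0 => m10; rewrite mE1 m10 mul0r.
have [|r /mem_rem rs||g [n' [m' [n1E m1E g0 red]]]] :=
    IH s' _ _ m1 n1 (u * v) _ m10 erefl.
- by rewrite size_rem // sk.
- exact: sp.
- by rewrite unitrMl.
exists (g * p), n', m'; split=> //; last by rewrite mulf_neq0.
  by rewrite nE n1E mulrA.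
by rewrite mE1 m1E mulrA.
Qed.

End Divisibility.

Lemma field_factorial (F : fieldType) : factorial F.
Proof.
move=> a a0; exists a, [::]; split=> //; first by rewrite unitfE.
by rewrite big_nil mulr1.
Qed.

Section MinimalSize.
Variable D : nzRingType.

Lemma exists_min_size (P : {poly D} -> Prop) :
  (exists x, P x) -> exists2 x, P x & forall y, P y -> (size x <= size y)%N.
Proof.
case=> x0 Px0.
have ex : exists n, `[< exists2 x : {poly D}, P x & size x = n >].
  by exists (size x0); apply/asboolP; exists x0.
case: (ex_minnP ex) => n /asboolP [x Px xn] nmin.
by exists x => // y Py; rewrite xn; apply: nmin; apply/asboolP; exists y.
Qed.

End MinimalSize.

Section PolynomialDivisibility.
Variable D : idomainType.
Implicit Types (p c : D) (f g h : {poly D}).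

Lemma divides_polyC p f : (forall i, divides p f`_i) -> divides p%:P f.
Proof.
elim/poly_ind: f => [|f c IH] pf; first exact: divides0.
apply: dividesD.
  apply: divides_mulr; apply: IH => i.
  by have := pf i.+1; rewrite coefD coefMX coefC /= addr0.
have := pf 0%N; rewrite coefD coefMX coefC eqxx add0r => -[d ->].
by exists d%:P; rewrite polyCM.
Qed.

Lemma coef_divides p f i : divides p%:P f -> divides p f`_i.
Proof. by case=> g ->; exists g`_i; rewrite coefMC. Qed.

Lemma size_drop_lead f : f != 0 ->
  (size (f - lead_coef f *: 'X^((size f).-1))%R < size f)%N.
Proof.
move=> f0; have sf : (0 < size f)%N by rewrite size_poly_gt0.
rewrite -[ltnRHS](prednK sf) ltnS; apply/leq_sizeP => j jf.
rewrite coefB coefZ coefXn; case: eqP => [->|/eqP jn].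
  by rewrite mulr1 lead_coefE subrr.
rewrite mulr0 subr0 nth_default //.
by rewrite -[leqLHS](prednK sf) ltn_neqAle eq_sym jn.
Qed.

(** Discarding the leading terms that p divides, one may assume that p divides
    neither leading coefficient, hence not their product. *)
Lemma prime_polyC p : prime_elt p -> prime_elt p%:P.
Proof.
case=> p0 pnu pP; split; first by rewrite polyC_eq0.
  by rewrite poly_unitE coefC eqxx (negbTE pnu) andbF.
move=> f g pfg.
have [n] := ubnP (size f + size g)%N; elim: n => // n IH in f g pfg *.
rewrite ltnS => le_n.
have [->|f0] := eqVneq f 0; first by left; apply: divides0.
have [->|g0] := eqVneq g 0; first by right; apply: divides0.
have : divides p (lead_coef f * lead_coef g).
  by rewrite -lead_coefM lead_coefE; apply: coef_divides.
case/pP => -[c lcE].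
  have dl : divides p%:P (lead_coef f *: 'X^((size f).-1)).
    by exists (c *: 'X^((size f).-1)); rewrite lcE -!mul_polyC polyCM mulrAC.
  have [||h|h] := IH (f - lead_coef f *: 'X^((size f).-1)) g.
  - by rewrite mulrBl; apply: dividesB => //; apply: divides_mulr.
  - by apply: leq_trans le_n; rewrite ltn_add2r size_drop_lead.
  - by left; rewrite -[f](subrK (lead_coef f *: 'X^((size f).-1))); apply: dividesD.
  - by right.
have dl : divides p%:P (lead_coef g *: 'X^((size g).-1)).
  by exists (c *: 'X^((size g).-1)); rewrite lcE -!mul_polyC polyCM mulrAC.
have [||h|h] := IH f (g - lead_coef g *: 'X^((size g).-1)).
- by rewrite mulrBr; apply: dividesB => //; apply: divides_mull.
- by apply: leq_trans le_n; rewrite ltn_add2l size_drop_lead.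
- by left.
by right; rewrite -[g](subrK (lead_coef g *: 'X^((size g).-1))); apply: dividesD.
Qed.

Definition primitive f := forall p, prime_elt p -> ~ divides p%:P f.

Lemma primitive_factor f g h : primitive f -> f = g * h -> primitive h.
Proof. by move=> pf fE p pp ph; apply: (pf p pp); rewrite fE; apply: divides_mull. Qed.

(** Pseudo-division, with the remainder killed by the minimality of m. *)
Lemma minimal_size_divides (I : {poly D} -> Prop) m :
    (forall f g, I f -> I g -> I (f - g)) -> (forall f g, I f -> I (g * f)) ->
    I m -> m != 0 -> (forall f, I f -> f != 0 -> (size m <= size f)%N) ->
  forall f, I f -> exists2 c, c != 0 & divides m (c%:P * f).
Proof.
move=> IB IM Im m0 mmin f If.
have E := Pdiv.WeakIdomain.divp_eq f m.
exists (lead_coef m ^+ Pdiv.Idomain.scalp f m).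
  by rewrite expf_neq0 // lead_coef_eq0.
exists (Pdiv.Idomain.divp f m); rewrite mul_polyC E.
suff -> : Pdiv.Idomain.modp f m = 0 by rewrite addr0.
apply/eqP; apply: contraT => r0.
have Ir : I (Pdiv.Idomain.modp f m).
  have -> : Pdiv.Idomain.modp f m =
      (lead_coef m ^+ Pdiv.Idomain.scalp f m)%:P * f - Pdiv.Idomain.divp f m * m.
    by rewrite mul_polyC E addrC addKr.
  by apply: IB; apply: IM.
by have := mmin _ Ir r0; rewrite leqNgt Pdiv.Idomain.ltn_modpN0.
Qed.

End PolynomialDivisibility.

Section Gauss.
Variable D : idomainType.
Hypothesis fD : factorial D.
Implicit Types (p c : D) (f g h : {poly D}).

(** Gauss: the prime factors of c, which do not divide f, divide the cofactor. *)
Lemma primitive_divides_cancel f h c :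
  primitive f -> c != 0 -> divides f (c%:P * h) -> divides f h.
Proof.
move=> pf c0 [g gE]; have [u [s [uu sp cE]]] := fD c0.
have : exists g', \prod_(p <- s) p%:P * h = g' * f.
  exists ((u^-1)%:P * g); rewrite -mulrA -gE mulrA -polyCM cE mulrA mulVr // mul1r.
  by rewrite rmorph_prod.
elim: s sp {cE} => [|p s IH] sp [g' g'E].
  by exists g'; rewrite -g'E big_nil mul1r.
apply: IH => [q qs|]; first by apply: sp; rewrite inE qs orbT.
have pp := sp p (mem_head _ _).
have [p0 _ pP] := prime_polyC pp.
have : divides p%:P (g' * f).
  by rewrite -g'E big_cons -mulrA; apply: divides_mulr; apply: divides_refl.
case/pP => [[k kE]|/(pf _ pp) //].
exists k; apply: (mulfI p0); rewrite mulrA.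
by move: g'E; rewrite big_cons kE => ->; rewrite mulrCA mulrA.
Qed.

(** The leading coefficient bounds the number of primes that can be taken out of
    f: each of them divides it. *)
Lemma content f : f != 0 ->
  exists c f0, [/\ c != 0, primitive f0 & f = c%:P * f0].
Proof.
move=> f0; have lf0 : lead_coef f != 0 by rewrite lead_coef_eq0.
have [u [s [uu sp lE]]] := fD lf0.
elim: {s}(size s) {-2}s (erefl (size s)) sp f u uu lE f0 {lf0} => [|k IH] s sk sp f u uu lE f0.
  exists 1, f; rewrite mul1r oner_neq0; split=> // p pp /coef_divides => pf.
  have := pf (size f).-1; rewrite -lead_coefE lE (size0nil sk) big_nil mulr1.
  exact: prime_ndiv_unit.
have [pf|] := EM (primitive f); first by exists 1, f; rewrite mul1r oner_neq0.
move/existsNP => [p /not_implyP [pp /contrapT [f1 fE]]].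
have p0 : p != 0 by case: pp.
have lE1 : lead_coef f = lead_coef f1 * p by rewrite fE lead_coefM lead_coefC.
have : divides p (u * \prod_(q <- s) q) by rewrite -lE lE1; exists (lead_coef f1).
case/(prime_div_prod pp uu sp) => q [v [qs vu qE]].
have f10 : f1 != 0 by apply: contraNneq f0 => f10; rewrite fE f10 mul0r.
have [||||c [f2 [c0 pf2 f1E]]] := IH (rem q s) _ _ f1 (u * v) _ _ f10.
- by rewrite size_rem // sk.
- by move=> r /mem_rem rs; exact: sp.
- by rewrite unitrMl.
- apply: (mulIf p0); rewrite -lE1 lE (perm_big _ (perm_to_rem qs)) big_cons /=.
  by set s' := rem q s; rewrite qE; ring.
exists (p * c), f2; split=> //; first by rewrite mulf_neq0.
by rewrite fE f1E polyCM mulrC mulrA.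
Qed.

Lemma primitive_const c : primitive c%:P -> c != 0 -> c \is a GRing.unit.
Proof.
move=> pc c0; apply: contraT => cnu.
have [p pp [d cE]] := exists_prime_divisor fD c0 cnu.
by case: (pc p pp); exists d%:P; rewrite cE polyCM.
Qed.

(** Constant factors are left aside: for them the primitivity of f is the
    relevant condition. *)
Definition irreducible_in_degree f :=
  forall g h, f = g * h -> (size g <= 1)%N \/ (size h <= 1)%N.

(** The ideal generated by f and g has an element m of minimal size, and the
    primitive part of m divides both of them; so it is a constant. *)
Lemma primitive_bezout f g : primitive f -> irreducible_in_degree f ->
    f != 0 -> ~ divides f g ->
  exists d a b, d != 0 /\ d%:P = a * f + b * g.
Proof.
move=> pf irr f0 nfg.
pose I x := exists a b, x = a * f + b * g.
have IB x y : I x -> I y -> I (x - y).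
  case=> a [b ->] [a' [b' ->]]; exists (a - a'), (b - b'); ring.
have IM x y : I x -> I (y * x).
  case=> a [b ->]; exists (y * a), (y * b); ring.
have If : I f by exists 1, 0; ring.
have Ig : I g by exists 0, 1; ring.
have [|m [Im m0] mmin] := @exists_min_size _ (fun x => I x /\ x != 0).
  by exists f.
have dm := minimal_size_divides IB IM Im m0 (fun x Ix x0 => mmin x (conj Ix x0)).
have [e [m1 [e0 pm1 mE]]] := content m0.
have dm1 x : I x -> divides m1 x.
  move=> /dm [c c0 mx]; apply: (primitive_divides_cancel pm1 c0).
  by apply: divides_trans mx; exists e%:P.
have [k fE] := dm1 f If.
have [sk|sm1] := irr _ _ fE.
  case: nfg; have kE := size1_polyC sk; have k0 : k`_0 != 0.
    by apply: contraNneq f0 => k0; rewrite fE kE k0 polyC0 mul0r.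
  have ku : k`_0 \is a GRing.unit.
    apply: primitive_const => //; rewrite -kE.
    by apply: (primitive_factor pf (g := m1)); rewrite mulrC.
  apply: divides_trans (dm1 g Ig); exists ((k`_0)^-1)%:P.
  by rewrite fE {2}kE mulrA -polyCM mulVr // mul1r.
have m1E := size1_polyC sm1.
have [a [b abE]] := Im.
exists (e * m1`_0), a, b; split; last by rewrite polyCM -m1E -mE.
by apply: contraNneq m0 => d0; rewrite mE m1E -polyCM d0.
Qed.

(** If f divides g h but not g, a Bezout identity for f and g shows that f
    divides a nonzero constant multiple of h. *)
Lemma primitive_irreducible_prime f : (1 < size f)%N -> primitive f ->
  irreducible_in_degree f -> prime_elt f.
Proof.
move=> sf pf irr.
have f0 : f != 0 by rewrite -size_poly_gt0 (leq_trans _ sf).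
split=> //; first by rewrite poly_unitE; case: (size f) sf => [|[]].
move=> g h fgh; have [|nfg] := EM (divides f g); [by left | right].
have [d [a [b [d0 dE]]]] := primitive_bezout pf irr f0 nfg.
apply: (primitive_divides_cancel pf d0); rewrite dE.
have -> : (a * f + b * g) * h = (a * h) * f + b * (g * h) by ring.
by apply: dividesD; apply: divides_mull => //; apply: divides_refl.
Qed.

Lemma prime_bezout f g : (1 < size f)%N -> prime_elt f -> ~ divides f g ->
  exists d a b, d != 0 /\ d%:P = a * f + b * g.
Proof.
move=> sf [f0 fnu fP].
have cofactor a b : f = a * b -> divides f a -> b \is a GRing.unit.
  move=> E [l aE]; apply/unitrP; exists l; rewrite [b * l]mulrC.
  suff -> : l * b = 1 by [].
  by apply: (mulIf f0); rewrite mulrAC -aE -E mul1r.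
apply: primitive_bezout => //.
  move=> p pp [k fE]; have [p0 pnu _] := prime_polyC pp.
  have : divides f (k * p%:P) by rewrite -fE; apply: divides_refl.
  case/fP => [/(cofactor _ _ fE)|]; first by rewrite (negbTE pnu).
  rewrite mulrC in fE; move=> /(cofactor _ _ fE); rewrite poly_unitE => /andP [/eqP sk _].
  by move: sf; rewrite fE size_Cmul ?sk // -polyC_eq0.
move=> a b E; have : divides f (a * b) by rewrite -E; apply: divides_refl.
case/fP => [/(cofactor _ _ E)|]; first by rewrite poly_unitE => /andP [/eqP ->]; right.
by rewrite mulrC in E; move=> /(cofactor _ _ E); rewrite poly_unitE => /andP [/eqP ->]; left.
Qed.

Lemma prime_linear (b0 b1 : D) : b1 != 0 ->
  (forall p, prime_elt p -> divides p b0 -> ~ divides p b1) ->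
  prime_elt (b0%:P + b1 *: 'X).
Proof.
move=> b10 cop.
have sz : size (b0%:P + b1 *: 'X) = 2%N.
  rewrite addrC size_polyDl; first by rewrite size_scale // size_polyX.
  by rewrite size_scale // size_polyX size_polyC; case: (b0 != 0).
apply: primitive_irreducible_prime; first by rewrite sz.
  move=> p pp dp; apply: (cop p pp).
    by have := coef_divides 0 dp; rewrite coefD coefC coefZ coefX mulr0 addr0.
  by have := coef_divides 1 dp; rewrite coefD coefC coefZ coefX mulr1 add0r.
move=> g h E; have : g * h != 0 by rewrite -E -size_poly_gt0 sz.
rewrite mulf_eq0 negb_or -!size_poly_gt0 => /andP [g0 h0].
have := sz; rewrite E size_mul -?size_poly_gt0 // .
move: g0 h0; case: (size g) (size h) => [|[|m]] [|[|n]] //; auto.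
by rewrite addSn addSn addnS addnS.
Qed.

(** Gauss: primitive polynomials are factored by induction on the degree, down
    to those that have no factor of smaller positive degree, which are prime. *)
Theorem factorial_poly : factorial {poly D}.
Proof.
have lift_prod (s : seq D) : (forall p, p \in s -> prime_elt p) ->
    forall P, P \in [seq p%:P | p <- s] -> prime_elt P.
  by move=> sp P /mapP [p ps ->]; apply/prime_polyC/sp.
suff prim f : f != 0 -> primitive f -> exists (u : {poly D}) (s : seq {poly D}),
    [/\ u \is a GRing.unit, (forall p : {poly D}, p \in s -> prime_elt p) &
        f = u * \prod_(p <- s) p].
  move=> f f0; have [c [f1 [c0 pf1 fE]]] := content f0.
  have [|u [s [uu sp f1E]]] := prim f1 _ pf1.
    by apply: contraNneq f0 => f10; rewrite fE f10 mulr0.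
  have [v [r [vu rp cE]]] := fD c0.
  exists (v%:P * u), ([seq p%:P | p <- r] ++ s); split.
  - by rewrite unitrMl // rmorph_unit.
  - by move=> p; rewrite mem_cat => /orP [/(lift_prod _ rp)|/sp].
  by rewrite fE f1E cE big_cat big_map /= polyCM rmorph_prod; ring.
have [n] := ubnP (size f); elim: n => // n IH in f *.
rewrite ltnS => fn f0 pf.
have [sf|sf] := leqP (size f) 1.
  exists f, [::]; split=> //; last by rewrite big_nil mulr1.
  have fE := size1_polyC sf.
  rewrite fE rmorph_unit // primitive_const // -?fE //.
  by apply: contraNneq f0 => f00; rewrite fE f00.
have [irr|] := EM (irreducible_in_degree f).
  exists 1, [:: f]; split; first exact: unitr1.
    by move=> p; rewrite inE => /eqP ->; apply: primitive_irreducible_prime.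
  by rewrite mul1r big_seq1.
move=> /existsNP [g /existsNP [h /not_implyP [fE /not_orP []]]].
move=> /negP; rewrite -ltnNge => sg /negP; rewrite -ltnNge => sh.
have g0 : g != 0 by rewrite -size_poly_gt0 (leq_trans _ sg).
have h0 : h != 0 by rewrite -size_poly_gt0 (leq_trans _ sh).
have sE : size f = (size g + size h).-1 by rewrite fE size_mul.
have [|||u [s [uu sp gE]]] := IH g => //.
- apply: leq_trans fn; rewrite sE; move: sh.
  by case: (size h) => [|[|b]] // _; rewrite !addnS ltnS leq_addr.
- by apply: (primitive_factor pf (g := h)); rewrite mulrC.
have [|||v [r [vu rp hE]]] := IH h => //.
- apply: leq_trans fn; rewrite sE; move: sg.
  by case: (size g) => [|[|b]] // _; rewrite !addSn ltnS leq_addl.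
- exact: primitive_factor pf fE.
exists (u * v), (s ++ r); split.
- by rewrite unitrMl.
- by move=> p; rewrite mem_cat => /orP [/sp|/rp].
by rewrite fE gE hE big_cat /=; ring.
Qed.

End Gauss.

(** * Polynomials and rational functions in two variables *)

Local Notation "x %:F" := (tofrac x).

Lemma exists_nonroot (C : numClosedFieldType) (p : {poly C}) :
  p != 0 -> exists x, p.[x] != 0.
Proof.
move=> p0; apply: contrapT => h.
have roots : all (root p) [seq n%:R | n <- iota 0 (size p)].
  apply/allP => x _; apply/rootP; apply: contrapT => /eqP px.
  by apply: h; exists x.
have /(_ _) := max_poly_roots p0 roots.
rewrite size_map size_iota ltnn map_inj_uniq ?iota_uniq => [/(_ isT) //|].
by move=> m n /eqP; rewrite Num.Theory.eqr_nat => /eqP.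
Qed.

Lemma fraction_repr (R : idomainType) (u : {fraction R}) :
  u = (\n_(repr u))%:F / (\d_(repr u))%:F.
Proof.
suff piE x : (\pi_{fraction R} x)%qT = (\n_x)%:F / (\d_x)%:F.
  by rewrite -piE reprK.
apply: (mulIf (x := (\d_x)%:F)); first by rewrite tofrac_eq0 denom_ratioP.
rewrite divfK ?tofrac_eq0 ?denom_ratioP //.
rewrite -[LHS]/(FracField.mul _ _) !generic_quotient.piE; apply/eqmodP.
rewrite /= FracField.equivfE /FracField.mulf.
by rewrite !numden_Ratio ?mulf_neq0 ?oner_neq0 ?denom_ratioP // !mulr1 mulrC.
Qed.

Lemma fraction_numden (R : idomainType) (u : {fraction R}) :
  exists n d, d != 0 /\ u = n%:F / d%:F.
Proof.
exists \n_(repr u), \d_(repr u); split; first exact: denom_ratioP.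
exact: fraction_repr.
Qed.

Lemma frac_eq (R : idomainType) (n m n' m' : R) : m != 0 -> m' != 0 ->
  n%:F / m%:F = n'%:F / m'%:F -> n * m' = n' * m.
Proof.
move=> m0 m'0 /eqP; rewrite eqr_div ?tofrac_eq0 // -!tofracM tofrac_eq.
by move/eqP.
Qed.

Lemma subf_div (F : fieldType) (x y z t : F) : y != 0 -> t != 0 ->
  x / y - z / t = (x * t - z * y) / (y * t).
Proof. by move=> y0 t0; rewrite -mulNr addf_div // mulNr. Qed.

Lemma eq_frac (R : idomainType) (n m n' m' : R) : m != 0 -> m' != 0 ->
  n * m' = n' * m -> n%:F / m%:F = n'%:F / m'%:F.
Proof.
move=> m0 m'0 E; apply/eqP; rewrite eqr_div ?tofrac_eq0 // -!tofracM tofrac_eq.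
exact/eqP.
Qed.

Lemma fracB (R : idomainType) (n m n' m' : R) : m != 0 -> m' != 0 ->
  n%:F / m%:F - n'%:F / m'%:F = (n * m' - n' * m)%:F / (m * m')%:F.
Proof.
by move=> m0 m'0; rewrite subf_div ?tofrac_eq0 // -!rmorphM -rmorphB.
Qed.

Lemma fracD (R : idomainType) (n m n' m' : R) : m != 0 -> m' != 0 ->
  n%:F / m%:F + n'%:F / m'%:F = (n * m' + n' * m)%:F / (m * m')%:F.
Proof.
by move=> m0 m'0; rewrite addf_div ?tofrac_eq0 // -!rmorphM -rmorphD.
Qed.

Lemma fracM (R : idomainType) (n m n' m' : R) :
  n%:F / m%:F * (n'%:F / m'%:F) = (n * n')%:F / (m * m')%:F.
Proof. by rewrite mulf_div -!rmorphM. Qed.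

Section Bivariate.
Variable C : numClosedFieldType.
Local Notation C2 := {poly {poly C}}.
Local Notation Fr := {fraction C2}.
Implicit Types (a b m n p q : C2) (x y z : C).

Lemma factorial_C2 : factorial C2.
Proof. exact/factorial_poly/factorial_poly/field_factorial. Qed.

(** The first variable is the outer one. *)
Definition value x y : C2 -> C := horner_eval y \o horner_eval x%:P.

HB.instance Definition _ x y := GRing.RMorphism.on (value x y).

Lemma valueE x y a : value x y a = (map_poly (horner_eval y) a).[x].
Proof.
transitivity (map_poly (horner_eval y) a).[horner_eval y x%:P].
  by rewrite horner_map.
by congr (_.[_]); apply: hornerC.
Qed.

Lemma map_horner_eq0 y a :
  map_poly (horner_eval y) a = 0 -> divides ('X - y%:P)%:P a.
Proof.
move=> a0; apply: divides_polyC => i.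
have /factor_theorem [d ->] : root a`_i y by
  rewrite /root -/(horner_eval y _) -coef_map a0 coef0.
by exists d.
Qed.

Lemma exists_nonzero_value a : a != 0 -> exists x y, value x y a != 0.
Proof.
move=> a0; have l0 : lead_coef a != 0 by rewrite lead_coef_eq0.
have [y ly] := exists_nonroot l0.
have [|x ax] := @exists_nonroot _ (map_poly (horner_eval y) a).
  by apply: contraNneq ly => /(congr1 (fun q : {poly C} => q`_((size a).-1)));
    rewrite coef_map coef0 /= -lead_coefE => /eqP.
by exists x, y; rewrite valueE.
Qed.

(** A weak Nullstellensatz for plane curves: eliminating the first variable between
    p and q leaves a nonzero polynomial in the second one. *)
Lemma prime_zero p q : prime_elt p -> ~ divides p q ->
  exists x y, value x y p = 0 /\ value x y q != 0.
Proof.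
move=> pp npq; have [p0 pnu pP] := pp.
have [sp|sp] := leqP (size p) 1.
  have pE := size1_polyC sp; set c := p`_0 in pE.
  have c0 : c != 0 by rewrite -polyC_eq0 -pE.
  have sc : size c != 1%N.
    apply: contraNneq pnu => sc; rewrite pE rmorph_unit // poly_unitE sc eqxx.
    by rewrite unitfE -{1}[0%N]/(1.-1) -sc -lead_coefE lead_coef_eq0.
  have [y /factor_theorem [d cE]] := closed_rootP _ sc.
  have q0 : map_poly (horner_eval y) q != 0.
    apply/eqP => /map_horner_eq0 yq; apply: npq.
    apply: divides_trans yq; have : divides p (d%:P * ('X - y%:P)%:P).
      by rewrite -polyCM -cE -pE; apply: divides_refl.
    case/pP => // -[e]; rewrite pE cE => dE.
    have d0 : d != 0 by apply: contraNneq c0 => d0; rewrite cE d0 mul0r.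
    have : e * ('X - y%:P)%:P = 1.
      apply: (mulfI (x := d%:P)); first by rewrite polyC_eq0.
      by rewrite mulr1 mulrCA -polyCM -dE.
    move=> E; have : (('X - y%:P)%:P : C2) \is a GRing.unit.
      by apply/unitrP; exists e; rewrite [_%:P * e]mulrC E.
    by rewrite poly_unitE coefC eqxx /= poly_unitE size_XsubC andbF.
  have [x qx] := exists_nonroot q0.
  exists x, y; rewrite !valueE; split=> //.
  by rewrite pE map_polyC hornerC /= /horner_eval cE hornerM hornerXsubC subrr mulr0.
have [d [a [b [d0 dE]]]] :=
  prime_bezout (factorial_poly (@field_factorial C)) sp pp npq.
have [|y] := @exists_nonroot _ (d * lead_coef p).
  by rewrite mulf_neq0 // lead_coef_eq0.
rewrite hornerM mulf_eq0 negb_or => /andP [dy ly].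
have sy : size (map_poly (horner_eval y) p) = size p.
  by rewrite size_map_poly_id0.
have [|x /rootP px] := closed_rootP (map_poly (horner_eval y) p) _.
  by rewrite sy; case: (size p) sp => [|[]].
have pxy : value x y p = 0 by rewrite valueE.
exists x, y; split=> //; apply: contraNneq dy => qxy.
have := congr1 (value x y) dE; rewrite rmorphD !rmorphM /= pxy qxy !mulr0 addr0.
by rewrite valueE map_polyC hornerC /= /horner_eval => ->.
Qed.

(** The fraction u belongs to the local ring of the point (x, y), and takes the
    value v there. *)
Definition has_value x y (u : Fr) (v : C) : Prop := exists n m,
  [/\ value x y m != 0, u = n%:F / m%:F & v = value x y n / value x y m].

Lemma value_neq0 x y m : value x y m != 0 -> m != 0.
Proof. by apply: contraNneq => ->; rewrite rmorph0. Qed.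

Lemma has_value_inj x y u v v' : has_value x y u v -> has_value x y u v' -> v = v'.
Proof.
case=> n [m [m0 -> ->]] [n' [m' [m'0 E ->]]].
have {}E := frac_eq (value_neq0 m0) (value_neq0 m'0) E.
by apply/eqP; rewrite eqr_div // -!rmorphM E.
Qed.

Lemma has_value_tofrac x y a : has_value x y a%:F (value x y a).
Proof. by exists a, 1; rewrite rmorph1 oner_neq0 tofrac1 !divr1. Qed.

Lemma has_valueB x y u v u' v' : has_value x y u v -> has_value x y u' v' ->
  has_value x y (u - u') (v - v').
Proof.
case=> n [m [m0 -> ->]] [n' [m' [m'0 -> ->]]].
have m0' := value_neq0 m0; have m'0' := value_neq0 m'0.
exists (n * m' - n' * m), (m * m'); split; first by rewrite rmorphM mulf_neq0.
  by rewrite fracB.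
by rewrite rmorphB !rmorphM subf_div.
Qed.

Lemma has_valueM x y u v u' v' : has_value x y u v -> has_value x y u' v' ->
  has_value x y (u * u') (v * v').
Proof.
case=> n [m [m0 -> ->]] [n' [m' [m'0 -> ->]]].
exists (n * n'), (m * m'); split; first by rewrite rmorphM mulf_neq0.
  by rewrite fracM.
by rewrite !rmorphM mulf_div.
Qed.

(** Two distinct fractions would take distinct values at a point where g, their
    denominators and the numerator of their difference do not vanish. *)
Lemma eq_of_values g u u' : g != 0 ->
    (forall x y, value x y g != 0 -> exists2 v, has_value x y u v & has_value x y u' v) ->
  u = u'.
Proof.
move=> g0 h; have [x [y gxy]] := exists_nonzero_value g0.
have [_ [n [m [m0 uE _]]] [n' [m' [m'0 u'E _]]]] := h x y gxy.
have {}m0 := value_neq0 m0; have {}m'0 := value_neq0 m'0.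
rewrite uE u'E; apply/eqP; rewrite eqr_div ?tofrac_eq0 // -!tofracM tofrac_eq.
rewrite -subr_eq0; apply: contraT => d0.
have [|s [t]] := @exists_nonzero_value (g * m * m' * (n * m' - n' * m)).
  by rewrite !mulf_neq0.
rewrite !rmorphM !mulf_eq0 !negb_or rmorphB !rmorphM.
move=> /andP [/andP [/andP [gst mst] m'st]] /eqP []; apply/eqP; rewrite subr_eq0.
have [v uv u'v] := h s t gst.
have vE : has_value s t u (value s t n / value s t m) by exists n, m.
have vE' : has_value s t u' (value s t n' / value s t m') by exists n', m'.
rewrite -eqr_div //; apply/eqP.
by rewrite (has_value_inj vE uv) (has_value_inj vE' u'v).
Qed.

(** In lowest terms, a prime factor of the denominator vanishes at a point where g
    does not, unless it divides g; no value is possible there. *)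
Lemma reduced_denominator g u :
    (forall x y, value x y g != 0 -> exists v, has_value x y u v) ->
  exists n m, [/\ m != 0, u = n%:F / m%:F,
    (forall p, prime_elt p -> divides p n -> ~ divides p m) &
    forall p, prime_elt p -> divides p m -> divides p g].
Proof.
move=> h; have [N [M [M0 uE]]] := fraction_numden u.
have [d [n [m [NE ME d0 red]]]] := reduced_fraction factorial_C2 N M0.
have m0 : m != 0 by apply: contraNneq M0 => m0; rewrite ME m0 mul0r.
have unE : u = n%:F / m%:F.
  by rewrite uE NE ME !tofracM -mulf_div divff ?mulr1 // tofrac_eq0.
exists n, m; split=> // p pp pm; apply: contrapT => npg.
have [x [y [pxy gxy]]] := prime_zero pp npg.
have [v [n' [m' [m'0 uE' _]]]] := h x y gxy.
have E : n * m' = n' * m.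
  by apply: frac_eq => //; [exact: value_neq0 m'0 | rewrite -unE].
have [_ _ pP] := pp; have : divides p (n * m').
  by rewrite E; apply: divides_mull.
case/pP => [pn|[k m'E]]; first exact: red pp pn pm.
by move: m'0; rewrite m'E rmorphM /= pxy mulr0 eqxx.
Qed.

End Bivariate.

(** * Derivations and valuations of fields of fractions *)

Definition derivation (R : comNzRingType) (d : R -> R) : Prop :=
  (forall a b, d (a - b) = d a - d b) /\
  (forall a b, d (a * b) = d a * b + a * d b).

Section Derivations.
Variables (E : comNzRingType) (d : E -> E).
Hypothesis dP : derivation d.
Implicit Types x y : E.

Lemma derivSub x y : d (x - y) = d x - d y. Proof. by case: dP. Qed.
Lemma derivMul x y : d (x * y) = d x * y + x * d y. Proof. by case: dP. Qed.

Lemma deriv_0 : d 0 = 0.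
Proof. by have := derivSub 0 0; rewrite !subrr. Qed.

Lemma derivOpp x : d (- x) = - d x.
Proof. by rewrite -sub0r derivSub deriv_0 sub0r. Qed.

Lemma derivAdd x y : d (x + y) = d x + d y.
Proof. by rewrite -[y in LHS]opprK derivSub derivOpp opprK. Qed.

Lemma deriv_1 : d 1 = 0.
Proof.
have := derivMul 1 1; rewrite !mul1r mulr1 => /eqP.
by rewrite eq_sym -subr_eq0 addrK => /eqP.
Qed.

Lemma deriv_nat n : d n%:R = 0.
Proof. by elim: n => [|n IH]; rewrite ?deriv_0 // -addn1 natrD derivAdd IH deriv_1 addr0. Qed.

End Derivations.

Section FractionDerivation.
Variables (R : idomainType) (d : R -> R).
Hypothesis dP : derivation d.
Implicit Types (u v : {fraction R}) (n m : R).

Definition frac_der u : {fraction R} :=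
  let n := \n_(repr u) in let m := \d_(repr u) in
  (d n * m - n * d m)%:F / (m ^+ 2)%:F.

Lemma frac_derE n m : m != 0 ->
  frac_der (n%:F / m%:F) = (d n * m - n * d m)%:F / (m ^+ 2)%:F.
Proof.
move=> m0; rewrite /frac_der; have := fraction_repr (n%:F / m%:F).
have : \d_(repr (n%:F / m%:F)) != 0 by exact: denom_ratioP.
move: \n_(repr _) \d_(repr _) => n' m' m'0 /(frac_eq m0 m'0) E.
apply/eqP; rewrite eqr_div ?tofrac_eq0 ?expf_neq0 // -!tofracM tofrac_eq.
apply/eqP; case: dP => _ dM; have dE := congr1 d E; rewrite !dM in dE.
have -> : (d n * m - n * d m) * m' ^+ 2 =
    (d n * m' + n * d m') * m * m' - (n * m') * (d m * m' + m * d m') by ring.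
by rewrite E dE; ring.
Qed.

Lemma derivation_frac_der : derivation frac_der.
Proof.
case: dP => dB dM; split=> u v; have [n [m [m0 ->]]] := fraction_numden u;
  have [n' [m' [m'0 ->]]] := fraction_numden v.
  rewrite fracB // !frac_derE ?mulf_neq0 // fracB ?expf_neq0 //.
  by apply: eq_frac; rewrite ?mulf_neq0 ?expf_neq0 ?mulf_neq0 // dB !dM; ring.
rewrite fracM !frac_derE ?mulf_neq0 // !fracM fracD ?mulf_neq0 ?expf_neq0 //.
by apply: eq_frac; rewrite ?mulf_neq0 ?expf_neq0 ?mulf_neq0 // !dM; ring.
Qed.

Lemma frac_der_tofrac n : frac_der n%:F = (d n)%:F.
Proof.
rewrite -{1}[n%:F]divr1 -[1 in LHS]tofrac1 frac_derE ?oner_neq0 //.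
by rewrite (deriv_1 dP) mulr0 subr0 mulr1 expr1n tofrac1 divr1.
Qed.

End FractionDerivation.

Section Valuation.
Variables (R : idomainType) (p : R).
Hypothesis pp : prime_elt p.
Implicit Types (u v : {fraction R}) (k l : nat).

(** The valuation of u at p is at least k. *)
Definition val_ge k u : Prop :=
  exists n m, ~ divides p m /\ u = (p ^+ k * n)%:F / m%:F.

Let p0 : p != 0. Proof. by case: pp. Qed.
Let nz m : ~ divides p m -> m != 0.
Proof. by move=> npm; apply/eqP => m0; apply: npm; rewrite m0; apply: divides0. Qed.

Lemma val_geB k u v : val_ge k u -> val_ge k v -> val_ge k (u - v).
Proof.
case=> n [m [pm ->]] [n' [m' [pm' ->]]].
exists (n * m' - n' * m), (m * m'); split; first exact: prime_ndivM.
by rewrite fracB ?nz //; congr (tofrac _ / _); ring.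
Qed.

Lemma val_geM k l u v : val_ge k u -> val_ge l v -> val_ge (k + l) (u * v).
Proof.
case=> n [m [pm ->]] [n' [m' [pm' ->]]].
exists (n * n'), (m * m'); split; first exact: prime_ndivM.
rewrite mulf_div -!rmorphM; congr (tofrac _ / _); rewrite exprD; ring.
Qed.

Lemma val_geW k l u : (l <= k)%N -> val_ge k u -> val_ge l u.
Proof.
move=> /subnK lk [n [m [pm ->]]]; exists (p ^+ (k - l) * n), m; split=> //.
by rewrite mulrA -exprD addnC lk.
Qed.

Lemma val_ge_tofrac k n : val_ge k n%:F -> divides (p ^+ k) n.
Proof.
case=> n' [m [pm E]].
have {E} : n * m = p ^+ k * n'.
  have := @frac_eq _ n 1 (p ^+ k * n') m (oner_neq0 _) (nz pm).
  by rewrite tofrac1 divr1 mulr1 => /(_ E).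
elim: k n n' => [|k IH] n n' E; first by exists n; rewrite expr0 mulr1.
have [_ _ pP] := pp; have : divides p (n * m).
  by rewrite E exprS -mulrA; apply: divides_mulr; apply: divides_refl.
case/pP => [[n1 nE]|/pm //].
have [|n2 n1E] := IH n1 n'.
  by apply: (mulfI p0); rewrite !mulrA [p * n1]mulrC -nE E exprS.
by exists n2; rewrite nE n1E exprSr mulrA.
Qed.

Lemma val_ge_fracE k n m : ~ divides p m ->
  val_ge k (n%:F / m%:F) <-> divides (p ^+ k) n.
Proof.
move=> pm; split=> [h|[n' ->]]; last by exists n', m; rewrite [p ^+ k * n']mulrC.
apply: val_ge_tofrac; rewrite -[n%:F](divfK (x := m%:F)) ?tofrac_eq0 ?nz //.
rewrite -[k]addn0; apply: val_geM => //; exists m, 1; rewrite expr0 mul1r tofrac1 divr1.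
by split=> //; apply: prime_ndiv_unit => //; apply: unitr1.
Qed.

Lemma val_ge_prime u v : val_ge 0 u -> val_ge 0 v -> val_ge 1 (u * v) ->
  val_ge 1 u \/ val_ge 1 v.
Proof.
case=> n [m [pm ->]] [n' [m' [pm' ->]]]; rewrite expr0 !mul1r mulf_div -!rmorphM.
move=> /(val_ge_fracE _ _ (prime_ndivM pp pm pm')); rewrite expr1.
by have [_ _ pP] := pp; case/pP => h; [left | right];
  apply/val_ge_fracE => //; rewrite expr1.
Qed.

(** The valuation is additive, and the valuation of u is at most 1. *)
Lemma val_ge_uniformizer u v : val_ge 0 u -> val_ge 0 v -> val_ge 2 (u * v) ->
  ~ val_ge 2 u -> val_ge 1 v.
Proof.
move=> u0 v0 uv2 nu2; have [|//|u1] := val_ge_prime v0 u0 _.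
  by rewrite mulrC; apply: val_geW uv2.
apply: contrapT => nv1.
case: u1 => n [m [pm uE]]; case: v0 => n' [m' [pm' vE]].
rewrite uE vE expr0 mul1r expr1 mulf_div -!rmorphM in uv2.
move: uv2 => /(val_ge_fracE _ _ (prime_ndivM pp pm pm')) [k E].
have [_ _ pP] := pp; have : divides p (n * n').
  exists k; apply: (mulfI p0); transitivity (p * n * n'); first by ring.
  by rewrite E; ring.
case/pP => [[n1 nE]|[n1 n'E]].
  by apply: nu2; rewrite uE; apply/val_ge_fracE => //; exists n1; rewrite nE expr2; ring.
apply: nv1; rewrite vE; apply/val_ge_fracE => //.
by exists n1; rewrite n'E expr0 mul1r expr1.
Qed.

Lemma val_ge_der d k u : derivation d -> val_ge k.+1 u -> val_ge k (frac_der d u).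
Proof.
move=> dP [n [m [pm ->]]]; rewrite frac_derE ?nz //.
have [dB dM] := dP.
have [c cE] : divides (p ^+ k) (d (p ^+ k.+1)).
  elim: k => [|k [c cE]]; first by exists (d (p ^+ 1)); rewrite expr0 mulr1.
  by exists (d p + c); rewrite exprS dM cE [p ^+ k.+1]exprS; ring.
exists (c * n * m + p * d n * m - p * n * d m), (m ^+ 2).
split; first exact: prime_ndivX.
by congr (tofrac _ / _); rewrite dM cE exprS; ring.
Qed.

End Valuation.

Section Substitution.
Variable C : numClosedFieldType.
Local Notation C2 := {poly {poly C}}.
Local Notation Fr := {fraction C2}.
Implicit Types (a b : C2) (X Y : Fr).

Lemma C2_ind (P : C2 -> Prop) :
    (forall c : C, P c%:P%:P) -> P 'X -> P 'X%:P ->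
    (forall a b, P a -> P b -> P (a + b)) ->
    (forall a b, P a -> P b -> P (a * b)) ->
  forall a, P a.
Proof.
move=> Pc PX PY PD PM a.
have PC (c : {poly C}) : P c%:P.
  elim/poly_ind: c => [|c e IH]; first by have := Pc 0.
  by rewrite polyCD polyCM; apply: PD => //; apply: PM.
elim/poly_ind: a => [|a c Pa]; first by have := PC 0.
by apply: PD => //; apply: PM.
Qed.

Definition const_frac (c : C) : Fr := (c%:P%:P)%:F.

HB.instance Definition _ :=
  GRing.RMorphism.copy const_frac (@tofrac C2 \o (@polyC _ \o @polyC C)).

Definition subst X Y : C2 -> Fr :=
  horner_eval X \o map_poly (horner_eval Y \o map_poly const_frac).

HB.instance Definition _ X Y := GRing.RMorphism.on (subst X Y).

Lemma substC X Y c : subst X Y c%:P%:P = const_frac c.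
Proof. by rewrite /subst /= map_polyC /= map_polyC /horner_eval !hornerC. Qed.

Lemma substX X Y : subst X Y 'X = X.
Proof. by rewrite /subst /= map_polyX /horner_eval hornerX. Qed.

Lemma substY X Y : subst X Y 'X%:P = Y.
Proof. by rewrite /subst /= map_polyC /= map_polyX /horner_eval hornerC hornerX. Qed.

Lemma valueC (x y c : C) : value x y c%:P%:P = c.
Proof. by rewrite /value /= /horner_eval !hornerC. Qed.

Lemma valueX (x y : C) : value x y 'X = x.
Proof. by rewrite /value /= /horner_eval hornerX hornerC. Qed.

Lemma valueY (x y : C) : value x y 'X%:P = y.
Proof. by rewrite /value /= /horner_eval hornerC hornerX. Qed.

Lemma has_valueD (x y : C) (u u' : Fr) v v' : has_value x y u v ->
  has_value x y u' v' -> has_value x y (u + u') (v + v').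
Proof.
move=> uv u'v'; rewrite -[u']opprK -[v']opprK; apply: has_valueB => //.
rewrite -[- u']sub0r -[- v']sub0r; apply: has_valueB => //.
by have := has_value_tofrac x y (0 : C2); rewrite tofrac0 rmorph0.
Qed.

Lemma has_value_subst x y X Y vX vY a : has_value x y X vX ->
  has_value x y Y vY -> has_value x y (subst X Y a) (value vX vY a).
Proof.
move=> hX hY; elim/C2_ind: a => [c||||].
- by rewrite substC valueC; have := has_value_tofrac x y (c%:P%:P); rewrite valueC.
- by rewrite substX valueX.
- by rewrite substY valueY.
- by move=> a b ha hb; rewrite !rmorphD; apply: has_valueD.
by move=> a b ha hb; rewrite !rmorphM; apply: has_valueM.
Qed.

Definition der_x : C2 -> C2 := deriv.
Definition der_y : C2 -> C2 := map_poly (@deriv C).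

Lemma derivation_x : derivation der_x.
Proof. by split=> a b; rewrite /der_x ?derivB ?derivM. Qed.

Lemma derivation_y : derivation der_y.
Proof.
split=> a b; rewrite /der_y; first by rewrite raddfB.
apply/polyP => i; rewrite coefD coef_map_id0 ?deriv0 // !coefM raddf_sum -big_split.
by apply: eq_bigr => j _; rewrite /= derivM !coef_map_id0 ?deriv0.
Qed.

Lemma der_yC (c : {poly C}) : der_y c%:P = c^`()%:P.
Proof.
apply/polyP => i; rewrite coef_map_id0 ?deriv0 // !coefC.
by case: eqP => // _; rewrite deriv0.
Qed.

Lemma der_yX : der_y 'X = 0.
Proof.
apply/polyP => i; rewrite coef_map_id0 ?deriv0 // coefX coef0.
by case: eqP => _; rewrite ?deriv0 // -[1]/(1%:P) derivC.
Qed.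

Lemma chain_rule (d : Fr -> Fr) X Y a : derivation d ->
    (forall c, d (const_frac c) = 0) ->
  d (subst X Y a) = subst X Y (der_x a) * d X + subst X Y (der_y a) * d Y.
Proof.
move=> dP d0; have dD := derivAdd dP; have dM := derivMul dP.
have [_ yM] := derivation_y; have [_ xM] := derivation_x.
elim/C2_ind: a => [c||||].
- by rewrite substC d0 /der_x der_yC !derivC polyC0 !rmorph0 !mul0r addr0.
- by rewrite substX der_yX /der_x derivX rmorph1 rmorph0 mul1r mul0r addr0.
- by rewrite substY der_yC /der_x !derivC derivX rmorph1 rmorph0 mul1r mul0r add0r.
- move=> a b IHa IHb; rewrite !(derivAdd derivation_x, derivAdd derivation_y) !rmorphD dD IHa IHb !mulrDl /=.
  by rewrite addrACA.
move=> a b IHa IHb; rewrite yM xM !rmorphD !rmorphM dM IHa IHb /=.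
rewrite !mulrDl !mulrDr addrACA; congr (_ + _ + (_ + _)).
- by rewrite mulrAC.
- by rewrite mulrA.
- by rewrite mulrAC.
- by rewrite mulrA.
Qed.

End Substitution.

(** * Prime ideals of the plane, and singular hypersurfaces *)

Lemma size_deriv_natU (D : idomainType) (f : {poly D}) :
    (forall n, (n.+1%:R : D) \is a GRing.unit) ->
  size f^`() = (size f).-1.
Proof.
move=> natU; have [sf|sf] := leqP (size f) 1.
  by rewrite (size1_polyC sf) derivC size_poly0 size_polyC; case: (f`_0 != 0).
have f0 : f != 0 by rewrite -size_poly_gt0 (leq_trans _ sf).
apply/eqP; rewrite eqn_leq; apply/andP; split.
  by rewrite -ltnS (prednK (ltnW sf)) lt_size_deriv.
case sE : (size f) sf => [|[|n]] // _; rewrite /= ltnNge; apply/negP => /leq_sizeP h.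
have := h n (leqnn _); rewrite coef_deriv -mulr_natr => /eqP.
have -> : f`_n.+1 = lead_coef f by rewrite lead_coefE sE.
rewrite mulf_eq0 lead_coef_eq0 (negbTE f0) /= => /eqP n0.
by have := natU n; rewrite n0 unitr0.
Qed.

Section PlaneIdeals.
Variable C : numClosedFieldType.
Local Notation C2 := {poly {poly C}}.
Variable I : C2 -> Prop.

Lemma natU_C n : (n.+1%:R : C) \is a GRing.unit.
Proof. by rewrite unitfE Num.Theory.pnatr_eq0. Qed.

Lemma natU_poly (D : idomainType) : (forall n, (n.+1%:R : D) \is a GRing.unit) ->
  forall n, (n.+1%:R : {poly D}) \is a GRing.unit.
Proof. by move=> natU n; rewrite -[1]/(1%:P) -polyCMn rmorph_unit // natU. Qed.

(** In characteristic zero, differentiating a nonzero polynomial often enough leads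
    to a nonzero constant. *)
Lemma der_closed_trivial : (forall a, I a -> I (der_x a)) ->
    (forall a, I a -> I (der_y a)) -> (forall c : C, I c%:P%:P -> c = 0) ->
  forall a, I a -> a = 0.
Proof.
move=> Ix Iy Ic a Ia; apply: contrapT => /eqP a0.
have [|b [Ib b0] bmin] := @exists_min_size _ (fun b => I b /\ b != 0).
  by exists a.
have sb : (size b <= 1)%N.
  rewrite leqNgt; apply/negP => sb.
  have s' : size (der_x b) = (size b).-1.
    exact/size_deriv_natU/natU_poly/natU_C.
  have := bmin (der_x b); rewrite s' -size_poly_gt0 s'.
  case: (size b) sb => [|[|n]] //= _ /(_ (conj (Ix _ Ib) isT)).
  by rewrite ltnn.
have bE := size1_polyC sb.
have [|c [Ic' c0] cmin] := @exists_min_size C (fun c => I c%:P /\ c != 0).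
  by exists b`_0; rewrite -bE; split=> //; rewrite -polyC_eq0 -bE.
have sc : (size c <= 1)%N.
  rewrite leqNgt; apply/negP => sc.
  have s' : size c^`() = (size c).-1 by exact/size_deriv_natU/natU_C.
  have := cmin c^`(); rewrite s' -size_poly_gt0 s' -der_yC.
  case: (size c) sc => [|[|n]] //= _ /(_ (conj (Iy _ Ic') isT)).
  by rewrite ltnn.
have cE := size1_polyC sc; move: Ic'; rewrite cE => /Ic c00.
by move: c0; rewrite cE c00 polyC0 eqxx.
Qed.

Hypothesis IB : forall a b, I a -> I b -> I (a - b).
Hypothesis IM : forall a b, I a -> I (b * a).
Hypothesis I1 : ~ I 1.
Hypothesis Iprime : forall a b, I (a * b) -> I a \/ I b.

Let IC (c : C) : c != 0 -> ~ I c%:P%:P.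
Proof.
move=> c0 /(IM (c^-1)%:P%:P); rewrite -!polyCM mulVf // => h; exact: I1.
Qed.

Let linear_factor (f : {rmorphism {poly C} -> C2}) (q : {poly C}) :
    (forall c, f c%:P = c%:P%:P) -> q != 0 -> I (f q) ->
  exists z, I (f ('X - z%:P)).
Proof.
move=> fC q0; have [r ->] := closed_field_poly_normal q.
rewrite -mul_polyC rmorphM fC => /Iprime [|]; first by move/IC => []; rewrite lead_coef_eq0.
elim: r => [|z r IH]; first by rewrite big_nil rmorph1.
by rewrite big_cons rmorphM => /Iprime [|/IH //]; exists z.
Qed.

(** A prime of height one is principal: either it contains some y - y0, or it has no
    element in y alone, and is generated by a primitive element of minimal degree in
    x. *)
Lemma curve_ideal_principal : (exists2 a, a != 0 & I a) ->
    (forall x0 y0 : C, I ('X - x0%:P%:P) -> ~ I ('X%:P - y0%:P%:P)) ->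
  exists2 h, prime_elt h & forall a, I a <-> divides h a.
Proof.
move=> [a0 a00 Ia0] noP.
suff [h [h0 Ih hI]] : exists h, [/\ h != 0, I h & forall a, I a -> divides h a].
  exists h.
    split=> // [|a b hab].
      apply/negP => hu; apply: I1; rewrite -(mulVr hu); exact: IM.
    have Iab : I (a * b) by case: hab => k ->; apply: IM.
    by case/Iprime: Iab => /hI; [left | right].
  by move=> a; split=> [/hI //|[k ->]]; apply: IM.
have [[y0 Iy0]|noy] := EM (exists y0 : C, I ('X - y0%:P)%:P).
  exists ('X - y0%:P)%:P; split=> // [|a Ia].
    by rewrite polyC_eq0 polyXsubC_eq0.
  pose q := map_poly (horner_eval y0) a.
  have /(divides_trans _) d : divides ('X - y0%:P)%:P (a - map_poly (@polyC C) q).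
    apply: map_horner_eq0; rewrite rmorphB /= -map_poly_comp /=.
    apply/polyP => i; rewrite coefB coef0 !coef_map /= -/(horner_eval _ _).
    by rewrite {2}/horner_eval hornerC subrr.
  have [q0|q0] := eqVneq q 0.
    have := map_horner_eq0 (y := y0) (a := a); exact.
  have Iq : I (map_poly (@polyC C) q).
    rewrite -[map_poly _ _](subKr a); apply: IB => //.
    have [k ->] := d _ (divides_refl _); exact: IM.
  have [|x0 Ix0] := @linear_factor (map_poly (@polyC C)) q _ q0 Iq.
    by move=> c; rewrite /= map_polyC.
  case: (noP x0 y0).
    by move: Ix0; rewrite rmorphB /= map_polyX map_polyC.
  by rewrite -polyCB.
have noC (c : {poly C}) : c != 0 -> ~ I c%:P.
  move=> c0 Ic; apply: noy; exact: (@linear_factor (@polyC _) c).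
have [|m [Im m0] mmin] := @exists_min_size _ (fun a => I a /\ a != 0).
  by exists a0.
have [c [h [c0 ph mE]]] := content (factorial_poly (@field_factorial C)) m0.
have Ih : I h by move: Im; rewrite mE => /Iprime [/(noC _ c0)|].
exists h; split=> // [|a Ia].
  by apply: contraNneq m0 => h0; rewrite mE h0 mulr0.
have [d d0 md] := minimal_size_divides IB IM Im m0 (fun x Ix x0 => mmin x (conj Ix x0)) Ia.
apply: (primitive_divides_cancel (factorial_poly (@field_factorial C)) ph d0).
by apply: divides_trans md; exists c%:P.
Qed.

End PlaneIdeals.

(** Let QQ be the prime ideal of the polynomials q such that P (phi q), where P
    and P2 stand for vanishing once and twice along a curve. Up to multipliers
    outside (h), QQ is generated by h and by a polynomial mu of minimal size
    among those of QQ that h does not divide. Since f' is in QQ, f is in the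
    square of QQ: the hypersurface f = 0 is singular along a curve. More
    precisely c1 f = mu b - h e with b and e in QQ, so that b / h = e / mu
    multiplies both h and mu into QQ: up to multipliers again, b / h is a root
    of the characteristic polynomial of a 2 x 2 matrix of polynomials. It is not
    itself a polynomial on the hypersurface: if c b = h g + w f, then h divides
    b (c1 c - w mu); but if h divided b it would divide c1 f, which is primitive
    up to c1, and c1 c - w mu is not even in QQ. *)
Section SingularHypersurface.
Variables (D : idomainType) (B : comPzRingType) (phi : {rmorphism {poly D} -> B}).
Hypothesis natU : forall n, (n.+1%:R : D) \is a GRing.unit.
Variables (f : {poly D}) (P P2 : B -> Prop) (h : D).
Hypothesis prim_f : primitive f.
Hypothesis ker_phi : forall q, phi q = 0 <-> divides f q.
Hypothesis PB : forall x y, P x -> P y -> P (x - y).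
Hypothesis PM : forall x y, P x -> P (y * x).
Hypothesis Pprime : forall x y, P (x * y) -> P x \/ P y.
Hypothesis P2M : forall x y, P x -> P y -> P2 (x * y).
Hypothesis prime_h : prime_elt h.
Hypothesis Ph : forall a, P (phi a%:P) <-> divides h a.
Hypothesis P2h : forall x, P2 (phi h%:P * x) -> P x.
Hypothesis Pf' : P (phi f^`()).

Lemma singular_not_normal : exists (beta : B) (q1 q2 q3 : {poly D}),
  let eta := phi h%:P in
  [/\ exists q, beta = phi q,
      (beta - phi q1 * eta) * (beta - phi q2 * eta) = phi q3 * eta ^+ 2 &
      forall g, beta <> phi g * eta].
Proof.
pose Q q := P (phi q).
have QB q r : Q q -> Q r -> Q (q - r) by move=> Qq Qr; rewrite /Q rmorphB; apply: PB.
have QD q r : Q q -> Q r -> Q (q + r).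
  move=> Qq Qr; rewrite -[r]opprK; apply: (QB) => //; rewrite -sub0r.
  by apply: (QB) => //; rewrite -(subrr q); apply: QB.
have QM q r : Q q -> Q (r * q) by move=> Qq; rewrite /Q rmorphM; apply: PM.
have QMr q r : Q q -> Q (q * r) by rewrite mulrC; apply: QM.
have Qh : Q h%:P by apply/Ph; apply: divides_refl.
have QH q : divides h%:P q -> Q q by case=> k ->; apply: QM.
have ph := prime_polyC prime_h.
have Qf : Q f by rewrite /Q (ker_phi f).2; [rewrite -(subrr (phi h%:P)); apply: PB | apply: divides_refl].
have [|mu [Qmu nmu] mu_min] := @exists_min_size _ (fun q => Q q /\ ~ divides h%:P q).
  by exists f; split=> //; apply: prim_f.
have small q : Q q -> (size q < size mu)%N -> divides h%:P q.
  move=> Qq sq; apply: contrapT => nq; have := mu_min q (conj Qq nq).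
  by rewrite leqNgt sq.
have mu0 : mu != 0 by apply/eqP => mu0; apply: nmu; rewrite mu0; apply: divides0.
have lmu : ~ divides h (lead_coef mu).
  case=> k lE; have dl : divides h%:P (lead_coef mu *: 'X^((size mu).-1)).
    by exists (k *: 'X^((size mu).-1)); rewrite lE -!mul_polyC polyCM mulrAC.
  apply: nmu; rewrite -[mu](subrK (lead_coef mu *: 'X^((size mu).-1))).
  apply: dividesD => //; apply: small; last exact: size_drop_lead.
  by apply: QB => //; apply: QH.
have smu : (1 < size mu)%N.
  rewrite ltnNge; apply/negP => /size1_polyC muE; apply: nmu.
  move: Qmu; rewrite muE => /Ph [k ->]; exists k%:P; exact: polyCM.
have division q : Q q -> exists c a r,
    ~ divides h c /\ c%:P * q = mu * a + h%:P * r.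
  move=> Qq; have E := Pdiv.WeakIdomain.divp_eq q mu.
  set l := lead_coef mu ^+ _ in E.
  have [r rE] : divides h%:P (Pdiv.Idomain.modp q mu).
    apply: small; last by rewrite Pdiv.Idomain.ltn_modpN0.
    have -> : Pdiv.Idomain.modp q mu = l%:P * q - Pdiv.Idomain.divp q mu * mu.
      by rewrite mul_polyC E addrC addKr.
    by apply: QB; apply: QM.
  exists l, (Pdiv.Idomain.divp q mu), r; split; first exact: prime_ndivX.
  by rewrite mul_polyC E rE; ring.
(* b belongs to QQ: differentiate c1 f = mu b + h r; the derivative of mu is too
   small to be in QQ. *)
have [c1 [b [r [nc1 fE]]]] := division f Qf.
have Qb : Q b.
  have : Q (mu^`() * b).
    have -> : mu^`() * b = c1%:P * f^`() - (b^`() * mu + r^`() * h%:P).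
      have := congr1 (fun q => q^`()) fE; rewrite derivD !derivM !derivC !mul0r !add0r => ->.
      by ring.
    by apply: QB; [apply: QM | apply: QD; apply: QM].
  rewrite /Q rmorphM => /Pprime [Qmu'|//]; case: lmu.
  have /(coef_divides (size mu).-2) : divides h%:P mu^`().
    by apply: small => //; apply: lt_size_deriv.
  rewrite coef_deriv -mulr_natr; have [_ _ hP] := prime_h; case/hP => [|h'].
    by rewrite lead_coefE; case: (size mu) smu => [|[|n]].
  by case: (prime_ndiv_unit prime_h (natU (size mu).-2)).
pose e := - r.
have muE : phi mu * phi b = phi h%:P * phi e.
  rewrite -!rmorphM; apply/eqP; rewrite -subr_eq0 -rmorphB; apply/eqP/ker_phi.
  exists c1%:P; rewrite fE /e; ring.
have Qe : Q e by apply: P2h; rewrite -muE; apply: P2M.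
have [c2 [b2 [b1 [nc2 bE]]]] := division b Qb.
have [c3 [e2 [e1 [nc3 eE]]]] := division e Qe.
pose c := c2 * c3; have nc : ~ divides h c by apply: prime_ndivM.
(* The matrix of the multiplication by c b / h is read off c2 b = mu b2 + h b1
   and c3 e = mu e2 + h e1. *)
exists (phi (c%:P * b)), (c3%:P * b1), (c2%:P * e2), (c3%:P * b2 * (c2%:P * e1)).
split; first by exists (c%:P * b).
  set eta := phi h%:P.
  have -> : phi (c%:P * b) - phi (c3%:P * b1) * eta = phi (c3%:P * b2) * phi mu.
    rewrite -!rmorphM -rmorphB; congr (phi _).
    have -> : c%:P * b = c3%:P * (c2%:P * b) by rewrite /c polyCM; ring.
    by rewrite bE; ring.
  have E : phi mu * (phi (c%:P * b) - phi (c2%:P * e2) * eta) = phi (c2%:P * e1) * eta ^+ 2.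
    have -> : phi mu * (phi (c%:P * b) - phi (c2%:P * e2) * eta) =
        phi c%:P * (phi mu * phi b) - phi (mu * (c2%:P * e2)) * eta.
      by rewrite !rmorphM; ring.
    rewrite muE -/eta.
    have -> : phi c%:P * (eta * phi e) = eta * phi (c2%:P * (c3%:P * e)).
      by rewrite /c !(rmorphM, polyCM); ring.
    by rewrite eE !(rmorphM, rmorphD) -/eta; ring.
  by rewrite -mulrA E rmorphM; ring.
move=> g gE.
have [w wE] : divides f (c%:P * b - h%:P * g).
  by apply/ker_phi; rewrite rmorphB gE rmorphM mulrC subrr.
have : divides h%:P (b * ((c1 * c)%:P - w * mu)).
  exists (c1%:P * g + w * r).
  have -> : b * ((c1 * c)%:P - w * mu) = c1%:P * (c%:P * b) - w * (mu * b).
    by rewrite polyCM; ring.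
  have -> : c%:P * b = w * f + h%:P * g by rewrite -wE subrK.
  have -> : mu * b = c1%:P * f - h%:P * r by rewrite fE addrK.
  by ring.
have [_ _ hP] := ph; case/hP => [[k bE']|].
  have : divides h%:P (c1%:P * f).
    by exists (mu * k + r); rewrite fE bE'; ring.
  case/hP => [/(coef_divides 0)|]; first by rewrite coefC.
  exact: prim_f.
move=> hd; have : Q (c1 * c)%:P.
  by rewrite -[(c1 * c)%:P](subrK (w * mu)); apply: QD; [apply: QH | apply: QM].
by move/Ph; apply: prime_ndivM.
Qed.

End SingularHypersurface.

(** * Regular functions in affine charts *)

Section RegularRing.
Variables (C : fieldType) (n k : nat) (gr : 'I_n -> 'I_k) (U : set 'rV[C]_n).
Local Notation B := (regular_ring gr U).
Implicit Types (b : B) (v : 'rV[C]_n).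

(** Being total, it can be evaluated at a row without a proof that this row
    belongs to U. *)
Definition fun_at b v : C :=
  if pselect (U v) is left Uv then val b (exist _ v Uv) else 0.

Lemma fun_atE b (s : {v | U v}) : val b s = fun_at b (sval s).
Proof.
case: s => v Uv; rewrite /fun_at /=; case: pselect => // Uv'.
by congr (val b (exist _ v _)); apply: Prop_irrelevance.
Qed.

Lemma fun_at_inj b b' : (forall v, U v -> fun_at b v = fun_at b' v) -> b = b'.
Proof.
move=> h; apply: val_inj; apply/funext => s; rewrite !fun_atE h //.
by case: s.
Qed.

Lemma fun_at1 v : U v -> fun_at 1 v = 1.
Proof. by rewrite /fun_at; case: pselect. Qed.

Lemma fun_atB b b' v : fun_at (b - b') v = fun_at b v - fun_at b' v.
Proof.
by rewrite /fun_at; case: pselect => [Uv|_]; [exact: regular_ringB | rewrite subr0].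
Qed.

Lemma fun_at0 v : fun_at 0 v = 0.
Proof. by rewrite -(subrr 0) fun_atB subrr. Qed.

Lemma fun_atN b v : fun_at (- b) v = - fun_at b v.
Proof. by rewrite -sub0r fun_atB fun_at0 sub0r. Qed.

Lemma fun_atD b b' v : fun_at (b + b') v = fun_at b v + fun_at b' v.
Proof. by rewrite -[b' in LHS]opprK fun_atB fun_atN opprK. Qed.

Lemma fun_atM b b' v : fun_at (b * b') v = fun_at b v * fun_at b' v.
Proof.
by rewrite /fun_at; case: pselect => [Uv|_]; [exact: regular_ringM | rewrite mulr0].
Qed.

Lemma fun_at_local b v : U v -> exists d G H,
  [/\ multihomog gr d G, multihomog gr d H, H.@[v 0] != 0 &
      forall w, U w -> H.@[w 0] != 0 -> fun_at b w = G.@[w 0] / H.@[w 0]].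
Proof.
move=> Uv; have /asboolP /(_ (exist _ v Uv)) [d [G [H [hG hH Hv bE]]]] := valP b.
exists d, G, H; split=> // w Uw Hw.
by rewrite -(bE (exist _ w Uw)) // fun_atE.
Qed.

Lemma regular_mk (f : 'rV[C]_n -> C) :
    (forall v, U v -> exists d G H,
      [/\ multihomog gr d G, multihomog gr d H, H.@[v 0] != 0 &
          forall w, U w -> H.@[w 0] != 0 -> f w = G.@[w 0] / H.@[w 0]]) ->
  exists b, forall v, U v -> fun_at b v = f v.
Proof.
move=> h; have rf : (fun s : {v | U v} => f (sval s)) \in @regular C n k gr U.
  apply/asboolP => -[v Uv]; have [d [G [H [hG hH Hv fE]]]] := h v Uv.
  by exists d, G, H; split=> // -[w Uw] /=; apply: fE.
pose b : B := exist (fun f : {v | U v} -> C => f \in @regular C n k gr U) _ rf.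
exists b => v Uv; rewrite /fun_at; case: pselect => // Uv'.
Qed.

Lemma regular_fraction d G H : multihomog gr d G -> multihomog gr d H ->
    (forall v, U v -> H.@[v 0] != 0) ->
  exists b, forall v, U v -> fun_at b v = G.@[v 0] / H.@[v 0].
Proof.
by move=> hG hH H0; apply: regular_mk => v Uv; exists d, G, H; split; auto.
Qed.

Lemma multihomogZ d c (G : {mpoly C[n]}) : multihomog gr d G -> multihomog gr d (c *: G).
Proof. by move=> hG m /msuppZ_le; apply: hG. Qed.

Lemma regular_const (c : C) : exists b, forall v, U v -> fun_at b v = c.
Proof.
have [||v _|b bE] := @regular_fraction (fun=> 0%N) (c *: 1) 1.
- exact/multihomogZ/multihomog1.
- exact: multihomog1.
- by rewrite meval1 oner_neq0.
by exists b => v Uv; rewrite bE // mevalZ meval1 mulr1 divr1.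
Qed.

End RegularRing.

Section Chart.
Variables (C : numClosedFieldType) (n k : nat) (gr : 'I_n -> 'I_k).
Variable U : set 'rV[C]_n.
Local Notation C2 := {poly {poly C}}.
Local Notation Fr := {fraction C2}.
Local Notation B := (regular_ring gr U).
Variables (coords : 'I_n -> C2) (g : C2).

Definition chart_pt x y : 'rV[C]_n := \row_i value x y (coords i).

Hypothesis g0 : g != 0.
Hypothesis chartU : forall x y, value x y g != 0 -> U (chart_pt x y).

Lemma chart_pullback (G : {mpoly C[n]}) :
  exists a, forall x y, value x y a = G.@[chart_pt x y 0].
Proof.
exists (mmap (fun c => c%:P%:P) coords G) => x y.
rewrite /mmap mevalE rmorph_sum; apply: eq_bigr => m _.
rewrite rmorphM /= valueC; congr (_ * _).
by rewrite /mmap1 rmorph_prod; apply: eq_bigr => i _; rewrite rmorphXn /= mxE.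
Qed.

(** The quotients that represent b locally are equal as fractions, since they
    take the same values. *)
Lemma chart_fraction (b : B) : exists u : Fr, forall x y,
  value x y g != 0 -> has_value x y u (fun_at b (chart_pt x y)).
Proof.
have loc x y : value x y g != 0 -> exists N M, value x y M != 0 /\
    forall s t, value s t g != 0 -> value s t M != 0 ->
      fun_at b (chart_pt s t) = value s t N / value s t M.
  move=> gxy; have [d [G [H [_ _ Hv bE]]]] := fun_at_local b (chartU gxy).
  have [N NE] := chart_pullback G; have [M ME] := chart_pullback H.
  exists N, M; rewrite ME; split=> // s t gst; rewrite ME NE => Mst.
  by rewrite bE //; apply: chartU.
have [x0 [y0 /loc [N0 [M0 [M0x bE0]]]]] := exists_nonzero_value g0.
exists (N0%:F / M0%:F) => x y gxy; have [N [M [Mxy bE]]] := loc x y gxy.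
exists N, M; split=> //; last exact: bE.
apply: eq_frac; [exact: value_neq0 M0x | exact: value_neq0 Mxy |].
apply/eqP; rewrite -subr_eq0; apply: contraT => d0.
have [|s [t]] := @exists_nonzero_value _ (g * M * M0 * (N0 * M - N * M0)).
  by rewrite !mulf_neq0 ?(value_neq0 M0x) ?(value_neq0 Mxy).
rewrite !rmorphM !mulf_eq0 !negb_or rmorphB !rmorphM /=.
move=> /andP [/andP [/andP [gst Mst] M0st]] /eqP []; apply/eqP.
by rewrite subr_eq0 -eqr_div // -bE0 // -bE.
Qed.

Lemma chart_morphism : exists chi : {rmorphism B -> Fr}, forall b x y,
  value x y g != 0 -> has_value x y (chi b) (fun_at b (chart_pt x y)).
Proof.
have [chi chiE] := choice chart_fraction.
have chiZ : zmod_morphism chi.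
  move=> b b'; apply: (eq_of_values g0) => x y gxy.
  exists (fun_at (b - b') (chart_pt x y)); first exact: chiE.
  by rewrite fun_atB; apply: has_valueB; apply: chiE.
have chiM : monoid_morphism chi.
  split=> [|b b']; apply: (eq_of_values g0) => x y gxy.
    exists 1; first by rewrite -(fun_at1 gr (chartU gxy)); apply: chiE.
    by have := has_value_tofrac x y (1 : C2); rewrite tofrac1 rmorph1.
  exists (fun_at (b * b') (chart_pt x y)); first exact: chiE.
  by rewrite fun_atM; apply: has_valueM; apply: chiE.
pose ZM := GRing.isZmodMorphism.Build B Fr chi chiZ.
pose MM := GRing.isMonoidMorphism.Build B Fr chi chiM.
by exists (HB.pack_for {rmorphism B -> Fr} chi ZM MM).
Qed.

End Chart.

Section Evaluation.
Variables (C : numClosedFieldType) (n k : nat) (gr : 'I_n -> 'I_k).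
Variable U : set 'rV[C]_n.
Local Notation C2 := {poly {poly C}}.
Local Notation B := (regular_ring gr U).
Variables X Y p : B.

Lemma evaluation_exists : exists phi : {rmorphism {poly C2} -> B}, forall q v,
  U v -> fun_at (phi q) v =
    (map_poly (value (fun_at X v) (fun_at Y v)) q).[fun_at p v].
Proof.
have ex2 (a : C2) : exists b : B, forall v, U v ->
    fun_at b v = value (fun_at X v) (fun_at Y v) a.
  elim/C2_ind: a => [c||||].
  - by have [b bE] := regular_const gr U c; exists b => v Uv; rewrite bE // valueC.
  - by exists X => v _; rewrite valueX.
  - by exists Y => v _; rewrite valueY.
  - move=> a a' [b bE] [b' bE']; exists (b + b') => v Uv.
    by rewrite fun_atD bE // bE' // rmorphD.
  move=> a a' [b bE] [b' bE']; exists (b * b') => v Uv.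
  by rewrite fun_atM bE // bE' // rmorphM.
have ex3 (q : {poly C2}) : exists b : B, forall v, U v -> fun_at b v =
    (map_poly (value (fun_at X v) (fun_at Y v)) q).[fun_at p v].
  elim/poly_ind: q => [|q a [b bE]].
    by exists 0 => v _; rewrite fun_at0 rmorph0 horner0.
  have [b' bE'] := ex2 a; exists (b * p + b') => v Uv.
  by rewrite fun_atD fun_atM bE // bE' // rmorphD rmorphM /= map_polyX map_polyC hornerMXaddC.
have [phi phiE] := choice ex3.
have phiZ : zmod_morphism phi.
  move=> q r; apply: fun_at_inj => v Uv.
  by rewrite fun_atB !phiE // rmorphB hornerD hornerN.
have phiM : monoid_morphism phi.
  split=> [|q r]; apply: fun_at_inj => v Uv.
    by rewrite phiE // rmorph1 hornerC fun_at1.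
  by rewrite fun_atM !phiE // rmorphM hornerM.
pose ZM := GRing.isZmodMorphism.Build {poly C2} B phi phiZ.
pose MM := GRing.isMonoidMorphism.Build {poly C2} B phi phiM.
by exists (HB.pack_for {rmorphism {poly C2} -> B} phi ZM MM).
Qed.

End Evaluation.

(** * The Kulikov surface in coordinates *)

Section Forms.
Variable E : comNzRingType.
Implicit Types (u s w : E).

(** Equations of the strict transforms, and components of the Kulikov map, at the
    point x = w (1, 1, 1) + s (u1, u2, 0) of the blowing-up. *)
Definition nodal_form u1 u2 s w :=
  w * (2 * (u1 ^+ 2 - u1 * u2 + u2 ^+ 2)) + s * (u1 * u2 * (u1 + u2)).

Definition kmap0 u1 u2 s w := w * (4 * u1 - 2 * u2) + s * (3 * u1 ^+ 2 - u1 * u2).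
Definition kmap1 u1 u2 s w := w * (4 * u2 - 2 * u1) + s * (3 * u2 ^+ 2 - u1 * u2).
Definition kmap2 u1 u2 s w := w * (- 2 * (u1 + u2)) + s * (- (u1 * u2)).

Definition conic_form (a0 a1 a2 : E) u1 u2 s w :=
  a0 * kmap0 u1 u2 s w + a1 * kmap1 u1 u2 s w + a2 * kmap2 u1 u2 s w.

Lemma conic_form_linear a0 a1 a2 u1 u2 s w : conic_form a0 a1 a2 u1 u2 s w =
  w * conic_form a0 a1 a2 u1 u2 0 1 + s * conic_form a0 a1 a2 u1 u2 1 0.
Proof. rewrite /conic_form /kmap0 /kmap1 /kmap2; ring. Qed.

End Forms.

Lemma ord3P (i : 'I_3) : [\/ i = 0, i = 1 | i = 2].
Proof.
by case: i => [[|[|[|//]]] ?]; [apply: Or31 | apply: Or32 | apply: Or33]; exact: val_inj.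
Qed.

Lemma ord2P (i : 'I_2) : i = 0 \/ i = 1.
Proof. by case: i => [[|[|//]] ?]; [left | right]; exact: val_inj. Qed.

Lemma sum3 (V : nmodType) (F : 'I_3 -> V) : \sum_(i < 3) F i = F 0 + F 1 + F 2.
Proof.
rewrite !big_ord_recl big_ord0 addr0 addrA; congr (_ + F _ + F _); exact: val_inj.
Qed.

Section BlowupPoints.
Variable C : fieldType.

Definition blowup_pt (u1 u2 s w : C) : 'rV[C]_(3 + 2) :=
  row_mx (\row_(i < 3) [:: w + s * u1; w + s * u2; w]`_i)
         (\row_(i < 2) [:: u1; u2]`_i).

Lemma blowup_pt_l u1 u2 s w :
  lsubmx (blowup_pt u1 u2 s w) = \row_(i < 3) [:: w + s * u1; w + s * u2; w]`_i.
Proof. exact: row_mxKl. Qed.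

Lemma blowup_pt_r u1 u2 s w :
  rsubmx (blowup_pt u1 u2 s w) = \row_(i < 2) [:: u1; u2]`_i.
Proof. exact: row_mxKr. Qed.

Lemma blowup_pt_x u1 u2 s w i :
  blowup_pt u1 u2 s w 0 (lshift 2 i) = [:: w + s * u1; w + s * u2; w]`_i.
Proof. by rewrite row_mxEl mxE. Qed.

Lemma blowup_pt_u u1 u2 s w i :
  blowup_pt u1 u2 s w 0 (rshift 3 i) = [:: u1; u2]`_i.
Proof. by rewrite row_mxEr mxE. Qed.

End BlowupPoints.

Section Surface.
Variable R : realType.
Local Notation C := R[i].
Local Notation gr := P2xP1_grading.

Lemma blowup_param (v : 'rV[C]_(3 + 2)) : blowup v -> exists u1 u2 s w,
  [/\ v = blowup_pt u1 u2 s w, (u1 != 0) || (u2 != 0) & (s != 0) || (w != 0)].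
Proof.
rewrite -[v]hsubmxK; move: (lsubmx v) (rsubmx v) => x u.
case; rewrite row_mxKl row_mxKr => x0 u0 xu.
have {}u0 : (u 0 0 != 0) || (u 0 1 != 0).
  apply: contraNT u0; rewrite negb_or !negbK => /andP [/eqP u00 /eqP u01].
  by apply/eqP/rowP => i; rewrite mxE; case: (ord2P i) => ->.
have [s [s0 s1]] : exists s, x 0 0 - x 0 2 = s * u 0 0 /\ x 0 1 - x 0 2 = s * u 0 1.
  have [u00|u00] := eqVneq (u 0 0) 0.
    have u01 : u 0 1 != 0 by move: u0; rewrite u00 eqxx.
    exists ((x 0 1 - x 0 2) / u 0 1); rewrite divfK // u00 mulr0; split=> //.
    by apply: (mulIf u01); rewrite xu u00 mulr0 mul0r.
  exists ((x 0 0 - x 0 2) / u 0 0); rewrite divfK //; split=> //.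
  by apply: (mulIf u00); rewrite -xu mulrAC divfK.
exists (u 0 0), (u 0 1), s, (x 0 2); split=> //.
  rewrite /blowup_pt -s0 -s1 addrC subrK addrC subrK; congr row_mx; apply/rowP => i; rewrite mxE.
    by case: (ord3P i) => ->.
  by case: (ord2P i) => ->.
apply: contraNT x0; rewrite negb_or !negbK => /andP [/eqP s00 /eqP x2].
move: s0 s1; rewrite s00 !mul0r x2 !subr0 => x00 x01.
by apply/eqP/rowP => i; rewrite mxE; case: (ord3P i) => ->.
Qed.

Lemma blowup_ptP (u1 u2 s w : C) : (u1 != 0) || (u2 != 0) ->
  (s != 0) || (w != 0) -> blowup (blowup_pt u1 u2 s w).
Proof.
move=> u0 sw0; rewrite /blowup /= blowup_pt_l blowup_pt_r !mxE /=; split.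
- apply/eqP => /rowP h; move: (h 0) (h 1) (h 2); rewrite !mxE /= => h0 h1 h2.
  move: sw0 u0 h0 h1; rewrite h2 eqxx orbF !add0r => s0 u0 /eqP.
  rewrite mulf_eq0 (negbTE s0) /= => /eqP u10 /eqP.
  by rewrite mulf_eq0 (negbTE s0) /= => /eqP u20; move: u0; rewrite u10 u20 eqxx.
- apply/eqP => /rowP h; move: (h 0) (h 1); rewrite !mxE /= => h0 h1.
  by move: u0; rewrite h0 h1 eqxx.
by rewrite ![w + _]addrC !addrK mulrAC.
Qed.

Lemma is_P_blowup_pt (u1 u2 s w : C) : (u1 != 0) || (u2 != 0) ->
  is_P (lsubmx (blowup_pt u1 u2 s w)) <-> s = 0.
Proof.
move=> u0; rewrite /is_P blowup_pt_l !mxE /=; split=> [[h0 h1]|->]; last by rewrite !mul0r !addr0.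
have {h1} su2 : s * u2 = 0 by apply: (addrI w); rewrite h1 addr0.
have {h0} su1 : s * u1 = 0 by apply: (addrI w); rewrite h0 su2.
apply/eqP; move/eqP: su1; rewrite mulf_eq0; case/orP => // u10.
by move/eqP: su2; rewrite mulf_eq0; case/orP => // u20; rewrite u10 u20 in u0.
Qed.

(** ** Equations of the strict transforms *)

Lemma meval_kulikov_R (x : 'I_3 -> C) : (kulikov_R R).@[x] =
  x 0 ^+ 2 * x 1 + x 0 ^+ 2 * x 2 + x 1 ^+ 2 * x 0 + x 1 ^+ 2 * x 2
    + x 2 ^+ 2 * x 0 + x 2 ^+ 2 * x 1 - 6 * (x 0 * x 1 * x 2).
Proof.
rewrite /kulikov_R mevalB mevalZ rmorph_sum /=.
under eq_bigr => i _ do rewrite big_mkcond sum3 /=.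
by rewrite sum3 /= !(mevalD, meval0, mevalM, mevalXU, rmorphXn) /= !add0r !addr0 !addrA.
Qed.

Lemma meval_kulikov_Q (x : 'I_3 -> C) i : (kulikov_Q R i).@[x] =
  3 * x i ^+ 2 - x 0 * x 1 - x 0 * x 2 - x 1 * x 2.
Proof. by rewrite /kulikov_Q !mevalB mevalZ expr2 !mevalM !mevalXU -expr2. Qed.

Variable a : 'I_3 -> C.

Lemma meval_kulikov_conic (x : 'I_3 -> C) : (kulikov_conic a).@[x] =
  \sum_i a i * (3 * x i ^+ 2 - x 0 * x 1 - x 0 * x 2 - x 1 * x 2).
Proof.
rewrite /kulikov_conic rmorph_sum; apply: eq_bigr => i _.
by rewrite /= mevalZ meval_kulikov_Q.
Qed.

Local Notation conic := (conic_form (a 0) (a 1) (a 2)).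

Lemma kulikov_R_blowup_pt (u1 u2 s w : C) :
  (kulikov_R R).@[lsubmx (blowup_pt u1 u2 s w) 0] = s ^+ 2 * nodal_form u1 u2 s w.
Proof.
rewrite meval_kulikov_R blowup_pt_l !mxE /= /nodal_form; ring.
Qed.

Lemma kulikov_conic_blowup_pt (u1 u2 s w : C) :
  (kulikov_conic a).@[lsubmx (blowup_pt u1 u2 s w) 0] = s * conic u1 u2 s w.
Proof.
rewrite meval_kulikov_conic sum3 blowup_pt_l !mxE /=.
rewrite /conic_form /kmap0 /kmap1 /kmap2; ring.
Qed.

Lemma kulikov_map_blowup_pt (u1 u2 s w : C) :
  kulikov_map (blowup_pt u1 u2 s w) =
  \row_i [:: kmap0 u1 u2 s w; kmap1 u1 u2 s w; kmap2 u1 u2 s w]`_i.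
Proof.
apply/rowP => i; rewrite /kulikov_map [LHS]mxE [RHS]mxE blowup_pt_l blowup_pt_r.
set W : 'rV_(2 + 1) := row_mx _ 0.
have W0 : W 0 0 = u1.
  transitivity (W 0 (lshift 1 (0 : 'I_2))); first by congr (W 0 _); exact: val_inj.
  by rewrite row_mxEl mxE.
have W1 : W 0 1 = u2.
  transitivity (W 0 (lshift 1 (1 : 'I_2))); first by congr (W 0 _); exact: val_inj.
  by rewrite row_mxEl mxE.
have W2 : W 0 2 = 0.
  transitivity (W 0 (rshift 2 (0 : 'I_1))); first by congr (W 0 _); exact: val_inj.
  by rewrite row_mxEr mxE.
have i12 : 1 + 2 = 0 :> 'I_3 by exact: val_inj.
have i21 : 2 + 1 = 0 :> 'I_3 by exact: val_inj.
have i22 : 2 + 2 = 1 :> 'I_3 by exact: val_inj.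
have i11 : 1 + 1 = 2 :> 'I_3 by exact: val_inj.
case: (ord3P i) => ->; rewrite ?add0r ?i12 ?i21 ?i22 ?i11 W0 W1 W2 !mxE /=
  /kmap0 /kmap1 /kmap2; ring.
Qed.

End Surface.

(** ** Consequences of genericity *)

Section Generic.
Variable R : realType.
Local Notation C := R[i].
Variable a : 'I_3 -> C.
Local Notation conic := (conic_form (a 0) (a 1) (a 2)).

Lemma mderivXU n (E : comNzRingType) (i j : 'I_n) :
  ('X_i : {mpoly E[n]})^`M(j) = (i == j)%:R.
Proof.
rewrite mderivX mnm1E; case: eqP => [->|_]; last by rewrite scale0r.
rewrite scale1r -[RHS]mpolyX0; congr 'X_[_].
by apply/mnmP => k; rewrite mnmBE subnn mnm0E.
Qed.

Lemma meval_nat n (E : comNzRingType) (x : 'I_n -> E) m :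
  (m%:R : {mpoly E[n]}).@[x] = m%:R.
Proof. by rewrite rmorph_nat. Qed.

Lemma meval_mderiv_Q (x : 'I_3 -> C) i j : ((kulikov_Q R i)^`M(j)).@[x] =
  6 * x i * (i == j)%:R - (x 0 + x 1 + x 2 - x j).
Proof.
rewrite /kulikov_Q !mderivB mderivZ expr2 !mderivM !mderivXU.
rewrite !(mevalB, mevalD, mevalM, mevalZ, mevalXU, meval_nat).
by case: (ord3P j) => ->; rewrite /= ?mulr0n; ring.
Qed.

Lemma meval_mderiv_comb (E : comNzRingType) n (c0 c1 c2 : E) (p0 p1 p2 : {mpoly E[n]}) j
    (x : 'I_n -> E) :
  ((c0 *: p0 + c1 *: p1 + c2 *: p2)^`M(j)).@[x] =
  c0 * (p0^`M(j)).@[x] + c1 * (p1^`M(j)).@[x] + c2 * (p2^`M(j)).@[x].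
Proof. by rewrite !mderivD !mderivZ !mevalD !mevalZ. Qed.

Lemma kulikov_conicE : kulikov_conic a =
  a 0 *: kulikov_Q R 0 + a 1 *: kulikov_Q R 1 + a 2 *: kulikov_Q R 2.
Proof. exact: sum3. Qed.

Lemma gradient_conic (x : 'rV[C]_3) j : gradient (kulikov_conic a) x 0 j =
  6 * a j * x 0 j - (a 0 + a 1 + a 2) * (x 0 0 + x 0 1 + x 0 2 - x 0 j).
Proof.
pose d i := 6 * x 0 i * (i == j)%:R - (x 0 0 + x 0 1 + x 0 2 - x 0 j).
transitivity (a 0 * d 0 + a 1 * d 1 + a 2 * d 2).
  rewrite mxE kulikov_conicE meval_mderiv_comb.
  by congr (_ * _ + _ * _ + _ * _); exact: meval_mderiv_Q.
by rewrite /d; case: (ord3P j) => ->; rewrite /= ?mulr0n; ring.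
Qed.

(** At a singular point, the coefficients of the conic are those of a linear
    relation between the rows of the Jacobian matrix. *)
Lemma singular_conic_ramified (x : 'rV[C]_3) : (exists i, a i != 0) ->
  gradient (kulikov_conic a) x = 0 -> (kulikov_R R).@[x 0] = 0.
Proof.
case=> i ai g0; pose M := \matrix_(i < 3, j < 3) ((kulikov_Q R i)^`M(j)).@[x 0].
have detM : \det M = - 36 * (kulikov_R R).@[x 0].
  have -> : M = map_mx (meval (x 0)) (\matrix_(i < 3, j < 3) (kulikov_Q R i)^`M(j)).
    by apply/matrixP => k l; rewrite !mxE.
  by rewrite det_map_mx kulikov_jacobian /= mevalZ.
suff : \det M == 0.
  rewrite detM mulf_eq0 oppr_eq0 Num.Theory.pnatr_eq0 /= => /eqP //.
apply/det0P; exists (\row_k a k).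
  by apply: contraNneq ai => /rowP /(_ i); rewrite !mxE => ->.
apply/rowP => j; have := congr1 (fun r : 'rV_3 => r 0 j) g0.
rewrite !mxE => gj; rewrite -[RHS]gj kulikov_conicE.
by rewrite sum3 meval_mderiv_comb !mxE.
Qed.

Hypothesis a_generic : kulikov_generic a.

Let gradP : gradient (kulikov_conic a) (const_mx 1) != 0.
Proof. by case: a_generic => _ []. Qed.

Let a_neq0 : exists i, a i != 0.
Proof.
apply: contrapT => h; have {h} a0 i : a i = 0.
  by apply: contrapT => /eqP ai; apply: h; exists i.
case/eqP: gradP; apply/rowP => j; rewrite gradient_conic !a0 [RHS]mxE; ring.
Qed.

(** A singular point would lie on the cubic. Off the node this contradicts
    transversality, and at the node the gradient is assumed not to vanish. *)
Lemma generic_conic_smooth (x : 'rV[C]_3) : x != 0 ->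
  (kulikov_conic a).@[x 0] = 0 -> gradient (kulikov_conic a) x != 0.
Proof.
move=> x0 qx; apply/eqP => gx; have Rx := singular_conic_ramified a_neq0 gx.
have [[e01 e12]|nP] := EM (is_P x).
  have xE : x = x 0 0 *: const_mx 1.
    by apply/rowP => j; rewrite !mxE mulr1; case: (ord3P j) => ->; rewrite -?e12 -?e01.
  have x00 : x 0 0 != 0 by apply: contraNneq x0 => x00; rewrite xE x00 scale0r.
  case/eqP: gradP; apply/rowP => j; apply: (mulfI x00); rewrite [in RHS]mxE mulr0.
  have := congr1 (fun r : 'rV_3 => r 0 j) gx.
  rewrite [X in _ = X]mxE => <-; rewrite !gradient_conic !mxE.
  by case: (ord3P j) => ->; rewrite -?e12 -?e01; ring.
have := proj1 a_generic x x0 nP qx Rx; rewrite gx.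
rewrite /row_free => /eqP rk.
have : (\rank (col_mx (0 : 'rV[C]_3) (gradient (kulikov_R R) x)) <= 1)%N.
  rewrite -addsmxE adds0mx; exact: rank_leq_row.
by rewrite rk.
Qed.

(** A line through P contained in the conic would contain a singular point. *)
Lemma generic_conic_no_fiber (u1 u2 : C) : (u1 != 0) || (u2 != 0) ->
  conic u1 u2 0 1 = 0 -> conic u1 u2 1 0 != 0.
Proof.
move=> u0 q1; apply/eqP => q2.
pose P : 'rV[C]_3 := const_mx 1; pose u : 'rV[C]_3 := \row_j [:: u1; u2; 0]`_j.
pose g x : 'rV[C]_3 := gradient (kulikov_conic a) x.
have gE (al be : C) j : g (al *: P + be *: u) 0 j = al * g P 0 j + be * g u 0 j.
  rewrite /g !gradient_conic !mxE /=; case: (ord3P j) => ->; ring.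
pose n : 'I_3 -> C := fun j => [:: u2; - u1; u1 - u2]`_j.
have ortho (h : 'I_3 -> C) : h 0 + h 1 + h 2 = 0 -> u1 * h 0 + u2 * h 1 = 0 ->
    exists m, forall j, h j = m * n j.
  move=> hP hu; have [u20|u20] := eqVneq u2 0.
    have u10 : u1 != 0 by move: u0; rewrite u20 eqxx orbF.
    have h0 : h 0 = 0.
      by move/eqP: hu; rewrite u20 mul0r addr0 mulf_eq0 (negbTE u10) => /eqP.
    exists (- h 1 / u1) => j; rewrite /n u20; case: (ord3P j) => -> /=.
    - by rewrite mulr0.
    - by field.
    by rewrite subr0 divfK //; apply/eqP; rewrite -addr_eq0 addrC -[h 1]add0r -{1}h0 hP.
  exists (h 0 / u2) => j; have h1 : h 1 = - (u1 * h 0) / u2.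
    by apply: (mulIf u20); rewrite divfK // mulrC; apply/eqP; rewrite -addr_eq0 addrC hu.
  have h2 : h 2 = - h 0 - h 1 by apply/eqP; rewrite -subr_eq0 -hP; apply/eqP; ring.
  rewrite /n; case: (ord3P j) => -> /=; rewrite ?h2 ?h1; by field.
have gP0 (x : 'rV[C]_3) : g x 0 0 + g x 0 1 + g x 0 2 =
    2 * (a 0 * (2 * x 0 0 - x 0 1 - x 0 2) + a 1 * (2 * x 0 1 - x 0 0 - x 0 2)
       + a 2 * (2 * x 0 2 - x 0 0 - x 0 1)) + 0.
  rewrite /g !gradient_conic; ring.
have [m mE] : exists m, forall j, g P 0 j = m * n j.
  apply: ortho; first by rewrite gP0 !mxE; ring.
  rewrite /g !gradient_conic !mxE -[RHS]q1 /conic_form /kmap0 /kmap1 /kmap2; ring.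
have [k kE] : exists k, forall j, g u 0 j = k * n j.
  apply: ortho.
    by rewrite gP0 !mxE /= -[RHS]q1 /conic_form /kmap0 /kmap1 /kmap2; ring.
  rewrite /g !gradient_conic !mxE /= -[RHS](mulr0 2) -[in RHS]q2.
  by rewrite /conic_form /kmap0 /kmap1 /kmap2; ring.
have m0 : m != 0.
  apply: contraNneq gradP => m0; apply/eqP/rowP => j.
  by rewrite [LHS]mE m0 mul0r mxE.
(* The gradients at P and u are both proportional to the equation n of the line,
   so that the gradient vanishes at this point of the line. *)
have x0 : k *: P + (- m) *: u != 0.
  apply/eqP => /rowP h; move: (h 0) (h 1) (h 2); rewrite !mxE /= mulr0 addr0 mulr1 => h0 h1 k0.
  move: h0 h1; rewrite k0 !add0r => /eqP; rewrite mulf_eq0 oppr_eq0 (negbTE m0) /= => /eqP u10.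
  move=> /eqP; rewrite mulf_eq0 oppr_eq0 (negbTE m0) /= => /eqP u20.
  by move: u0; rewrite u10 u20 eqxx.
have qx : (kulikov_conic a).@[(k *: P + (- m) *: u) 0] = 0.
  rewrite meval_kulikov_conic sum3 !mxE /=.
  transitivity (- m * k * conic u1 u2 0 1 + m ^+ 2 * conic u1 u2 1 0).
    by rewrite /conic_form /kmap0 /kmap1 /kmap2; ring.
  by rewrite q1 q2 !mulr0 addr0.
case/eqP: (generic_conic_smooth x0 qx).
by apply/rowP => j; rewrite [LHS]gE mE kE mxE; ring.
Qed.

(** Otherwise the point (0 : 0 : 1) would be singular on the conic. *)
Lemma generic_line : (a 2 != 0) || (a 0 + a 1 != 0).
Proof.
rewrite -negb_and; apply/negP => /andP [/eqP a2 /eqP a01].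
pose x : 'rV[C]_3 := \row_j [:: 0; 0; 1]`_j.
have x0 : x != 0.
  by apply/eqP => /rowP /(_ 2); rewrite !mxE /= => /eqP; rewrite oner_eq0.
have qx : (kulikov_conic a).@[x 0] = 0.
  by rewrite meval_kulikov_conic sum3 !mxE /= a2; ring.
case/eqP: (generic_conic_smooth x0 qx).
apply/rowP => j; rewrite gradient_conic a01 a2 [RHS]mxE !mxE.
by case: (ord3P j) => ->; rewrite /= ?a2; ring.
Qed.

End Generic.

(** ** Equations of the Kulikov surface *)

Lemma sum2 (V : nmodType) (F : 'I_2 -> V) : \sum_(i < 2) F i = F 0 + F 1.
Proof. by rewrite !big_ord_recl big_ord0 addr0; congr (_ + F _); exact: val_inj. Qed.

Lemma rmorph_nodal_form (E E' : comNzRingType) (f : {rmorphism E -> E'}) u1 u2 s w :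
  f (nodal_form u1 u2 s w) = nodal_form (f u1) (f u2) (f s) (f w).
Proof. by rewrite /nodal_form !(rmorph_nat, rmorphN, rmorphM, rmorphXn, rmorphD). Qed.

Lemma rmorph_kmap (E E' : comNzRingType) (f : {rmorphism E -> E'}) u1 u2 s w :
  [/\ f (kmap0 u1 u2 s w) = kmap0 (f u1) (f u2) (f s) (f w),
      f (kmap1 u1 u2 s w) = kmap1 (f u1) (f u2) (f s) (f w) &
      f (kmap2 u1 u2 s w) = kmap2 (f u1) (f u2) (f s) (f w)].
Proof.
rewrite /kmap0 /kmap1 /kmap2.
by split; rewrite !(rmorph_nat, rmorphN, rmorphM, rmorphXn, rmorphD).
Qed.

Lemma rmorph_conic_form (E E' : comNzRingType) (f : {rmorphism E -> E'}) a0 a1 a2 u1 u2 s w :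
  f (conic_form a0 a1 a2 u1 u2 s w) =
  conic_form (f a0) (f a1) (f a2) (f u1) (f u2) (f s) (f w).
Proof.
have [E0 E1 E2] := rmorph_kmap f u1 u2 s w.
by rewrite /conic_form 2!rmorphD 3!rmorphM E0 E1 E2.
Qed.

Section BlowupChart.
Variable C : numClosedFieldType.
Local Notation C2 := {poly {poly C}}.

Definition blowup_coords (U1 U2 S W : C2) (i : 'I_(3 + 2)) : C2 :=
  match fintype.split i with
  | inl j => [:: W + S * U1; W + S * U2; W]`_j
  | inr j => [:: U1; U2]`_j
  end.

Lemma chart_pt_blowup (U1 U2 S W : C2) x y :
  chart_pt (blowup_coords U1 U2 S W) x y =
  blowup_pt (value x y U1) (value x y U2) (value x y S) (value x y W).
Proof.
apply/rowP => i; rewrite /blowup_pt !mxE /blowup_coords.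
case: fintype.split => j; rewrite mxE.
  by case: (ord3P j) => -> /=; rewrite ?rmorphD ?rmorphM.
by case: (ord2P j) => ->.
Qed.

Lemma linear_poly_exists (c d : C) : exists U : C2, forall x y, value x y U = c + d * x.
Proof.
by exists (c%:P%:P + d%:P%:P * 'X) => x y; rewrite rmorphD rmorphM /= !valueC valueX.
Qed.

Lemma nodal_curve_exists (lam : C) (U1 U2 : C2) : exists S W : C2, forall x y,
  let v1 := value x y U1 in let v2 := value x y U2 in
  value x y S = lam * (2 * (v1 ^+ 2 - v1 * v2 + v2 ^+ 2)) /\
  value x y W = - lam * (v1 * v2 * (v1 + v2)).
Proof.
exists ((lam * 2)%:P%:P * (U1 * U1 - U1 * U2 + U2 * U2)),
  ((- lam)%:P%:P * (U1 * U2 * (U1 + U2))) => x y /=.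
rewrite !rmorphM /= !valueC [lam * (2 * _)]mulrA; split; congr (_ * _).
  by rewrite rmorphD rmorphB !rmorphM.
by rewrite rmorphD.
Qed.

Lemma conic_curve_exists (lam a0 a1 a2 r t : C) (U1 U2 : C2) : exists S : C2,
  forall x y, value x y S =
    lam * conic_form a0 a1 a2 (value x y U1) (value x y U2) r t.
Proof.
exists (lam%:P%:P * conic_form a0%:P%:P a1%:P%:P a2%:P%:P U1 U2 r%:P%:P t%:P%:P).
by move=> x y; rewrite rmorphM rmorph_conic_form /= !valueC.
Qed.

Lemma value_nodal_form x y (u1 u2 s w : C2) : value x y (nodal_form u1 u2 s w) =
  nodal_form (value x y u1) (value x y u2) (value x y s) (value x y w).
Proof. exact: (@rmorph_nodal_form {poly {poly C}} C (value x y)). Qed.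

Lemma value_conic_form x y (a0 a1 a2 u1 u2 s w : C2) :
  value x y (conic_form a0 a1 a2 u1 u2 s w) =
  conic_form (value x y a0) (value x y a1) (value x y a2)
    (value x y u1) (value x y u2) (value x y s) (value x y w).
Proof. exact: (@rmorph_conic_form {poly {poly C}} C (value x y)). Qed.

(** A form that vanishes on Z pulls back to a polynomial that vanishes wherever
    g does not, hence to zero. *)
Lemma zariski_closure_chart n k (gr : 'I_n -> 'I_k) (Z : set 'rV[C]_n)
    (coords : 'I_n -> C2) (g : C2) : g != 0 ->
    (forall x y, value x y g != 0 -> Z (chart_pt coords x y)) ->
  forall x y, zariski_closure gr Z (chart_pt coords x y).
Proof.
move=> g0 gZ x y d G hG GZ; have [b bE] := chart_pullback coords G.
rewrite -bE; suff -> : b = 0 by rewrite rmorph0.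
apply/eqP; apply: contraT => b0.
have [|s [t]] := @exists_nonzero_value _ (g * b); first by rewrite mulf_neq0.
rewrite rmorphM mulf_eq0 negb_or => /andP [gst /eqP []] /=.
by rewrite bE; apply/GZ/gZ.
Qed.

End BlowupChart.

Section Multihomog.
Variables (C : fieldType) (n k : nat) (gr : 'I_n -> 'I_k).

Lemma multihomogX i : multihomog gr (fun j => gr i == j : nat) ('X_i : {mpoly C[n]}).
Proof.
move=> m; rewrite msuppX inE => /eqP -> j.
rewrite (eq_bigr (fun l => (i == l) : nat)); last by move=> l _; rewrite mnm1E.
have [gij|gij] := eqVneq (gr i) j.
  rewrite (bigD1 i) ?gij //= eqxx big1 // => l /andP [_ li].
  by rewrite eq_sym (negbTE li).
rewrite big1 // => l glj; case: eqP => // il.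
by move: gij; rewrite il glj.
Qed.

Lemma multihomogD d (G H : {mpoly C[n]}) :
  multihomog gr d G -> multihomog gr d H -> multihomog gr d (G + H).
Proof.
move=> hG hH; rewrite -[H]opprK; apply: multihomogB => //.
by move=> m; rewrite (perm_mem (msuppN _)); apply: hH.
Qed.

Lemma multihomog_sum d (I : Type) (r : seq I) (G : I -> {mpoly C[n]}) :
  (forall i, multihomog gr d (G i)) -> multihomog gr d (\sum_(i <- r) G i).
Proof.
move=> hG; elim: r => [|i r IH]; first by rewrite big_nil => m; rewrite msupp0.
by rewrite big_cons; apply: multihomogD.
Qed.

Lemma meval_rescale (c : 'I_k -> C) d (G : {mpoly C[n]}) (x : 'I_n -> C) :
    multihomog gr d G ->
  G.@[fun i => c (gr i) * x i] = (\prod_j c j ^+ d j) * G.@[x].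
Proof.
move=> hG; rewrite !mevalE [LHS]big_seq [X in _ * X]big_seq mulr_sumr; apply: eq_bigr => m mG.
rewrite [RHS]mulrCA; congr (_ * _).
have <- : \prod_(i < n) c (gr i) ^+ m i = \prod_j c j ^+ d j.
  rewrite (partition_big gr predT) //=; apply: eq_bigr => j _.
  transitivity (\prod_(i < n | gr i == j) c j ^+ m i).
    by apply: eq_bigr => i /eqP ->.
  rewrite -(hG m mG j).
  by elim/big_rec2: _ => [|i y1 y2 _ ->]; rewrite ?expr0 // exprD.
by rewrite -big_split; apply: eq_bigr => i _; rewrite exprMn.
Qed.

End Multihomog.

Section BilinearForms.
Variable C : fieldType.
Local Notation gr := P2xP1_grading.

Lemma gr_x (j : 'I_3) : gr (lshift 2 j) = 0.
Proof. by rewrite /P2xP1_grading -[lshift 2 j]/(unsplit (inl j)) unsplitK. Qed.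

Lemma gr_u (j : 'I_2) : gr (rshift 3 j) = 1.
Proof. by rewrite /P2xP1_grading -[rshift 3 j]/(unsplit (inr j)) unsplitK. Qed.

Definition deg_x (j : 'I_2) : nat := 0 == j.
Definition deg_u (j : 'I_2) : nat := 1 == j.

Lemma multihomog_x (j : 'I_3) : multihomog gr deg_x ('X_(lshift 2 j) : {mpoly C[3 + 2]}).
Proof. by have := @multihomogX C _ _ gr (lshift 2 j); rewrite gr_x. Qed.

Lemma multihomog_u (j : 'I_2) : multihomog gr deg_u ('X_(rshift 3 j) : {mpoly C[3 + 2]}).
Proof. by have := @multihomogX C _ _ gr (rshift 3 j); rewrite gr_u. Qed.

Local Notation Xx j := ('X_(lshift 2 j) : {mpoly C[3 + 2]}).
Local Notation Xu j := ('X_(rshift 3 j) : {mpoly C[3 + 2]}).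

Definition bilinear (c : 'I_2 -> 'I_3 -> C) : {mpoly C[3 + 2]} :=
  \sum_(i < 2) \sum_(j < 3) c i j *: (Xu i * Xx j).

Lemma multihomog_bilinear c : multihomog gr (fun j => deg_u j + deg_x j)%N (bilinear c).
Proof.
apply: multihomog_sum => i; apply: multihomog_sum => j; apply: multihomogZ.
by apply: multihomogM; [apply: multihomog_u | apply: multihomog_x].
Qed.

Lemma meval_bilinear c u1 u2 s w : (bilinear c).@[blowup_pt u1 u2 s w 0] =
    u1 * (c 0 0 * (w + s * u1) + c 0 1 * (w + s * u2) + c 0 2 * w)
  + u2 * (c 1 0 * (w + s * u1) + c 1 1 * (w + s * u2) + c 1 2 * w).
Proof.
have E i j : (c i j *: (Xu i * Xx j)).@[blowup_pt u1 u2 s w 0] =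
    c i j * ([:: u1; u2]`_i * [:: w + s * u1; w + s * u2; w]`_j).
  by rewrite mevalZ mevalM !mevalXU blowup_pt_u blowup_pt_x.
have -> : (bilinear c).@[blowup_pt u1 u2 s w 0] = \sum_(i < 2) \sum_(j < 3)
    c i j * ([:: u1; u2]`_i * [:: w + s * u1; w + s * u2; w]`_j).
  rewrite rmorph_sum; apply: eq_bigr => i _.
  by rewrite rmorph_sum; apply: eq_bigr => j _; exact: E.
by rewrite sum2 !sum3 /=; ring.
Qed.

Definition kmap_coef (k : 'I_3) (i : 'I_2) (j : 'I_3) : C :=
  (nth [::] (nth [::] [:: [:: [:: 3; 0; 1]; [:: -1; 0; -1]];
                         [:: [:: 0; -2; 0]; [:: 1; 3; 0]];
                         [:: [:: 0; -1; -1]; [:: 0; 0; -2]]] k) i)`_j.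

Definition conic_coef (m : 'I_3 -> C) (i : 'I_2) (j : 'I_3) : C :=
  m 0 * kmap_coef 0 i j + m 1 * kmap_coef 1 i j + m 2 * kmap_coef 2 i j.

Lemma meval_conic_coef (m : 'I_3 -> C) u1 u2 s w :
  (bilinear (conic_coef m)).@[blowup_pt u1 u2 s w 0] =
  conic_form (m 0) (m 1) (m 2) u1 u2 s w.
Proof.
rewrite meval_bilinear /conic_coef /kmap_coef /= /conic_form /kmap0 /kmap1 /kmap2.
ring.
Qed.

End BilinearForms.

Section SurfaceEquations.
Variable R : realType.
Local Notation C := R[i].
Local Notation C2 := {poly {poly C}}.
Local Notation gr := P2xP1_grading.
Variable a : 'I_3 -> C.
Local Notation conic := (conic_form (a 0) (a 1) (a 2)).
Implicit Types (u s w : C).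

Local Notation Xx j := ('X_(lshift 2 j) : {mpoly C[3 + 2]}).
Local Notation Xu j := ('X_(rshift 3 j) : {mpoly C[3 + 2]}).

Lemma strict_transform_avoid G d (H : {mpoly C[3 + 2]}) u1 u2 s w :
    multihomog gr d H ->
    (forall u1 u2 s w, s != 0 ->
       G.@[lsubmx (blowup_pt u1 u2 s w) 0] = 0 -> H.@[blowup_pt u1 u2 s w 0] = 0) ->
  strict_transform G (blowup_pt u1 u2 s w) -> H.@[blowup_pt u1 u2 s w 0] = 0.
Proof.
move=> hH HG /(_ d H hH); apply=> v [/blowup_param [u1' [u2' [s' [w' [-> u0 _]]]]] nP GP].
by apply: HG => //; apply/eqP => /(is_P_blowup_pt s' w' u0).
Qed.

Lemma strict_transform_off_E (G : {mpoly C[3]}) u1 u2 s w : (u1 != 0) || (u2 != 0) ->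
    s != 0 -> G.@[lsubmx (blowup_pt u1 u2 s w) 0] = 0 ->
  strict_transform G (blowup_pt u1 u2 s w).
Proof.
move=> u0 s0 G0 d H _; apply; split=> //.
  by apply: blowup_ptP => //; rewrite s0.
by move/(is_P_blowup_pt s w u0)/eqP; rewrite (negbTE s0).
Qed.

(** At a point of the exceptional curve, the strict transform is reached along the
    curve on which s and w are determined by the direction (u1, u2). *)
Lemma strict_transform_on_E (G : {mpoly C[3]}) (U1 U2 S W : C2) u1 u2 w :
    value 0 0 U1 = u1 -> value 0 0 U2 = u2 -> value 0 0 S = 0 -> value 0 0 W = w ->
    S != 0 ->
    (forall x y, (value x y U1 != 0) || (value x y U2 != 0)) ->
    (forall x y, G.@[lsubmx (blowup_pt (value x y U1) (value x y U2)
                                       (value x y S) (value x y W)) 0] = 0) ->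
  strict_transform G (blowup_pt u1 u2 0 w).
Proof.
move=> E1 E2 E3 E4 S0 Un0 G0.
have -> : blowup_pt u1 u2 0 w = chart_pt (blowup_coords U1 U2 S W) 0 0.
  by rewrite chart_pt_blowup E1 E2 E3 E4.
apply: (zariski_closure_chart (g := S)) => // x y Sxy; rewrite chart_pt_blowup.
split; [by apply: blowup_ptP; rewrite ?Sxy | | exact: G0].
by move/(is_P_blowup_pt _ _ (Un0 x y))/eqP; rewrite (negbTE Sxy).
Qed.

Definition trilinear (i i' : 'I_2) (j : 'I_3) : {mpoly C[3 + 2]} := Xu i * Xu i' * Xx j.

Lemma meval_trilinear i i' j u1 u2 s w : (trilinear i i' j).@[blowup_pt u1 u2 s w 0] =
  [:: u1; u2]`_i * [:: u1; u2]`_i' * [:: w + s * u1; w + s * u2; w]`_j.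
Proof. by rewrite /trilinear !mevalM !mevalXU !blowup_pt_u blowup_pt_x. Qed.

Lemma meval_comb5 (E : comNzRingType) n (c0 c1 c2 c3 c4 : E) (p0 p1 p2 p3 p4 : {mpoly E[n]})
    (x : 'I_n -> E) :
  (c0 *: p0 + c1 *: p1 + c2 *: p2 + c3 *: p3 + c4 *: p4).@[x] =
  c0 * p0.@[x] + c1 * p1.@[x] + c2 * p2.@[x] + c3 * p3.@[x] + c4 * p4.@[x].
Proof. by rewrite !mevalD !mevalZ. Qed.

Lemma multihomog_trilinear i i' j :
  multihomog gr (fun j => deg_u j + deg_u j + deg_x j)%N (trilinear i i' j).
Proof.
by apply: multihomogM; [apply: multihomogM|]; rewrite ?gr_u;
  [apply: multihomog_u | apply: multihomog_u | apply: multihomog_x].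
Qed.

Lemma strict_transform_nodal u1 u2 s w : (u1 != 0) || (u2 != 0) ->
  (s != 0) || (w != 0) ->
  strict_transform (kulikov_R R) (blowup_pt u1 u2 s w) <-> nodal_form u1 u2 s w = 0.
Proof.
move=> u0 sw0; split=> [h|h0].
  pose H := 2 *: trilinear 0 0 2 + 2 *: trilinear 1 1 2 + 1 *: trilinear 0 1 0
    + 1 *: trilinear 0 1 1 + (- 4) *: trilinear 0 1 2.
  have HE v1 v2 r t : H.@[blowup_pt v1 v2 r t 0] = nodal_form v1 v2 r t.
    rewrite /H meval_comb5; rewrite 5!meval_trilinear /= /nodal_form; ring.
  rewrite -HE; apply: (strict_transform_avoid _ _ h).
    by do ![apply: multihomogD]; apply: multihomogZ; apply: multihomog_trilinear.
  move=> v1 v2 r t r0; rewrite kulikov_R_blowup_pt HE => /eqP.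
  by rewrite mulf_eq0 expf_eq0 (negbTE r0) /= => /eqP.
have [s0|s0] := eqVneq s 0; last first.
  by apply: strict_transform_off_E => //; rewrite kulikov_R_blowup_pt h0 mulr0.
move: sw0 h0; rewrite s0 eqxx /= => w0 /eqP.
rewrite /nodal_form mul0r addr0 mulf_eq0 (negbTE w0) mulf_eq0 Num.Theory.pnatr_eq0 /=.
move/eqP => hu; have u20 : u2 != 0.
  apply/eqP => u20; move: u0 hu; rewrite u20 eqxx orbF => u10 /eqP.
  by rewrite mulr0 subr0 expr0n addr0 expf_eq0 /= (negbTE u10).
have u10 : u1 != 0.
  by apply: contraNneq u20 => u10; move/eqP: hu; rewrite u10 mul0r expr0n subr0 add0r expf_eq0.
have r0 : u1 * u2 * (u1 + u2) != 0.
  rewrite !mulf_neq0 //; apply: contraNneq u20 => /eqP; rewrite addr_eq0 => /eqP E.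
  have /eqP : 3 * u2 ^+ 2 = 0 by rewrite -[RHS]hu E; ring.
  by rewrite mulf_eq0 Num.Theory.pnatr_eq0 expf_eq0.
(* Over the direction (u1 + x, u2), the nodal form vanishes at a point (s, w)
   which is unique up to a scalar; lam is chosen to give the point (0, w) at x =
   0. *)
pose lam := - w / (u1 * u2 * (u1 + u2)).
have [U1 EU1] := linear_poly_exists u1 1; have [U2 EU2'] := linear_poly_exists u2 0.
have EU2 x y : value x y U2 = u2 by rewrite EU2' mul0r addr0.
have [S [W SW]] := nodal_curve_exists lam U1 U2.
have ES x y : value x y S = lam * (2 * ((u1 + 1 * x) ^+ 2 - (u1 + 1 * x) * u2 + u2 ^+ 2)).
  by rewrite (proj1 (SW x y)) EU1 EU2.
have EW x y : value x y W = - lam * ((u1 + 1 * x) * u2 * ((u1 + 1 * x) + u2)).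
  by rewrite (proj2 (SW x y)) EU1 EU2.
have lam0 : lam != 0 by rewrite mulf_neq0 ?oppr_eq0 ?invr_eq0.
apply: (@strict_transform_on_E _ U1 U2 S W).
- by rewrite EU1 mulr0 addr0.
- by rewrite EU2.
- by rewrite ES mulr0 addr0 hu !mulr0.
- by rewrite EW mulr0 addr0 mulNr /lam divfK // opprK.
- apply/eqP => S0; have := ES 1 0; have := ES (-1) 0; rewrite S0 !rmorph0 => e1 e2.
  have /eqP : lam * 4 = 0.
    transitivity (lam * (2 * ((u1 + 1 * 1) ^+ 2 - (u1 + 1 * 1) * u2 + u2 ^+ 2))
      + lam * (2 * ((u1 + 1 * -1) ^+ 2 - (u1 + 1 * -1) * u2 + u2 ^+ 2))
      - 4 * lam * (u1 ^+ 2 - u1 * u2 + u2 ^+ 2)); first by ring.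
    by rewrite -e1 -e2 hu mulr0 subr0 addr0.
  by rewrite mulf_eq0 (negbTE lam0) Num.Theory.pnatr_eq0.
- by move=> x y; rewrite EU2 u20 orbT.
move=> x y; rewrite kulikov_R_blowup_pt EU1 EU2 ES EW /nodal_form; ring.
Qed.

Lemma strict_transform_conic u1 u2 s w : kulikov_generic a ->
    (u1 != 0) || (u2 != 0) -> (s != 0) || (w != 0) ->
  strict_transform (kulikov_conic a) (blowup_pt u1 u2 s w) <-> conic u1 u2 s w = 0.
Proof.
move=> gen u0 sw0; split=> [h|h0].
  rewrite -meval_conic_coef; apply: (strict_transform_avoid _ _ h).
    exact: multihomog_bilinear.
  move=> v1 v2 r t r0; rewrite kulikov_conic_blowup_pt meval_conic_coef => /eqP.
  by rewrite mulf_eq0 (negbTE r0) /= => /eqP.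
have [s0|s0] := eqVneq s 0; last first.
  by apply: strict_transform_off_E => //; rewrite kulikov_conic_blowup_pt h0 mulr0.
move: sw0 h0; rewrite s0 eqxx /= => w0 /eqP.
rewrite conic_form_linear mul0r addr0 mulf_eq0 (negbTE w0) /= => /eqP q1.
have q2 := generic_conic_no_fiber gen u0 q1.
have [d1 [d2 qd]] : exists d1 d2, conic d1 d2 0 1 != 0.
  apply: contrapT => h; have h' d1 d2 : conic d1 d2 0 1 = 0.
    by apply: contrapT => /eqP hd; apply: h; exists d1, d2.
  case: gen => _ [/eqP gP _]; apply: gP; apply/rowP => j.
  have [e0 e1] := (h' 1 0, h' 0 1); rewrite gradient_conic [RHS]mxE !mxE.
  case: (ord3P j) => ->.
  - by rewrite -[RHS]e0 /conic_form /kmap0 /kmap1 /kmap2; ring.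
  - by rewrite -[RHS]e1 /conic_form /kmap0 /kmap1 /kmap2; ring.
  transitivity (- (conic 1 0 0 1 + conic 0 1 0 1)).
    rewrite /conic_form /kmap0 /kmap1 /kmap2; ring.
  by rewrite e0 e1 addr0 oppr0.
(* The same with the conic, and with a direction that is moved towards (d1, d2),
   in which the tangent to the conic at P does not point. *)
pose lam := - w / conic u1 u2 1 0.
have [U1 EU1] := linear_poly_exists u1 d1; have [U2 EU2] := linear_poly_exists u2 d2.
have [S ES'] := conic_curve_exists lam (a 0) (a 1) (a 2) 0 1 U1 U2.
have [W EW'] := conic_curve_exists (- lam) (a 0) (a 1) (a 2) 1 0 U1 U2.
have ES x y : value x y S = lam * conic (u1 + d1 * x) (u2 + d2 * x) 0 1.
  by rewrite ES' EU1 EU2.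
have EW x y : value x y W = - lam * conic (u1 + d1 * x) (u2 + d2 * x) 1 0.
  by rewrite EW' EU1 EU2.
have lam0 : lam != 0 by rewrite mulf_neq0 ?oppr_eq0 ?invr_eq0.
have q1d x : conic (u1 + d1 * x) (u2 + d2 * x) 0 1 = x * conic d1 d2 0 1.
  transitivity (conic u1 u2 0 1 + x * conic d1 d2 0 1); last by rewrite q1 add0r.
  rewrite /conic_form /kmap0 /kmap1 /kmap2; ring.
apply: (@strict_transform_on_E _ U1 U2 S W).
- by rewrite EU1 mulr0 addr0.
- by rewrite EU2 mulr0 addr0.
- by rewrite ES q1d mul0r mulr0.
- by rewrite EW !mulr0 !addr0 mulNr /lam divfK // opprK.
- apply/eqP => S0; have := ES 1 0; rewrite S0 rmorph0 q1d mul1r => /esym/eqP.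
  by rewrite mulf_eq0 (negbTE lam0) (negbTE qd).
- move=> x y; rewrite EU1 EU2 -negb_and; apply/negP => /andP [/eqP e1 /eqP e2].
  have /eqP := q1d x; rewrite e1 e2 {1}/conic_form /kmap0 /kmap1 /kmap2.
  have -> : a 0 * (1 * (4 * 0 - 2 * 0) + 0 * (3 * 0 ^+ 2 - 0 * 0)) +
    a 1 * (1 * (4 * 0 - 2 * 0) + 0 * (3 * 0 ^+ 2 - 0 * 0)) +
    a 2 * (1 * (- 2 * (0 + 0)) + 0 * - (0 * 0)) = 0 by ring.
  rewrite eq_sym mulf_eq0 (negbTE qd) orbF => /eqP x0.
  by move: u0 e1 e2; rewrite x0 !mulr0 !addr0 => + e1 e2; rewrite e1 e2 eqxx.
move=> x y; rewrite kulikov_conic_blowup_pt EU1 EU2 conic_form_linear ES EW; ring.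
Qed.

Theorem kulikov_surfaceP u1 u2 s w : kulikov_generic a ->
    (u1 != 0) || (u2 != 0) -> (s != 0) || (w != 0) ->
  kulikov_surface a (blowup_pt u1 u2 s w) <->
  nodal_form u1 u2 s w * conic u1 u2 s w != 0.
Proof.
move=> gen u0 sw0; rewrite mulf_eq0 negb_or; split.
  case=> _ nR nC; apply/andP; split; apply/eqP => h.
    by apply/nR/strict_transform_nodal.
  by apply/nC/strict_transform_conic.
move=> /andP [nR nC]; split; first exact: blowup_ptP.
  by move/(strict_transform_nodal u0 sw0)/eqP; rewrite (negbTE nR).
by move/(strict_transform_conic gen u0 sw0)/eqP; rewrite (negbTE nC).
Qed.

End SurfaceEquations.

(** ** The Kulikov map is unramified *)

Section KulikovDerivatives.
Variables (E : comNzRingType) (d : E -> E).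
Hypothesis dP : derivation d.

Lemma deriv_kmap u1 u2 s w :
  [/\ d (kmap0 u1 u2 s w) = d w * (4 * u1 - 2 * u2) + w * (4 * d u1 - 2 * d u2)
        + d s * (3 * u1 ^+ 2 - u1 * u2) + s * (6 * u1 * d u1 - d u1 * u2 - u1 * d u2),
      d (kmap1 u1 u2 s w) = d w * (4 * u2 - 2 * u1) + w * (4 * d u2 - 2 * d u1)
        + d s * (3 * u2 ^+ 2 - u1 * u2) + s * (6 * u2 * d u2 - d u1 * u2 - u1 * d u2) &
      d (kmap2 u1 u2 s w) = d w * (- 2 * (u1 + u2)) + w * (- 2 * (d u1 + d u2))
        + d s * (- (u1 * u2)) + s * (- (d u1 * u2 + u1 * d u2))].
Proof.
by rewrite /kmap0 /kmap1 /kmap2 !expr2; split;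
  rewrite !(deriv_nat dP, derivMul dP, derivOpp dP, derivAdd dP); ring.
Qed.

End KulikovDerivatives.

(** The factors other than the nodal form are Wronskians of coordinates of
    projective lines, which have no zero: the map is ramified only along the
    strict transform of the nodal cubic. *)
Lemma kmap_jacobian (E : comNzRingType) (d d' : E -> E) (u1 u2 s w : E) :
    derivation d -> derivation d' -> d s = 0 -> d w = 0 -> d' u1 = 0 -> d' u2 = 0 ->
  let k0 := kmap0 u1 u2 s w in let k1 := kmap1 u1 u2 s w in
  let k2 := kmap2 u1 u2 s w in
  k0 * (d k1 * d' k2 - d' k1 * d k2) - k1 * (d k0 * d' k2 - d' k0 * d k2)
    + k2 * (d k0 * d' k1 - d' k0 * d k1) =
  18 * nodal_form u1 u2 s w * (u1 * d u2 - u2 * d u1) * (d' s * w - s * d' w).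
Proof.
move=> dP d'P ds dw du1 du2 k0 k1 k2.
have [E0 E1 E2] := deriv_kmap dP u1 u2 s w.
have [E0' E1' E2'] := deriv_kmap d'P u1 u2 s w.
rewrite /k0 /k1 /k2 E0 E1 E2 E0' E1' E2' ds dw du1 du2 /nodal_form /kmap0 /kmap1 /kmap2.
ring.
Qed.

(** With d and e the derivatives of k, the Jacobian determinant of (k0 - k1) / c
    and m / c, as a multiple of the homogeneous one. *)
Lemma quotient_jacobian (E : comNzRingType) (k0 k1 k2 d0 d1 d2 e0 e1 e2 : E)
    (a0 a1 a2 m0 m1 m2 : E) :
  let A := k0 - k1 in let dA := d0 - d1 in let eA := e0 - e1 in
  let M x y z := m0 * x + m1 * y + m2 * z in
  let c x y z := a0 * x + a1 * y + a2 * z in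
  (dA * c k0 k1 k2 - A * c d0 d1 d2) * (M e0 e1 e2 * c k0 k1 k2 - M k0 k1 k2 * c e0 e1 e2)
  - (eA * c k0 k1 k2 - A * c e0 e1 e2) * (M d0 d1 d2 * c k0 k1 k2 - M k0 k1 k2 * c d0 d1 d2)
  = c k0 k1 k2 * (m1 * a2 - m2 * a1 + (m0 * a2 - m2 * a0)) *
    (k0 * (d1 * e2 - e1 * d2) - k1 * (d0 * e2 - e0 * d2) + k2 * (d0 * e1 - e0 * d1)).
Proof. move=> A dA eA M c; rewrite /A /dA /eA /M /c; ring. Qed.

Lemma frac_jacobian (R : idomainType) (d e : R -> R) (k0 k1 k2 a0 a1 a2 m0 m1 m2 c m : R) :
    derivation d -> derivation e ->
    (forall a, a \in [:: a0; a1; a2; m0; m1; m2] -> d a = 0 /\ e a = 0) ->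
    c = a0 * k0 + a1 * k1 + a2 * k2 -> m = m0 * k0 + m1 * k1 + m2 * k2 -> c != 0 ->
  frac_der d ((k0 - k1)%:F / c%:F) * frac_der e (m%:F / c%:F)
    - frac_der e ((k0 - k1)%:F / c%:F) * frac_der d (m%:F / c%:F) =
  (c * (m1 * a2 - m2 * a1 + (m0 * a2 - m2 * a0)) *
     (k0 * (d k1 * e k2 - e k1 * d k2) - k1 * (d k0 * e k2 - e k0 * d k2)
       + k2 * (d k0 * e k1 - e k0 * d k1)))%:F / (c ^+ 2 * c ^+ 2)%:F.
Proof.
move=> dP eP con cE mE c0; rewrite !frac_derE // !fracM -mulrBl -rmorphB.
congr (tofrac _ / _); rewrite cE mE -quotient_jacobian.
have lin f (b0 b1 b2 : R) : derivation f -> f b0 = 0 -> f b1 = 0 -> f b2 = 0 ->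
    f (b0 * k0 + b1 * k1 + b2 * k2) = b0 * f k0 + b1 * f k1 + b2 * f k2.
  move=> fP h0 h1 h2; rewrite !(derivAdd fP) !(derivMul fP) h0 h1 h2; ring.
have mem b : b \in [:: a0; a1; a2; m0; m1; m2] -> d b = 0 by case/con.
have mem' b : b \in [:: a0; a1; a2; m0; m1; m2] -> e b = 0 by case/con.
rewrite !(derivSub dP) !(derivSub eP).
by rewrite !(lin d) ?(lin e) //; do ?[apply: mem | apply: mem'];
  rewrite !inE eqxx ?orbT.
Qed.

Lemma val_ge0_der (R : idomainType) (p : R) (d : R -> R) (u : {fraction R}) :
  prime_elt p -> derivation d -> val_ge p 0 u -> val_ge p 0 (frac_der d u).
Proof.
move=> pp dP [n [m [pm ->]]]; rewrite expr0 mul1r (frac_derE dP); last first.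
  by apply/eqP => m0; apply: pm; rewrite m0; apply: divides0.
exists (d n * m - n * d m), (m ^+ 2); rewrite expr0 mul1r; split=> //.
exact: prime_ndivX.
Qed.

Lemma cramer (F : comNzRingType) (ax ay x1 x2 y1 y2 t1 t2 : F) :
    t1 = ax * x1 + ay * y1 -> t2 = ax * x2 + ay * y2 ->
  ax * (x1 * y2 - x2 * y1) = t1 * y2 - t2 * y1 /\
  ay * (x1 * y2 - x2 * y1) = x1 * t2 - x2 * t1.
Proof. by move=> -> ->; split; ring. Qed.

(** ** Curves on a surface that is unramified over the plane *)

Section ValuedPoint.
Variable C : numClosedFieldType.
Local Notation C2 := {poly {poly C}}.
Local Notation Fr := {fraction C2}.
Variables (p : C2) (x y : C).
Hypothesis pp : prime_elt p.
Hypothesis pxy : value x y p = 0.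
Implicit Types u : Fr.

Lemma has_value_val_ge0 u v : has_value x y u v -> val_ge p 0 u.
Proof.
case=> n [m [mxy -> _]]; exists n, m; rewrite expr0 mul1r; split=> // -[k mE].
by move: mxy; rewrite mE rmorphM /= pxy mulr0 eqxx.
Qed.

Lemma val_ge1_has_value u v : val_ge p 1 u -> has_value x y u v -> v = 0.
Proof.
case=> n [m [pm uE]] [n' [m' [m'xy uE' ->]]].
have m0 : m != 0 by apply/eqP => m0; apply: pm; rewrite m0; apply: divides0.
rewrite uE expr1 in uE'; have E := frac_eq m0 (value_neq0 m'xy) uE'.
have [_ _ pP] := pp; have : divides p (n' * m).
  by rewrite -E -mulrA; apply: divides_mulr; apply: divides_refl.
by case/pP => [[k ->]|//]; rewrite rmorphM /= pxy mulr0 mul0r.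
Qed.

Variables X Y : Fr.
Hypothesis X0 : val_ge p 0 X.
Hypothesis Y0 : val_ge p 0 Y.
Variables d e : C2 -> C2.
Hypothesis dP : derivation d.
Hypothesis eP : derivation e.
Hypothesis dC : forall c : C, d c%:P%:P = 0.
Hypothesis eC : forall c : C, e c%:P%:P = 0.
Let D := frac_der d.
Let E := frac_der e.
Variable j : C.
Hypothesis j0 : j != 0.
Hypothesis jac : has_value x y (D X * E Y - E X * D Y) j.

Let DC c : D (const_frac c) = 0.
Proof. by rewrite /D /const_frac frac_der_tofrac // dC tofrac0. Qed.
Let EC c : E (const_frac c) = 0.
Proof. by rewrite /E /const_frac frac_der_tofrac // eC tofrac0. Qed.

Let jac_ndiv : ~ val_ge p 1 (D X * E Y - E X * D Y).
Proof. by move/val_ge1_has_value/(_ jac)/eqP; rewrite (negbTE j0). Qed.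

Let derE a : let u := subst X Y a in
  subst X Y (der_x a) * (D X * E Y - E X * D Y) = D u * E Y - E u * D Y /\
  subst X Y (der_y a) * (D X * E Y - E X * D Y) = D X * E u - E X * D u.
Proof.
apply: (@cramer {fraction {poly {poly C}}}).
  by apply: chain_rule => //; apply: derivation_frac_der.
by apply: chain_rule => //; apply: derivation_frac_der.
Qed.

Let subst_val_ge0 a : val_ge p 0 (subst X Y a).
Proof.
elim/C2_ind: a => [c||||].
- by rewrite substC; exists c%:P%:P, 1; rewrite expr0 mul1r tofrac1 divr1; split=> //;
    apply: prime_ndiv_unit (unitr1 _).
- by rewrite substX.
- by rewrite substY.
- move=> a b ha hb; rewrite rmorphD /= -[subst X Y b]opprK; apply: val_geB => //.
  rewrite -sub0r; apply: val_geB => //.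
  exists 0, 1; rewrite mulr0 tofrac0 mul0r; split=> //; exact: prime_ndiv_unit (unitr1 _).
by move=> a b ha hb; rewrite rmorphM /=; apply: (val_geM pp (k := 0) (l := 0)).
Qed.

(** By Cramer's rule, the derivatives of a are obtained from those of a(X, Y),
    which vanish along p = 0, and from the Jacobian determinant, which does not. *)
Lemma unramified_val_ge a : val_ge p 2 (subst X Y a) ->
  val_ge p 1 (subst X Y (der_x a)) /\ val_ge p 1 (subst X Y (der_y a)).
Proof.
move=> h2; have [Ex Ey] := derE a.
have hD := val_ge_der pp dP h2; have hE := val_ge_der pp eP h2.
have jac0 := has_value_val_ge0 jac.
have d0 u : val_ge p 0 u -> val_ge p 0 (D u) by exact: val_ge0_der.
have e0 u : val_ge p 0 u -> val_ge p 0 (E u) by exact: val_ge0_der.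
split.
  have [|//|/jac_ndiv //] := @val_ge_prime _ _ pp _ _ (subst_val_ge0 (der_x a)) jac0 _.
  by rewrite Ex; apply: val_geB => //; apply: (val_geM pp (k := 1) (l := 0)); auto.
have [|//|/jac_ndiv //] := @val_ge_prime _ _ pp _ _ (subst_val_ge0 (der_y a)) jac0 _.
by rewrite Ey; apply: val_geB => //; apply: (val_geM pp (k := 0) (l := 1)); auto.
Qed.

Lemma unramified_kernel a : subst X Y a = 0 ->
  subst X Y (der_x a) = 0 /\ subst X Y (der_y a) = 0.
Proof.
move=> a0; have [Ex Ey] := derE a.
have D0 : D 0 = 0 by apply: deriv_0; apply: derivation_frac_der.
have E0 : E 0 = 0 by apply: deriv_0; apply: derivation_frac_der.
have J0 : D X * E Y - E X * D Y != 0.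
  apply: contraNneq j0 => J0; have h0 := has_value_tofrac x y (0 : C2).
  by apply/eqP; apply: has_value_inj jac _; move: h0; rewrite J0 tofrac0 rmorph0.
move: Ex Ey; rewrite a0 D0 E0 !mul0r !mulr0 subrr.
by move=> /eqP; rewrite mulf_eq0 (negbTE J0) orbF => /eqP -> /eqP;
  rewrite mulf_eq0 (negbTE J0) orbF => /eqP ->.
Qed.

(** If X - x0 and Y - y0 both vanished along p = 0, so would the Jacobian
    determinant. *)
Lemma unramified_not_contracted (x0 y0 : C) :
  val_ge p 1 (X - const_frac x0) -> ~ val_ge p 1 (Y - const_frac y0).
Proof.
move=> hX hY; apply: jac_ndiv.
have Pe u : val_ge p 1 u -> exists v, val_ge p 0 v /\ u = p%:F * v.
  case=> n [m [pm ->]]; exists (n%:F / m%:F); split.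
    by exists n, m; rewrite expr0 mul1r.
  by rewrite expr1 rmorphM mulrA.
have [u [u0 uE]] := Pe _ hX; have [v [v0 vE]] := Pe _ hY.
have sub1 (f : Fr -> Fr) c w z : derivation f -> f (const_frac c) = 0 ->
    z - const_frac c = p%:F * w -> f z = f p%:F * w + p%:F * f w.
  move=> fP fc /eqP; rewrite subr_eq => /eqP ->.
  by rewrite (derivAdd fP) fc addr0 (derivMul fP).
have DP := derivation_frac_der dP; have EP := derivation_frac_der eP.
rewrite (sub1 D _ _ _ DP (DC x0) uE) (sub1 E _ _ _ EP (EC y0) vE).
rewrite (sub1 E _ _ _ EP (EC x0) uE) (sub1 D _ _ _ DP (DC y0) vE).
have id (F : comNzRingType) (P dp ep s t ds dt es et : F) :
  (dp * s + P * ds) * (ep * t + P * et) - (ep * s + P * es) * (dp * t + P * dt) =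
  P * (dp * s * et - ep * s * dt - (es * (dp * t + P * dt) - ds * (ep * t + P * et))).
  by ring.
rewrite (id {fraction {poly {poly C}}}).
have d0 w : val_ge p 0 w -> val_ge p 0 (D w) by exact: val_ge0_der.
have e0 w : val_ge p 0 w -> val_ge p 0 (E w) by exact: val_ge0_der.
have p1 : val_ge p 1 p%:F.
  exists 1, 1; rewrite mulr1 expr1 tofrac1 divr1; split=> //.
  exact: prime_ndiv_unit (unitr1 _).
have p0 : val_ge p 0 p%:F by apply: val_geW p1.
have M0 w z : val_ge p 0 w -> val_ge p 0 z -> val_ge p 0 (w * z).
  by move=> hw hz; apply: (val_geM pp (k := 0) (l := 0)).
have B0 w z : val_ge p 0 w -> val_ge p 0 z -> val_ge p 0 (w - z).
  by move=> hw hz; apply: val_geB.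
have A0 w z : val_ge p 0 w -> val_ge p 0 z -> val_ge p 0 (w + z).
  move=> hw hz; rewrite -[z]opprK -[- z]sub0r; apply: (B0) => //; apply: (B0) => //.
  by rewrite -(subrr p%:F); apply: (B0).
apply: (val_geM pp (k := 1) (l := 0)) => //.
by do ![exact: p0 | exact: u0 | exact: v0 | apply: (d0) | apply: (e0) | apply: (B0) | apply: (M0) | apply: (A0)].
Qed.

End ValuedPoint.

Lemma fraction_lift (D : idomainType) (E : fieldType) (f : {rmorphism D -> E}) :
    (forall a, f a = 0 -> a = 0) ->
  exists g : {rmorphism {fraction D} -> E}, forall a, g a%:F = f a.
Proof.
move=> f_inj; have fn0 a : a != 0 -> f a != 0 by apply: contraNneq => /f_inj ->.
pose g (u : {fraction D}) := f \n_(repr u) / f \d_(repr u).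
have gE n d : d != 0 -> g (n%:F / d%:F) = f n / f d.
  move=> d0; have := fraction_repr (n%:F / d%:F); rewrite /g.
  have : \d_(repr (n%:F / d%:F)) != 0 by exact: denom_ratioP.
  move: \n_(repr _) \d_(repr _) => n' d' d'0 /(frac_eq d0 d'0) E'.
  by apply/eqP; rewrite eqr_div ?fn0 // -!rmorphM E'.
have gZ : zmod_morphism g.
  move=> u v; have [n [d [d0 ->]]] := fraction_numden u.
  have [n' [d' [d'0 ->]]] := fraction_numden v.
  by rewrite fracB // !gE ?mulf_neq0 // rmorphB !rmorphM subf_div ?fn0.
have gM : monoid_morphism g.
  split=> [|u v].
    have := gE 1 1 (oner_neq0 _); rewrite tofrac1 divr1 => ->.
    by rewrite rmorph1 divr1.
  have [n [d [d0 ->]]] := fraction_numden u.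
  have [n' [d' [d'0 ->]]] := fraction_numden v.
  by rewrite fracM !gE ?mulf_neq0 // !rmorphM mulf_div.
pose ZM := GRing.isZmodMorphism.Build {fraction D} E g gZ.
pose MM := GRing.isMonoidMorphism.Build {fraction D} E g gM.
exists (HB.pack_for {rmorphism {fraction D} -> E} g ZM MM) => a /=.
by have := gE a 1 (oner_neq0 _); rewrite tofrac1 divr1 rmorph1 divr1.
Qed.

Lemma clear_denominators_step (F : fieldType) (c n d : F) (P : {poly F}) : d != 0 ->
  d%:P * (c *: P) * 'X + (c * n)%:P = (c * d) *: (P * 'X + (n / d)%:P).
Proof.
move=> d0; rewrite scalerDr -!mul_polyC -[in RHS]polyCM.
have -> : c * d * (n / d) = c * n by field.
by rewrite [(c * d)%:P]polyCM !mulrA [d%:P * c%:P]mulrC.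
Qed.

Lemma clear_denominators (D : idomainType) (P : {poly {fraction D}}) :
  exists c q, c != 0 /\ map_poly (@tofrac D) q = c%:F *: P.
Proof.
elim/poly_ind: P => [|P u [c [q [c0 qE]]]].
  by exists 1, 0; rewrite oner_neq0 rmorph0 scaler0.
have [n [d [d0 ->]]] := fraction_numden u.
exists (c * d), (d%:P * q * 'X + (c * n)%:P); rewrite mulf_neq0 //; split=> //.
rewrite rmorphD !rmorphM /= map_polyX !map_polyC /= qE ?rmorphM /=.
have := @clear_denominators_step {fraction D} c%:F n%:F d%:F P.
by rewrite tofrac_eq0 !polyCM; apply.
Qed.

(** Here y0, y1, y2 are the coordinates, normalized by the equation of a line,
    of the image of the point of direction (t, 1) and position (s, 1). The
    position can be eliminated, and recovered from t. *)
Lemma fiber_equations (F : comNzRingType) (t s ci : F) :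
  let y0 := kmap0 t 1 s 1 * ci in let y1 := kmap1 t 1 s 1 * ci in
  let y2 := kmap2 t 1 s 1 * ci in
  [/\ y0 - y1 * t ^+ 3 + y2 * (t - 1) ^+ 3 = 0,
      (3 - t) * y2 + t * y1 = - 6 * ci &
      s * ((3 - t) * y2 + t * y1) = - 2 * (t + 1) * y1 - (4 - 2 * t) * y2].
Proof. by rewrite /= /kmap0 /kmap1 /kmap2; split; ring. Qed.

(** The cubic equation of t is not trivial: its values at 0, 1 and -1 would be
    zero, and then y0, y1 and y2 as well. *)
Lemma fiber_algebraic (K F : fieldType) (psi : {rmorphism K -> F}) (l0 l1 l2 : K) (t s ci : F) :
    6 != 0 :> F -> ci != 0 -> kmap0 t 1 s 1 * ci = psi l0 ->
    kmap1 t 1 s 1 * ci = psi l1 -> kmap2 t 1 s 1 * ci = psi l2 ->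
  algebraicOver psi t /\ algebraicOver psi s.
Proof.
move=> six ci0 E0 E1 E2; have [] := fiber_equations t s ci.
rewrite E0 E1 E2 => cubic den num.
have den0 : (3 - t) * psi l2 + t * psi l1 != 0.
  by rewrite den mulf_neq0 // oppr_eq0.
have alg_t : algebraicOver psi t.
  pose G := l0%:P - l1 *: 'X^3 + l2 *: ('X - 1) ^+ 3.
  have GE z : G.[z] = l0 - l1 * z ^+ 3 + l2 * (z - 1) ^+ 3.
    by rewrite /G !(hornerE, hornerXn, horner_exp).
  exists G; last first.
    have -> : map_poly psi G = (psi l0)%:P - psi l1 *: 'X^3 + psi l2 *: ('X - 1) ^+ 3.
      rewrite /G rmorphD rmorphB /= map_polyC !map_polyZ map_polyXn /=.
      by rewrite rmorphXn rmorphB /= map_polyX rmorph1.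
    by apply/eqP; rewrite -[RHS]cubic !(hornerE, hornerXn, horner_exp).
  apply: contraNneq den0 => G0.
  have G0E z : l0 - l1 * z ^+ 3 + l2 * (z - 1) ^+ 3 = 0 by rewrite -GE G0 horner0.
  have e2 : l2 = l0.
    by apply/eqP; rewrite eq_sym -subr_eq0 -(G0E 0); apply/eqP; ring.
  have e1 : l1 = l0.
    by apply/eqP; rewrite eq_sym -subr_eq0 -(G0E 1); apply/eqP; ring.
  have l00 : l0 = 0.
    have six' : 6 != 0 :> K by rewrite -(fmorph_eq0 psi) rmorph_nat.
    apply: (mulfI six'); rewrite mulr0 -[RHS]oppr0 -(G0E (-1)) e1 e2; ring.
  by rewrite e1 e2 l00 rmorph0 !mulr0 addr0.
split=> //; have alg_psi := algebraic_id psi.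
have alg_nat n : algebraicOver psi n%:R by rewrite -(rmorph_nat psi); exact: alg_psi.
have alg1 : algebraicOver psi 1 by exact: (alg_nat 1).
have -> : s = (- 2 * (t + 1) * psi l1 - (4 - 2 * t) * psi l2) /
    ((3 - t) * psi l2 + t * psi l1) by rewrite -num mulfK.
by do ![apply: algebraic_div | apply: algebraic_add | apply: algebraic_sub
  | apply: algebraic_mul | apply: algebraic_opp | done].
Qed.

Lemma algebraic_generators (C : numClosedFieldType) (K F : fieldType) (psi : {rmorphism K -> F})
    (f : {rmorphism {poly {poly C}} -> F}) :
    (forall c, algebraicOver psi (f c%:P%:P)) -> algebraicOver psi (f 'X) ->
    algebraicOver psi (f 'X%:P) ->
  forall a b, algebraicOver psi (f a / f b).
Proof.
move=> fC fX fY; have alg a : algebraicOver psi (f a).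
  elim/C2_ind: a => // a b Ia Ib; first by rewrite rmorphD; exact: algebraic_add.
  by rewrite rmorphM; exact: algebraic_mul.
by move=> a b; exact: algebraic_div.
Qed.

(** ** Failure of normality along a curve of double points *)

Lemma prime_factor_zero (C : numClosedFieldType) (x y : C) (n : {poly {poly C}}) :
    n != 0 -> value x y n = 0 ->
  exists p, [/\ prime_elt p, divides p n & value x y p = 0].
Proof.
move=> n0; have [u [s [uu sp ->]]] := factorial_C2 n0.
move/eqP; rewrite (@rmorphM {poly {poly C}} C (value x y)) mulf_eq0.
have /negbTE -> /= : value x y u != 0.
  by rewrite -unitfE; apply: (@rmorph_unit {poly {poly C}} C (value x y)).
elim: s sp => [_|q s IH sp]; first by rewrite big_nil (@rmorph1 {poly {poly C}} C) oner_eq0.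
rewrite big_cons (@rmorphM {poly {poly C}} C (value x y)) mulf_eq0 => /orP [/eqP q0|].
  exists q; split=> //; first exact: (sp _ (mem_head _ _)).
  by exists (u * \prod_(p <- s) p); rewrite -mulrA [q * _]mulrC.
case/IH => [p ps|p [pp [k kE] p0]]; first by apply: sp; rewrite inE ps orbT.
by exists p; split=> //; exists (k * q); rewrite mulrCA kE mulrA [q * k]mulrC.
Qed.

Section RamifiedCurve.
Variables (C : numClosedFieldType) (B : comPzRingType).
Local Notation C2 := {poly {poly C}}.
Local Notation Fr := {fraction C2}.
Variables (phi : {rmorphism {poly C2} -> B}) (chi : {rmorphism B -> Fr}) (X Y : Fr) (x y j : C).
Hypothesis chi_phi : forall a, chi (phi a%:P) = subst X Y a.
Hypothesis chi_X : exists b, chi b = X.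
Hypothesis chi_Y : exists b, chi b = Y.
Hypothesis chi_value : forall b, exists v, has_value x y (chi b) v.
Hypothesis j0 : j != 0.
Hypothesis jac : has_value x y (frac_der (@der_y C) X * frac_der (@der_x C) Y
  - frac_der (@der_x C) X * frac_der (@der_y C) Y) j.
Variable f : {poly C2}.
Hypothesis prim_f : primitive f.
Hypothesis prime_f : prime_elt f.
Hypothesis size_f : (1 < size f)%N.
Hypothesis ker_phi : forall q, phi q = 0 <-> divides f q.
Hypothesis df_neq0 : chi (phi f^`()) != 0.
Hypothesis df_zero : has_value x y (chi (phi f^`())) 0.

(** Since the map to the plane is unramified, a curve through (x, y) along which
    f'(p) vanishes has for image a curve h = 0. The pullback of h vanishes only
    once along it: otherwise h would divide its own partial derivatives, and all
    the iterated ones. *)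
Lemma ramified_not_normal : exists (h : C2) (beta : B) (q1 q2 q3 : {poly C2}),
  let eta := phi h%:P in
  [/\ exists q, beta = phi q,
      (beta - phi q1 * eta) * (beta - phi q2 * eta) = phi q3 * eta ^+ 2 &
      forall g, beta <> phi g * eta].
Proof.
have [n [m [mxy dfE vE]]] := df_zero; have m0 := value_neq0 mxy.
have n0 : n != 0 by apply: contraNneq df_neq0 => n0; rewrite dfE n0 tofrac0 mul0r.
have nxy : value x y n = 0.
  by move/esym/eqP: vE; rewrite mulf_eq0 invr_eq0 (negbTE mxy) orbF => /eqP.
have [p [pp pn pxy]] := prime_factor_zero n0 nxy.
have npm : ~ divides p m.
  by case=> k mE; move: mxy; rewrite mE (@rmorphM {poly {poly C}} C (value x y)) /= pxy mulr0 eqxx.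
have ge0 b : val_ge p 0 (chi b).
  by have [v hv] := chi_value b; exact: has_value_val_ge0 hv.
have X0 : val_ge p 0 X by case: chi_X => b <-.
have Y0 : val_ge p 0 Y by case: chi_Y => b <-.
have yC k : der_y (k%:P%:P : C2) = 0 by rewrite der_yC derivC polyC0.
have xC (k : C) : der_x (k%:P%:P : C2) = 0 by rewrite /der_x derivC.
pose P b := val_ge p 1 (chi b); pose P2 b := val_ge p 2 (chi b).
have PB b c : P b -> P c -> P (b - c).
  by rewrite /P rmorphB; exact: val_geB.
have PM b c : P b -> P (c * b).
  by rewrite /P rmorphM; apply: (val_geM pp (k := 0) (l := 1)).
have Pprime b c : P (b * c) -> P b \/ P c.
  by rewrite /P rmorphM; exact: val_ge_prime.
have P2M b c : P b -> P c -> P2 (b * c).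
  by rewrite /P /P2 rmorphM; apply: (val_geM pp (k := 1) (l := 1)).
have Pdf : P (phi f^`()) by rewrite /P dfE; apply/val_ge_fracE; rewrite ?expr1.
have P1 : ~ P 1.
  rewrite /P rmorph1 => h1; have := has_value_tofrac x y (1 : C2).
  rewrite tofrac1 => /(val_ge1_has_value pp pxy h1) /eqP.
  by rewrite (@rmorph1 {poly {poly C}} C) oner_eq0.
pose I a := P (phi a%:P).
have IB a b : I a -> I b -> I (a - b) by rewrite /I polyCB rmorphB; exact: PB.
have IM a b : I a -> I (b * a) by rewrite /I polyCM rmorphM; exact: PM.
have I1 : ~ I 1 by rewrite /I polyC1 rmorph1.
have Iprime a b : I (a * b) -> I a \/ I b by rewrite /I polyCM rmorphM; exact: Pprime.
have I0 : exists2 a, a != 0 & I a.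
  have [|d [a [b [d0 dE]]]] := @prime_bezout {poly {poly C}} (@factorial_C2 C) f f^`() size_f prime_f.
    by move/ker_phi => h; move: df_neq0; rewrite h rmorph0 eqxx.
  exists d => //; rewrite /I dE rmorphD !rmorphM.
  have -> : phi f = 0 by apply/ker_phi; exact: divides_refl.
  by rewrite mulr0 add0r; apply: PM.
have noP (x0 y0 : C) : I ('X - x0%:P%:P) -> ~ I ('X%:P - y0%:P%:P).
  rewrite /I /P !chi_phi (@rmorphB C2 Fr (subst X Y)) (@rmorphB C2 Fr (subst X Y)) /=.
  rewrite substX substY !substC.
  exact: (unramified_not_contracted pp pxy (@derivation_y C) (@derivation_x C) yC xC j0 jac).
have [h prime_h hI] := curve_ideal_principal IB IM I1 Iprime I0 noP.
have natU : forall n, (n.+1%:R : C2) \is a GRing.unit by exact/natU_poly/natU_poly/natU_C.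
have P2h b : P2 (phi h%:P * b) -> P b.
  rewrite /P2 /P rmorphM => h2; apply: (val_ge_uniformizer pp (ge0 _) (ge0 _) h2); move: h2 => _.
  rewrite chi_phi => /(unramified_val_ge pp pxy X0 Y0 (@derivation_y C) (@derivation_x C) yC xC j0 jac).
  rewrite -!chi_phi => -[/hI hx /hI hy]; have [h0 hnu _] := prime_h.
  have [dxB dxM] := @derivation_x C; have [dyB dyM] := @derivation_y C.
  move: h0; rewrite (@der_closed_trivial C (divides h) _ _ _ h) ?eqxx //; last exact: divides_refl.
  - by move=> a [k ->]; rewrite dxM; apply: dividesD; [apply: divides_mull; apply: divides_refl | apply: divides_mull].
  - by move=> a [k ->]; rewrite dyM; apply: dividesD; [apply: divides_mull; apply: divides_refl | apply: divides_mull].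
  move=> c hc; apply: contrapT => /eqP c0; move: hc; apply: prime_ndiv_unit => //.
  by do 2!apply: (rmorph_unit (@polyC _)); rewrite unitfE.
exists h.
exact: (@singular_not_normal C2 B phi natU f P P2 h prim_f ker_phi PB PM Pprime
  P2M prime_h hI P2h Pdf).
Qed.

End RamifiedCurve.

(** * Functions on an abstract copy of the Kulikov surface *)

Lemma fun_at_rescale (C : fieldType) n k (gr : 'I_n -> 'I_k) (U : set 'rV[C]_n)
    (b : regular_ring gr U) (c : 'I_k -> C) (v v' : 'rV[C]_n) :
  (forall j, c j != 0) -> U v -> U v' -> (forall i, v' 0 i = c (gr i) * v 0 i) ->
  fun_at b v' = fun_at b v.
Proof.
move=> c0 Uv Uv' vE; have [d [G [H [hG hH Hv bE]]]] := fun_at_local b Uv.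
have E (F : {mpoly C[n]}) : multihomog gr d F ->
    F.@[v' 0] = (\prod_j c j ^+ d j) * F.@[v 0].
  by move=> hF; rewrite -(meval_rescale c _ hF); apply: meval_eq.
have p0 : \prod_j c j ^+ d j != 0.
  by apply/prodf_neq0 => j _; rewrite expf_neq0.
rewrite !bE //; last by rewrite E // mulf_neq0.
by rewrite !E // -mulf_div divff // mul1r.
Qed.

Lemma product_of_two_primes (D : idomainType) (m r c : D) : factorial D -> m != 0 ->
    prime_elt r -> prime_elt c ->
    (forall p, prime_elt p -> divides p m -> divides p (r * c)) ->
  exists u i j, u \is a GRing.unit /\ m = u * r ^+ i * c ^+ j.
Proof.
move=> fD m0 pr pc h; have [u [s [uu sp mE]]] := fD m m0.
have {h} h p : p \in s -> divides p (r * c).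
  move=> ps; apply: h; first exact: sp.
  rewrite mE (big_rem p) //=; apply: divides_mull; apply: divides_mulr; exact: divides_refl.
rewrite {}mE {m0}; elim: s sp h => [|p s IH] sp h.
  by exists u, 0%N, 0%N; rewrite big_nil !expr0 !mulr1.
have [||v [i [j [vu E]]]] := IH.
- by move=> q qs; apply: sp; rewrite inE qs orbT.
- by move=> q qs; apply: h; rewrite inE qs orbT.
have pp := sp p (mem_head _ _); have [_ _ pP] := pp.
case/pP: (h p (mem_head _ _)) => [pr'|pc'].
  have [w wu rE] := prime_associate pp pr pr'.
  exists (v * w^-1), i.+1, j; rewrite unitrMl ?unitrV //; split=> //.
  rewrite big_cons mulrCA E rE exprS; transitivity (v * (w^-1 * w) * p * (w * p) ^+ i * c ^+ j).
    by rewrite mulVr // mulr1; ring.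
  by ring.
have [w wu cE] := prime_associate pp pc pc'.
exists (v * w^-1), i, j.+1; rewrite unitrMl ?unitrV //; split=> //.
rewrite big_cons mulrCA E cE exprS; transitivity (v * (w^-1 * w) * p * r ^+ i * (w * p) ^+ j).
  by rewrite mulVr // mulr1; ring.
by ring.
Qed.

Lemma order_at_zero (C : numClosedFieldType) (P Q : {poly C}) k l :
  P.[0] != 0 -> Q.[0] != 0 -> P * 'X^k = Q * 'X^l -> k = l.
Proof.
wlog kl : P Q k l / (k <= l)%N => [hw P0 Q0 E|].
  case/orP: (leq_total k l) => h; first exact: (hw P Q).
  by symmetry; apply: (hw Q P).
move=> P0 Q0 E; apply/eqP; rewrite eqn_leq kl leqNgt; apply/negP => lk.
have {}E : P = Q * 'X^(l - k).
  apply: (mulIf (x := 'X^k)); first by rewrite expf_neq0 // polyX_eq0.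
  by rewrite E -mulrA -exprD subnK.
by move: P0; rewrite E hornerM hornerXn expr0n subn_eq0 leqNgt lk mulr0 eqxx.
Qed.

Lemma curve_pullback (C : numClosedFieldType) (c d : {poly C}) (a : {poly {poly C}}) :
  exists n : {poly C}, forall t, n.[t] = value c.[t] d.[t] a.
Proof.
elim/C2_ind: a => [k||||].
- by exists k%:P => t; rewrite hornerC valueC.
- by exists c => t; rewrite valueX.
- by exists d => t; rewrite valueY.
- by move=> a b [n nE] [m mE]; exists (n + m) => t; rewrite hornerD nE mE rmorphD.
by move=> a b [n nE] [m mE]; exists (n * m) => t; rewrite hornerM nE mE rmorphM.
Qed.

Lemma eq_poly_off_roots (C : numClosedFieldType) (P Q g : {poly C}) : g != 0 ->
  (forall t, g.[t] != 0 -> P.[t] = Q.[t]) -> P = Q.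
Proof.
move=> g0 h; apply/eqP; rewrite -subr_eq0; apply: contraT => d0.
have [|t] := @exists_nonroot _ (g * (P - Q)); first by rewrite mulf_neq0.
rewrite hornerM hornerD hornerN mulf_eq0 negb_or subr_eq0 => /andP [gt].
by rewrite h // eqxx.
Qed.

Lemma prime_root (C : numClosedFieldType) (q : {poly C}) : prime_elt q -> exists z, q.[z] = 0.
Proof.
case=> q0 qnu _; have [|z /rootP] := closed_rootP q _; last by exists z.
apply: contraNneq qnu => sq; rewrite poly_unitE sq eqxx unitfE.
by have := lead_coef_eq0 q; rewrite lead_coefE sq => ->.
Qed.

Lemma valueB (C : numClosedFieldType) (x y : C) a b :
  value x y (a - b) = value x y a - value x y b.
Proof. exact: (@rmorphB {poly {poly C}} C (value x y)). Qed.

Lemma unit_C2 (C : numClosedFieldType) (u : {poly {poly C}}) : u \is a GRing.unit ->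
  exists2 k : C, k != 0 & u = k%:P%:P.
Proof.
rewrite poly_unitE => /andP [/eqP su]; rewrite poly_unitE => /andP [/eqP sk ku].
exists u`_0`_0; first by rewrite -unitfE.
by rewrite -!size1_polyC ?sk ?su.
Qed.

Lemma nodal_form_affine (E E' : comNzRingType) (f : {rmorphism E -> E'}) t z :
  nodal_form (f t) 1 z 1 = f (2 * (t ^+ 2 - t + 1)) + f (t * (t + 1)) * z.
Proof.
rewrite /nodal_form !(rmorph_nat, rmorphN, rmorphM, rmorphXn, rmorphD, rmorph1).
ring.
Qed.

Lemma conic_form_affine (E E' : comNzRingType) (f : {rmorphism E -> E'}) a0 a1 a2 t z :
  conic_form (f a0) (f a1) (f a2) (f t) 1 z 1 =
  f (conic_form a0 a1 a2 t 1 0 1) + f (conic_form a0 a1 a2 t 1 1 0) * z.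
Proof.
rewrite [LHS]conic_form_linear !rmorph_conic_form !(rmorph0, rmorph1) mul1r.
by congr (_ + _); exact: mulrC.
Qed.

(** The three components of the map are even in z, so that z and -z give two
    points of the same fibre. *)
Lemma double_point_values (E : comNzRingType) (z : E) :
  [/\ kmap0 (1 - z) (- 1 - z) 1 z = 4, kmap1 (1 - z) (- 1 - z) 1 z = 4,
      kmap2 (1 - z) (- 1 - z) 1 z = 3 * z ^+ 2 + 1 &
      nodal_form (1 - z) (- 1 - z) 1 z = 8 * z].
Proof. by rewrite /kmap0 /kmap1 /kmap2 /nodal_form; split; ring. Qed.

(** U is the Kulikov surface, known only by its parametrization and its
    equation. *)
Section AbstractSurface.
Variable C : numClosedFieldType.
Local Notation C2 := {poly {poly C}}.
Local Notation Fr := {fraction C2}.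
Local Notation gr := P2xP1_grading.
Variables a0 a1 a2 : C.
Local Notation conic := (conic_form a0 a1 a2).
Variable U : set 'rV[C]_(3 + 2).
Hypothesis U_param : forall v, U v -> exists u1 u2 s w,
  [/\ v = blowup_pt u1 u2 s w, (u1 != 0) || (u2 != 0) & (s != 0) || (w != 0)].
Hypothesis UP : forall u1 u2 s w : C, (u1 != 0) || (u2 != 0) ->
    (s != 0) || (w != 0) ->
  U (blowup_pt u1 u2 s w) <-> nodal_form u1 u2 s w * conic u1 u2 s w != 0.
Hypothesis no_fiber : forall u1 u2 : C, (u1 != 0) || (u2 != 0) ->
  conic u1 u2 0 1 = 0 -> conic u1 u2 1 0 != 0.
Local Notation B := (regular_ring gr U).
Hypothesis B_domain : forall b b' : B, b * b' = 0 -> b = 0 \/ b' = 0.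

Lemma bilinear_fraction (c : 'I_2 -> 'I_3 -> C) : exists b : B,
  forall u1 u2 s w, (u1 != 0) || (u2 != 0) -> (s != 0) || (w != 0) ->
    U (blowup_pt u1 u2 s w) ->
    fun_at b (blowup_pt u1 u2 s w) =
    (bilinear c).@[blowup_pt u1 u2 s w 0] / conic u1 u2 s w.
Proof.
pose m (i : 'I_3) : C := [:: a0; a1; a2]`_i.
have mE u1 u2 s w : (bilinear (conic_coef m)).@[blowup_pt u1 u2 s w 0] = conic u1 u2 s w.
  exact: meval_conic_coef.
have [||v Uv|b bE] := @regular_fraction C _ _ gr U
  (fun j => deg_u j + deg_x j)%N (bilinear c) (bilinear (conic_coef m)).
- exact: multihomog_bilinear.
- exact: multihomog_bilinear.
- have [u1 [u2 [s [w [vE u0 sw0]]]]] := U_param Uv; rewrite vE mE.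
  by move: Uv; rewrite vE UP // mulf_eq0 negb_or => /andP [].
by exists b => u1 u2 s w u0 sw0 Us; rewrite bE // mE.
Qed.

(** ** The four affine charts *)

(** The chart (e1, e2) has one affine coordinate on each of the two lines where
    (u1 : u2) and (s : w) live; the flags tell which homogeneous coordinate is
    normalized to 1. The inner variable is the direction, the outer one the
    position. *)
Definition chart_u1 (e : bool) : C2 := if e then 'X%:P else 1.
Definition chart_u2 (e : bool) : C2 := if e then 1 else 'X%:P.
Definition chart_s (e : bool) : C2 := if e then 'X else 1.
Definition chart_w (e : bool) : C2 := if e then 1 else 'X.

Definition surface_coords e1 e2 :=
  blowup_coords (chart_u1 e1) (chart_u2 e1) (chart_s e2) (chart_w e2).

Definition point_u1 (e : bool) (x : C) : C := if e then x else 1.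
Definition point_u2 (e : bool) (x : C) : C := if e then 1 else x.

Definition chart_point e1 e2 x y : 'rV[C]_(3 + 2) :=
  blowup_pt (point_u1 e1 y) (point_u2 e1 y) (point_u1 e2 x) (point_u2 e2 x).

Definition chart_nodal e1 e2 : C2 :=
  nodal_form (chart_u1 e1) (chart_u2 e1) (chart_s e2) (chart_w e2).

Definition chart_conic e1 e2 : C2 :=
  conic_form a0%:P%:P a1%:P%:P a2%:P%:P
    (chart_u1 e1) (chart_u2 e1) (chart_s e2) (chart_w e2).

Lemma value_chart_u1 e x y : value x y (chart_u1 e) = point_u1 e y.
Proof. by case: e; rewrite ?valueY ?rmorph1. Qed.
Lemma value_chart_u2 e x y : value x y (chart_u2 e) = point_u2 e y.
Proof. by case: e; rewrite ?valueY ?rmorph1. Qed.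
Lemma value_chart_s e x y : value x y (chart_s e) = point_u1 e x.
Proof. by case: e; rewrite ?valueX ?rmorph1. Qed.
Lemma value_chart_w e x y : value x y (chart_w e) = point_u2 e x.
Proof. by case: e; rewrite ?valueX ?rmorph1. Qed.

Lemma chart_pointE e1 e2 x y : chart_pt (surface_coords e1 e2) x y = chart_point e1 e2 x y.
Proof. by rewrite chart_pt_blowup value_chart_u1 value_chart_u2 value_chart_s value_chart_w. Qed.

Lemma value_chart_nodal e1 e2 x y : value x y (chart_nodal e1 e2) =
  nodal_form (point_u1 e1 y) (point_u2 e1 y) (point_u1 e2 x) (point_u2 e2 x).
Proof.
by rewrite value_nodal_form value_chart_u1 value_chart_u2 value_chart_s value_chart_w.
Qed.

Lemma value_chart_conic e1 e2 x y : value x y (chart_conic e1 e2) =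
  conic (point_u1 e1 y) (point_u2 e1 y) (point_u1 e2 x) (point_u2 e2 x).
Proof.
by rewrite value_conic_form value_chart_u1 value_chart_u2 value_chart_s value_chart_w !valueC.
Qed.

Definition chart_den e1 e2 : C2 := chart_nodal e1 e2 * chart_conic e1 e2.

Lemma point_u_neq0 e x : (point_u1 e x != 0) || (point_u2 e x != 0).
Proof. by case: e; rewrite /= oner_neq0 ?orbT. Qed.

Lemma chart_pointP e1 e2 x y :
  U (chart_point e1 e2 x y) <-> value x y (chart_den e1 e2) != 0.
Proof.
by rewrite UP ?point_u_neq0 // rmorphM /= value_chart_nodal value_chart_conic.
Qed.

Lemma chart_nodal_neq0 e1 e2 : chart_nodal e1 e2 != 0.
Proof.
apply/eqP => h; have := value_chart_nodal e1 e2 0 1; rewrite h rmorph0.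
case: e1 {h}; case: e2; rewrite /= /nodal_form => /esym/eqP;
  rewrite !(mul0r, mul1r, mulr1, add0r, addr0, expr1n) ?subrr ?add0r ?mulr1;
  by rewrite ?(Num.Theory.pnatr_eq0 C 2) // Num.Theory.pnatr_eq0.
Qed.

Lemma chart_conic_neq0 e1 e2 : chart_conic e1 e2 != 0.
Proof.
apply/eqP => h.
have val y : conic 1 1 (point_u1 e2 y) (point_u2 e2 y) = 0.
  have -> : conic 1 1 (point_u1 e2 y) (point_u2 e2 y) =
      conic (point_u1 e1 1) (point_u2 e1 1) (point_u1 e2 y) (point_u2 e2 y).
    by case: e1 {h}.
  by rewrite -value_chart_conic h rmorph0.
have u0 : ((1 : C) != 0) || ((1 : C) != 0) by rewrite oner_neq0.
have [q1 q2] : conic 1 1 0 1 = 0 /\ conic 1 1 1 0 = 0.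
  move: (val 0) (val 1); rewrite ![conic 1 1 (point_u1 _ _) _]conic_form_linear.
  by case: e2 {h val} => /=; rewrite !mul1r !mul0r ?add0r ?addr0 => -> //; rewrite ?add0r ?addr0.
by move: (no_fiber u0 q1); rewrite q2 eqxx.
Qed.

Lemma chart_den_neq0 e1 e2 : chart_den e1 e2 != 0.
Proof. by rewrite mulf_neq0 ?chart_nodal_neq0 ?chart_conic_neq0. Qed.

Definition is_chart_morphism e1 e2 (chi : {rmorphism B -> Fr}) : Prop :=
  forall b x y, value x y (chart_den e1 e2) != 0 ->
    has_value x y (chi b) (fun_at b (chart_point e1 e2 x y)).

Lemma chart_morphism_exists e1 e2 : exists chi, is_chart_morphism e1 e2 chi.
Proof.
have [|chi chiE] := @chart_morphism C _ _ gr U (surface_coords e1 e2) _ (chart_den_neq0 e1 e2).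
  by move=> x y; rewrite chart_pointE => /chart_pointP.
by exists chi => b x y gxy; rewrite -chart_pointE; apply: chiE.
Qed.

(** The homogeneous coordinate that the chart normalizes to 1. *)
Definition unit_u (e : bool) (u1 u2 : C) := if e then u2 else u1.

Lemma chart_cover_at e1 e2 u1 u2 s w : U (blowup_pt u1 u2 s w) ->
    unit_u e1 u1 u2 != 0 -> unit_u e2 s w != 0 ->
  let p := unit_u e1 u1 u2 in
  let lam := (if e2 then unit_u e2 s w else unit_u e2 s w * p)^-1 in
  exists x y, [/\ value x y (chart_nodal e1 e2) = lam / p ^+ 2 * nodal_form u1 u2 s w,
    value x y (chart_conic e1 e2) = lam / p * conic u1 u2 s w,
    value x y (chart_den e1 e2) != 0 &
    forall b : B, fun_at b (blowup_pt u1 u2 s w) = fun_at b (chart_point e1 e2 x y)].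
Proof.
set q := unit_u e2 s w => Uv p0 q0 p lam.
have lam0 : lam != 0 by rewrite /lam invr_eq0; case: (e2); rewrite ?mulf_neq0.
pose x' := (if e1 then u1 else u2) / p.
pose y' := (if e2 then s * p else w) * lam.
have u0 : (u1 != 0) || (u2 != 0) by move: p0; rewrite /p; case: (e1) => /= ->; rewrite ?orbT.
have sw0 : (s != 0) || (w != 0) by move: q0; rewrite /q; case: (e2) => /= ->; rewrite ?orbT.
have e1E : point_u1 e1 x' = u1 / p by move: p0; rewrite /x' /p; case: (e1) => //= h; rewrite divff.
have e2E : point_u2 e1 x' = u2 / p by move: p0; rewrite /x' /p; case: (e1) => //= h; rewrite divff.
have sE : point_u1 e2 y' = s * p * lam.
  by move: q0; rewrite /y' /lam /q; case: (e2) => //= h; rewrite divff // mulf_neq0.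
have wE : point_u2 e2 y' = w * lam.
  by move: q0; rewrite /y' /lam /q; case: (e2) => //= h; rewrite divff // mulf_neq0.
have rE : value y' x' (chart_nodal e1 e2) = lam / p ^+ 2 * nodal_form u1 u2 s w.
  by rewrite value_chart_nodal e1E e2E sE wE /nodal_form; field.
have qE : value y' x' (chart_conic e1 e2) = lam / p * conic u1 u2 s w.
  by rewrite value_chart_conic e1E e2E sE wE /conic_form /kmap0 /kmap1 /kmap2; field.
have gE : value y' x' (chart_den e1 e2) != 0.
  rewrite rmorphM /= rE qE; move: Uv; rewrite UP // !mulf_eq0 !negb_or => /andP [n0 c0].
  by rewrite lam0 n0 c0 !invr_eq0 expf_neq0 ?p0.
exists y', x'; split=> // b; symmetry.
apply: (@fun_at_rescale _ _ _ gr U b (fun j : 'I_2 => if j == 0 then lam else p^-1)) => //.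
- by move=> j; case: ifP => _; [exact: lam0 | rewrite invr_eq0].
- exact/chart_pointP.
move=> i; rewrite /chart_point e1E e2E sE wE; case: (split_ordP i) => j ->.
  by rewrite gr_x /= !blowup_pt_x; case: (ord3P j) => -> /=; field.
by rewrite gr_u /= !blowup_pt_u; case: (ord2P j) => -> /=; rewrite mulrC.
Qed.

Lemma chart_cover v : U v -> exists e1 e2 x y, value x y (chart_den e1 e2) != 0 /\
  forall b : B, fun_at b v = fun_at b (chart_point e1 e2 x y).
Proof.
move=> Uv; have [u1 [u2 [s [w [vE u0 sw0]]]]] := U_param Uv; rewrite vE in Uv *.
have [||x [y [_ _ g bE]]] := @chart_cover_at (u2 != 0) (w != 0) _ _ _ _ Uv;
  last by exists (u2 != 0), (w != 0), x, y.
  by rewrite /unit_u; case: (eqVneq u2 0) u0 => [_|//]; rewrite orbF.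
by rewrite /unit_u; case: (eqVneq w 0) sw0 => [_|//]; rewrite orbF.
Qed.

(** The product of b with a function that vanishes outside of the chart, but not
    identically, is zero. *)
Lemma chart_morphism_inj e1 e2 (chi : {rmorphism B -> Fr}) :
    is_chart_morphism e1 e2 chi ->
  forall b, chi b = 0 -> b = 0.
Proof.
move=> chiE b b0.
pose c (i : 'I_2) (j : 'I_3) : C :=
  if val i == e1 :> nat then
    (if e2 then [:: 0; 0; 1] else if e1 then [:: 0; 1; -1] else [:: 1; 0; -1])`_j else 0.
have [b' bE] := bilinear_fraction c.
have cE u1 u2 s w : (bilinear c).@[blowup_pt u1 u2 s w 0] =
    unit_u e1 u1 u2 * ((if e2 then 1 else unit_u e1 u1 u2) * unit_u e2 s w).
  rewrite meval_bilinear /c /unit_u; case: (e1); case: (e2) => /=; ring.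
have bb' : b * b' = 0.
  apply: fun_at_inj => v Uv; rewrite fun_atM fun_at0.
  have [u1 [u2 [s [w [vE u0 sw0]]]]] := U_param Uv; rewrite vE in Uv *.
  have [p0|p0] := eqVneq (unit_u e1 u1 u2) 0; first by rewrite bE // cE p0 !mul0r mulr0.
  have [q0|q0] := eqVneq (unit_u e2 s w) 0; first by rewrite bE // cE q0 !mulr0 mul0r mulr0.
  have [x [y [_ _ gxy hE]]] := chart_cover_at Uv p0 q0.
  have := chiE b x y gxy; rewrite b0 -hE => h.
  have h0 : has_value x y (0 : Fr) 0.
    by have := has_value_tofrac x y (0 : C2); rewrite tofrac0 rmorph0.
  by rewrite (has_value_inj h h0) mul0r.
case: (B_domain bb') => // b'0.
have [x [y gxy]] := exists_nonzero_value (chart_den_neq0 e1 e2).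
have := (chart_pointP e1 e2 x y).2 gxy; rewrite /chart_point => Uv.
have := bE _ _ _ _ (point_u_neq0 _ _) (point_u_neq0 _ _) Uv.
rewrite b'0 fun_at0 cE => /esym/eqP; rewrite mulf_eq0 invr_eq0.
move: gxy; rewrite rmorphM /= value_chart_conic mulf_eq0 negb_or => /andP [_ /negbTE ->].
by rewrite orbF /unit_u; case: (e1); case: (e2); rewrite /= !mulr1 oner_eq0.
Qed.

(** ** The units of the coordinate ring *)

Lemma chart_nodal_prime : prime_elt (chart_nodal true true).
Proof.
have -> : chart_nodal true true =
    (2 * ('X ^+ 2 - 'X + 1))%:P + ('X * ('X + 1)) *: 'X.
  by rewrite -mul_polyC; exact: (@nodal_form_affine {poly C} {poly {poly C}} (@polyC _)).
apply: prime_linear.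
- exact/factorial_poly/field_factorial.
- rewrite mulf_eq0 polyX_eq0 -[1]opprK -[- 1]/(- 1%:P) -polyCN.
  by rewrite polyXsubC_eq0.
move=> q pq [h hE] [h' hE']; have [z qz] := prime_root pq.
have r0 : 2 * (z ^+ 2 - z + 1) = 0.
  have : (h * q).[z] = 0 by rewrite hornerM qz mulr0.
  by rewrite -hE !(hornerE, hornerXn).
have r1 : z * (z + 1) = 0.
  have : (h' * q).[z] = 0 by rewrite hornerM qz mulr0.
  by rewrite -hE' !hornerE.
have /eqP : (6 : C) = 0.
  transitivity ((3 + 2 * z) * (2 * (z ^+ 2 - z + 1)) + (2 - 4 * z) * (z * (z + 1)));
    last by rewrite r0 r1 !mulr0 addr0.
  by ring.
by rewrite Num.Theory.pnatr_eq0.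
Qed.

Lemma conic_off_E_val z :
  (conic_form a0%:P a1%:P a2%:P 'X 1 1 0 : {poly C}).[z] = conic z 1 1 0.
Proof.
apply: (etrans (@rmorph_conic_form {poly C} C (horner_eval z) _ _ _ _ _ _ _)).
by rewrite !rmorph0 !rmorph1 /= /horner_eval !hornerC hornerX.
Qed.

Lemma conic_off_E_neq0 : conic_form a0%:P a1%:P a2%:P 'X 1 1 0 != 0 :> {poly C}.
Proof.
apply/eqP => q0; have v z : conic z 1 1 0 = 0.
  by rewrite -conic_off_E_val q0 horner0.
have six0 : (6 : C) != 0 by rewrite Num.Theory.pnatr_eq0.
have a10 : a1 = 0.
  apply: (mulfI six0); rewrite mulr0 -[RHS](mulr0 2) -[in RHS](v 0).
  rewrite /conic_form /kmap0 /kmap1 /kmap2; ring.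
have a00 : a0 = 0.
  apply: (mulfI six0); rewrite mulr0; transitivity (conic 1 1 1 0 + conic (-1) 1 1 0).
    by rewrite /conic_form /kmap0 /kmap1 /kmap2 a10; ring.
  by rewrite !v addr0.
have u0 : ((1 : C) != 0) || ((1 : C) != 0) by rewrite oner_neq0.
have a20 : a2 = 0.
  by rewrite -[RHS]oppr0 -[in RHS](v 1) /conic_form /kmap0 /kmap1 /kmap2 a10 a00; ring.
have := @no_fiber 1 1 u0 _; rewrite v eqxx => h.
by have /h : conic 1 1 0 1 = 0 by rewrite /conic_form a00 a10 a20; ring.
Qed.

Lemma chart_conic_prime : prime_elt (chart_conic true true).
Proof.
pose q0 : {poly C} := conic_form a0%:P a1%:P a2%:P 'X 1 0 1.
pose q1 : {poly C} := conic_form a0%:P a1%:P a2%:P 'X 1 1 0.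
have q0E z : q0.[z] = conic z 1 0 1.
  apply: (etrans (@rmorph_conic_form {poly C} C (horner_eval z) _ _ _ _ _ _ _)).
  by rewrite !rmorph0 !rmorph1 /= /horner_eval !hornerC hornerX.
have -> : chart_conic true true = q0%:P + q1 *: 'X.
  by rewrite -mul_polyC; exact: (@conic_form_affine {poly C} {poly {poly C}} (@polyC _)).
apply: prime_linear.
- exact/factorial_poly/field_factorial.
- exact: conic_off_E_neq0.
move=> q pq [h hE] [h' hE']; have [z qz] := prime_root pq.
have u0 : (z != 0) || ((1 : C) != 0) by rewrite oner_neq0 orbT.
have q0z : conic z 1 0 1 = 0 by rewrite -q0E hE hornerM qz mulr0.
by have := no_fiber u0 q0z; rewrite -conic_off_E_val -/q1 hE' hornerM qz mulr0 eqxx.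
Qed.

(** Along the curve (c, d), the two forms and b have neither zero nor pole at t
    = 0: compare the orders in t. *)
Lemma pole_order_at_infinity (b : B) e1 e2 (c d : {poly C}) (k1 k2 : C) i1 j1 i2 j2 k l :
    (forall v, U v -> fun_at b v != 0) -> k1 != 0 -> k2 != 0 ->
    value c.[0] d.[0] (chart_den e1 e2) != 0 ->
    (forall t, t != 0 -> let x := c.[t] in let y := d.[t] in
      let r := value x y (chart_nodal e1 e2) in
      let q := value x y (chart_conic e1 e2) in r * q != 0 ->
      fun_at b (chart_point e1 e2 x y) * (k2 * r ^+ i2 * q ^+ j2) * t ^+ k =
      k1 * r ^+ i1 * q ^+ j1 * t ^+ l) ->
  k = l.
Proof.
move=> b0 k10 k20 g0 bE.
have [chi chiE] := chart_morphism_exists e1 e2.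
have [N [M [M0 uE NME]]] := chiE b _ _ g0.
have N0 : value c.[0] d.[0] N != 0.
  by move: (b0 _ ((chart_pointP e1 e2 _ _).2 g0)); rewrite NME mulf_eq0 negb_or => /andP [].
have [n nE] := curve_pullback c d N; have [m mE] := curve_pullback c d M.
have [r rE] := curve_pullback c d (chart_nodal e1 e2).
have [q qE] := curve_pullback c d (chart_conic e1 e2).
have /andP [r0 q0] : (r.[0] != 0) && (q.[0] != 0).
  by move: g0; rewrite rmorphM mulf_eq0 negb_or rE qE.
have nz (f : {poly C}) : f.[0] != 0 -> f != 0 by apply: contraNneq => ->; rewrite horner0.
apply: (@order_at_zero C (n * (k2%:P * r ^+ i2 * q ^+ j2)) (m * (k1%:P * r ^+ i1 * q ^+ j1))).
- by rewrite !(hornerM, horner_exp, hornerC) !mulf_neq0 ?expf_neq0 // nE.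
- by rewrite !(hornerM, horner_exp, hornerC) !mulf_neq0 ?expf_neq0 // mE.
apply: (@eq_poly_off_roots C _ _ ('X * m * (r * q))).
  by rewrite !mulf_neq0 ?polyX_eq0 // nz // mE.
move=> t; rewrite !(hornerM, horner_exp, hornerC, hornerX) !mulf_eq0 !negb_or -andbA.
move=> /and3P [t0 mt /andP [rt qt]].
have gt : value c.[t] d.[t] (chart_den e1 e2) != 0.
  by rewrite rmorphM mulf_neq0 //= -?rE -?qE.
have := bE t t0; rewrite /= -rE -qE mulf_neq0 // => /(_ isT) E.
have bt : fun_at b (chart_point e1 e2 c.[t] d.[t]) = n.[t] / m.[t].
  by apply: has_value_inj (chiE b _ _ gt) _; exists N, M; rewrite -mE -nE.
rewrite bt in E; rewrite -[RHS]mulrA -E !mulrA; congr (_ * _ * _ * _ * _).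
by rewrite [RHS]mulrC mulKf.
Qed.

(** On the standard chart, the complement of the surface consists of two
    irreducible curves, so that a function without zeros is a monomial in their
    equations. Its order vanishes along the two other curves u2 = 0 and w = 0,
    and the matrix of the orders of the two equations along them, with rows (2,
    1) and (1, 1), is invertible. *)
Lemma unit_constant (b : B) : (forall v, U v -> fun_at b v != 0) ->
  exists k, forall v, U v -> fun_at b v = k.
Proof.
move=> b0; have [chi chiE] := chart_morphism_exists true true.
set r := chart_nodal true true; set q := chart_conic true true.
have [|n [m [m0 bE red mden]]] := @reduced_denominator C (chart_den true true) (chi b).
  by move=> x y g; exists (fun_at b (chart_point true true x y)); apply: chiE.
have val x y : value x y (chart_den true true) != 0 ->
    fun_at b (chart_point true true x y) * value x y m = value x y n.
  move=> g; have [n' [m' [m'0 bE' vE]]] := chiE b x y g.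
  have E : n * m' = n' * m.
    by apply: frac_eq => //; [exact: value_neq0 m'0 | rewrite -bE].
  have := congr1 (value x y) E; rewrite !rmorphM /= => E'.
  by rewrite vE mulrAC -E' mulfK.
have nden p : prime_elt p -> divides p n -> divides p (r * q).
  move=> pp pn; apply: contrapT => npg; have [x [y [pxy gxy]]] := prime_zero pp npg.
  have [n' [m' [m'0 bE' vE]]] := chiE b x y gxy.
  have E : n * m' = n' * m.
    by apply: frac_eq => //; [exact: value_neq0 m'0 | rewrite -bE].
  have [_ _ pP] := pp; have : divides p (n' * m) by rewrite -E; apply: divides_mulr.
  case/pP => [[k n'E]|]; last exact: red.
  move/eqP: (b0 _ ((chart_pointP true true x y).2 gxy)); apply.
  by rewrite vE n'E rmorphM /= pxy mulr0 mul0r.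
have n0 : n != 0.
  have [x [y g]] := exists_nonzero_value (chart_den_neq0 true true).
  apply/eqP => n0; have := val x y g; rewrite n0 rmorph0 => /eqP.
  rewrite mulf_eq0 (negbTE (b0 _ ((chart_pointP true true x y).2 g))) /= => /eqP mxy.
  have [n' [m' [m'0 bE' vE]]] := chiE b x y g.
  move/eqP: (b0 _ ((chart_pointP true true x y).2 g)); apply.
  have E : n * m' = n' * m.
    by apply: frac_eq => //; [exact: value_neq0 m'0 | rewrite -bE].
  move: E; rewrite n0 mul0r => /esym/eqP; rewrite mulf_eq0 (negbTE m0) orbF => /eqP n'0.
  by rewrite vE n'0 rmorph0 mul0r.
have pr := chart_nodal_prime; have pq := chart_conic_prime.
have [v1 [i1 [j1 [/unit_C2 [k1 k10 ->] nE]]]] :=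
  product_of_two_primes (@factorial_C2 C) n0 pr pq nden.
have [v2 [i2 [j2 [/unit_C2 [k2 k20 ->] mE]]]] :=
  product_of_two_primes (@factorial_C2 C) m0 pr pq mden.
have std x y : value x y (chart_den true true) != 0 ->
    fun_at b (chart_point true true x y) * (k2 * value x y r ^+ i2 * value x y q ^+ j2) =
    k1 * value x y r ^+ i1 * value x y q ^+ j1.
  move=> g; have := val x y g.
  by rewrite nE mE !(rmorphM, rmorphXn) /= !valueC.
have gen u1 u2 s w : U (blowup_pt u1 u2 s w) -> u2 != 0 -> w != 0 ->
    fun_at b (blowup_pt u1 u2 s w) *
      (k2 * nodal_form u1 u2 s w ^+ i2 * conic u1 u2 s w ^+ j2) *
      ((w * u2 ^+ 2) ^+ i1 * (w * u2) ^+ j1) =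
    k1 * nodal_form u1 u2 s w ^+ i1 * conic u1 u2 s w ^+ j1 *
      ((w * u2 ^+ 2) ^+ i2 * (w * u2) ^+ j2).
  move=> Uv u20 w0; have [x [y [rE qE g /(_ b) ->]]] := @chart_cover_at true true _ _ _ _ Uv u20 w0.
  have A0 : w * u2 ^+ 2 != 0 by rewrite mulf_neq0 ?expf_neq0.
  have B0 : w * u2 != 0 by rewrite mulf_neq0.
  have E := std x y g; rewrite /= -invfM [_^-1 * _]mulrC in rE.
  rewrite /= -invfM [_^-1 * _]mulrC in qE.
  move: E; rewrite rE qE !expr_div_n.
  move: (expf_neq0 i1 A0) (expf_neq0 i2 A0) (expf_neq0 j1 B0) (expf_neq0 j2 B0).
  move: (nodal_form _ _ _ _ ^+ i1) (nodal_form _ _ _ _ ^+ i2) (conic_form _ _ _ _ _ _ _ ^+ j1)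
    (conic_form _ _ _ _ _ _ _ ^+ j2) => R1 R2 Q1 Q2.
  move: (_ ^+ i1) (_ ^+ i2) (_ ^+ j1) (_ ^+ j2) => A1 A2 B1 B2 A10 A20 B10 B20 E.
  transitivity (fun_at b (chart_point true true x y) * (k2 * (R2 / A2) * (Q2 / B2))
      * (A1 * B1 * A2 * B2)); first by field; rewrite A20 B20.
  by rewrite E; field; rewrite A10 B10.
(* order along u2 = 0 *)
have e1 : (2 * i1 + j1 = 2 * i2 + j2)%N.
  have [x0 g0] : exists x0, value x0 0 (chart_den false true) != 0.
    have u0 : ((1 : C) != 0) || ((0 : C) != 0) by rewrite oner_neq0.
    have N (x0 : C) : nodal_form 1 0 x0 1 != 0.
      have -> : nodal_form 1 0 x0 1 = 2%:R by rewrite /nodal_form; ring.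
      by rewrite (Num.Theory.pnatr_eq0 C 2).
    have V x0 : value x0 0 (chart_den false true) = nodal_form 1 0 x0 1 * conic 1 0 x0 1.
      by rewrite rmorphM /= value_chart_nodal value_chart_conic.
    have [q0|q0] := eqVneq (conic 1 0 0 1) 0; [exists 1 | exists 0]; rewrite V mulf_neq0 //.
    by rewrite conic_form_linear q0 !mul1r add0r; apply: no_fiber.
  apply: (@pole_order_at_infinity b false true x0%:P 'X k1 k2 i1 j1 i2 j2) => //.
    by rewrite hornerC hornerX.
  move=> t t0 x y; rewrite /x /y hornerC hornerX value_chart_nodal value_chart_conic /= => rq.
  have Uv : U (blowup_pt 1 t x0 1) by rewrite UP ?oner_neq0 ?orbT.
  have := gen _ _ _ _ Uv t0 (oner_neq0 _).
  by rewrite !mul1r -!exprM -!exprD.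
(* order along w = 0 *)
have e2 : (i1 + j1 = i2 + j2)%N.
  have [|y0] := @exists_nonroot _ ('X * ('X + 1) * conic_form a0%:P a1%:P a2%:P 'X 1 1 0 : {poly C}).
    rewrite !mulf_neq0 ?polyX_eq0 ?conic_off_E_neq0 //.
    by rewrite -[1]opprK -[- 1]/(- 1%:P) -polyCN polyXsubC_eq0.
  rewrite !hornerM => h0.
  have g0 : value 0 y0 (chart_den true false) != 0.
    rewrite rmorphM /= value_chart_nodal value_chart_conic /=.
    move: h0; rewrite hornerD hornerX hornerC conic_off_E_val.
    by rewrite /nodal_form; have -> : forall z : C, 0 * (2 * (z ^+ 2 - z * 1 + 1 ^+ 2)) + 1 * (z * 1 * (z + 1)) = z * (z + 1) by move=> z; ring.
  apply: (@pole_order_at_infinity b true false 'X y0%:P k1 k2 i1 j1 i2 j2) => //.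
    by rewrite hornerC hornerX.
  move=> t t0 x y; rewrite /x /y hornerC hornerX value_chart_nodal value_chart_conic /= => rq.
  have Uv : U (blowup_pt y0 1 1 t) by rewrite UP ?oner_neq0 ?orbT.
  have := gen _ _ _ _ Uv (oner_neq0 _) t0.
  by rewrite !(mulr1, expr1n) -!exprD.
have iE : i1 = i2.
  by apply/eqP; rewrite -(eqn_add2r (i1 + j1)) addnA addnn -mul2n e1 e2 addnA addnn -mul2n.
have jE : j1 = j2 by apply/eqP; rewrite -(eqn_add2l i1) e2 iE.
have [bk bkE] := regular_const gr U (k1 / k2).
exists (k1 / k2) => v Uv; rewrite -(bkE v Uv); congr (fun_at _ v).
apply/eqP; rewrite -subr_eq0; apply/eqP; apply: (chart_morphism_inj chiE).
apply: (eq_of_values (chart_den_neq0 true true)) => x y g.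
exists 0; last by have := has_value_tofrac x y (0 : C2); rewrite tofrac0 rmorph0.
have -> : 0 = fun_at (b - bk) (chart_point true true x y); last exact: chiE.
rewrite fun_atB bkE; last exact/chart_pointP.
have := std x y g; rewrite iE jE.
move: g; rewrite rmorphM mulf_eq0 negb_or => /andP [r0 q0].
move=> E; have <- : fun_at b (chart_point true true x y) * k2 = k1.
  apply: (mulIf (mulf_neq0 (expf_neq0 i2 r0) (expf_neq0 j2 q0))).
  by move: E; rewrite !mulrA.
by rewrite mulfK // subrr.
Qed.

(** ** The coordinates of the plane as functions on the surface *)

Variables m0 m1 m2 : C.
Hypothesis coords_indep : m1 * a2 - m2 * a1 + (m0 * a2 - m2 * a0) != 0.
Local Notation mform u1 u2 s w := (conic_form m0 m1 m2 u1 u2 s w).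
Variables X Y p : B.
Hypothesis XE : forall u1 u2 s w, (u1 != 0) || (u2 != 0) -> (s != 0) || (w != 0) ->
  U (blowup_pt u1 u2 s w) ->
  fun_at X (blowup_pt u1 u2 s w) =
  (kmap0 u1 u2 s w - kmap1 u1 u2 s w) / conic u1 u2 s w.
Hypothesis YE : forall u1 u2 s w, (u1 != 0) || (u2 != 0) -> (s != 0) || (w != 0) ->
  U (blowup_pt u1 u2 s w) ->
  fun_at Y (blowup_pt u1 u2 s w) = mform u1 u2 s w / conic u1 u2 s w.
Variable phi : {rmorphism {poly C2} -> B}.
Hypothesis phiE : forall q v, U v -> fun_at (phi q) v =
  (map_poly (value (fun_at X v) (fun_at Y v)) q).[fun_at p v].

Definition chart_k0 e1 e2 := kmap0 (chart_u1 e1) (chart_u2 e1) (chart_s e2) (chart_w e2).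
Definition chart_k1 e1 e2 := kmap1 (chart_u1 e1) (chart_u2 e1) (chart_s e2) (chart_w e2).
Definition chart_k2 e1 e2 := kmap2 (chart_u1 e1) (chart_u2 e1) (chart_s e2) (chart_w e2).
Definition chart_m e1 e2 : C2 := conic_form m0%:P%:P m1%:P%:P m2%:P%:P
  (chart_u1 e1) (chart_u2 e1) (chart_s e2) (chart_w e2).

Lemma value_chart_kmap e1 e2 x y :
  let u1 := point_u1 e1 y in let u2 := point_u2 e1 y in
  let s := point_u1 e2 x in let w := point_u2 e2 x in
  [/\ value x y (chart_k0 e1 e2) = kmap0 u1 u2 s w,
      value x y (chart_k1 e1 e2) = kmap1 u1 u2 s w &
      value x y (chart_k2 e1 e2) = kmap2 u1 u2 s w].
Proof.
have [E0 E1 E2] := @rmorph_kmap {poly {poly C}} C (value x y)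
  (chart_u1 e1) (chart_u2 e1) (chart_s e2) (chart_w e2).
by split; [apply: (etrans E0) | apply: (etrans E1) | apply: (etrans E2)];
  rewrite /= value_chart_u1 value_chart_u2 value_chart_s value_chart_w.
Qed.

Lemma value_chart_m e1 e2 x y : value x y (chart_m e1 e2) =
  mform (point_u1 e1 y) (point_u2 e1 y) (point_u1 e2 x) (point_u2 e2 x).
Proof.
by rewrite value_conic_form value_chart_u1 value_chart_u2 value_chart_s value_chart_w !valueC.
Qed.

Lemma chart_conicE e1 e2 : chart_conic e1 e2 = a0%:P%:P * chart_k0 e1 e2
  + a1%:P%:P * chart_k1 e1 e2 + a2%:P%:P * chart_k2 e1 e2.
Proof. by []. Qed.

Lemma chart_mE e1 e2 : chart_m e1 e2 = m0%:P%:P * chart_k0 e1 e2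
  + m1%:P%:P * chart_k1 e1 e2 + m2%:P%:P * chart_k2 e1 e2.
Proof. by []. Qed.

Lemma chart_kmap_jacobian e1 e2 :
  let k0 := chart_k0 e1 e2 in let k1 := chart_k1 e1 e2 in let k2 := chart_k2 e1 e2 in
  exists2 n : C2, (forall x y, value x y n != 0) &
  k0 * (der_y k1 * der_x k2 - der_x k1 * der_y k2)
    - k1 * (der_y k0 * der_x k2 - der_x k0 * der_y k2)
    + k2 * (der_y k0 * der_x k1 - der_x k0 * der_y k1) = chart_nodal e1 e2 * n.
Proof.
have yC k : der_y (k%:P%:P : C2) = 0 by rewrite der_yC derivC polyC0.
have xC (k : {poly C}) : der_x (k%:P : C2) = 0 by rewrite /der_x derivC.
have y1 : der_y (1 : C2) = 0 by exact: (yC 1).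
have x1 : der_x (1 : C2) = 0 by exact: (xC 1).
have yY : der_y ('X%:P : C2) = 1 by rewrite der_yC derivX.
have xX : der_x ('X : C2) = 1 by rewrite /der_x derivX.
have yX : der_y ('X : C2) = 0 by exact: der_yX.
have wu e : exists2 n : C, n != 0 &
    chart_u1 e * der_y (chart_u2 e) - chart_u2 e * der_y (chart_u1 e) = n%:P%:P.
  case: e; rewrite /chart_u1 /chart_u2.
    exists (-1); first by rewrite oppr_eq0 oner_neq0.
    by rewrite y1 yY mulr0 mulr1 sub0r !polyCN.
  by exists 1; rewrite ?oner_neq0 // yY y1 mulr0 mulr1 subr0.
have ws e : exists2 n : C, n != 0 &
    der_x (chart_s e) * chart_w e - chart_s e * der_x (chart_w e) = n%:P%:P.
  case: e; rewrite /chart_s /chart_w.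
    by exists 1; rewrite ?oner_neq0 // xX x1 mulr0 mulr1 subr0.
  exists (-1); first by rewrite oppr_eq0 oner_neq0.
  by rewrite x1 xX mulr1 mul0r sub0r !polyCN.
move=> k0 k1 k2; have [n n0 nE] := wu e1; have [n' n'0 n'E] := ws e2.
exists (18%:R%:P%:P * n%:P%:P * n'%:P%:P).
  by move=> x y; rewrite !rmorphM /= !valueC !mulf_neq0 // Num.Theory.pnatr_eq0.
rewrite (@kmap_jacobian {poly {poly C}} (@der_y C) (@der_x C)) //.
- by rewrite nE n'E !polyCMn !polyC1 -!mulrA mulrCA.
- exact: derivation_y.
- exact: derivation_x.
- by case: (e2); [exact: yX | exact: y1].
- by case: (e2); [exact: y1 | exact: yX].
- by case: (e1); [exact: xC | exact: x1].
by case: (e1); [exact: x1 | exact: xC].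
Qed.

Lemma standard_chart_kmap : let t : Fr := ('X%:P)%:F in let s : Fr := 'X%:F in
  [/\ kmap0 t 1 s 1 = (chart_k0 true true)%:F, kmap1 t 1 s 1 = (chart_k1 true true)%:F &
      kmap2 t 1 s 1 = (chart_k2 true true)%:F].
Proof.
have [E0 E1 E2] := @rmorph_kmap C2 Fr (@tofrac C2) 'X%:P 1 'X 1.
by rewrite -[1]/(1 : Fr) -tofrac1; split; symmetry; [exact: E0 | exact: E1 | exact: E2].
Qed.

Opaque chart_k0 chart_k1 chart_k2 chart_m chart_conic chart_nodal.

Section OneChart.
Variables (e1 e2 : bool) (chi : {rmorphism B -> Fr}).
Hypothesis chiE : is_chart_morphism e1 e2 chi.
Local Notation c := (chart_conic e1 e2).

Let c_neq0 x y : value x y (chart_den e1 e2) != 0 -> value x y c != 0.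
Proof. by rewrite rmorphM mulf_eq0 negb_or => /andP []. Qed.

Lemma chart_X : chi X = (chart_k0 e1 e2 - chart_k1 e1 e2)%:F / c%:F.
Proof.
apply: (eq_of_values (chart_den_neq0 e1 e2)) => x y g.
exists (fun_at X (chart_point e1 e2 x y)); first exact: chiE.
exists (chart_k0 e1 e2 - chart_k1 e1 e2), c; split; rewrite ?c_neq0 //.
rewrite XE ?point_u_neq0 //; last exact/chart_pointP.
have [E0 E1 _] := value_chart_kmap e1 e2 x y.
congr (_ / _); last by rewrite value_chart_conic.
rewrite valueB.
exact: (congr2 (fun s t => s - t) (esym E0) (esym E1)).
Qed.

Lemma chart_Y : chi Y = (chart_m e1 e2)%:F / c%:F.
Proof.
apply: (eq_of_values (chart_den_neq0 e1 e2)) => x y g.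
exists (fun_at Y (chart_point e1 e2 x y)); first exact: chiE.
exists (chart_m e1 e2), c; split; rewrite ?c_neq0 //.
rewrite YE ?point_u_neq0 //; last exact/chart_pointP.
by rewrite value_chart_m value_chart_conic.
Qed.

Lemma chart_phi a : chi (phi a%:P) = subst (chi X) (chi Y) a.
Proof.
apply: (eq_of_values (chart_den_neq0 e1 e2)) => x y g.
exists (fun_at (phi a%:P) (chart_point e1 e2 x y)); first exact: chiE.
rewrite phiE; last exact/chart_pointP.
by rewrite map_polyC hornerC; apply: has_value_subst; apply: chiE.
Qed.

Lemma chart_jacobian x y : value x y (chart_den e1 e2) != 0 ->
  let D := frac_der (@der_y C) in let E := frac_der (@der_x C) in
  exists2 j, j != 0 & has_value x y (D (chi X) * E (chi Y) - E (chi X) * D (chi Y)) j.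
Proof.
move=> g D E; have cxy := c_neq0 g; have c0 := value_neq0 cxy.
have [n n0 JE] := chart_kmap_jacobian e1 e2.
have := @frac_jacobian {poly {poly C}} (@der_y C) (@der_x C) (chart_k0 e1 e2)
  (chart_k1 e1 e2) (chart_k2 e1 e2) a0%:P%:P a1%:P%:P a2%:P%:P m0%:P%:P m1%:P%:P m2%:P%:P
  c (chart_m e1 e2) (@derivation_y C) (@derivation_x C) _ (chart_conicE _ _) (chart_mE _ _) c0.
rewrite JE -chart_X -chart_Y.
have -> : m1%:P%:P * a2%:P%:P - m2%:P%:P * a1%:P%:P
    + (m0%:P%:P * a2%:P%:P - m2%:P%:P * a0%:P%:P) =
    (m1 * a2 - m2 * a1 + (m0 * a2 - m2 * a0))%:P%:P :> C2.
  by rewrite !polyCD !polyCN !polyCM.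
move: (m1 * a2 - m2 * a1 + (m0 * a2 - m2 * a0)) coords_indep => k k0 J.
exists (value x y c * k * (value x y (chart_nodal e1 e2) * value x y n)
    / (value x y c ^+ 2 * value x y c ^+ 2)).
  rewrite !mulf_neq0 ?invr_eq0 ?mulf_neq0 ?expf_neq0 //.
  by move: g; rewrite rmorphM mulf_eq0 negb_or => /andP [].
rewrite /D /E J.
  exists (c * k%:P%:P * (chart_nodal e1 e2 * n)), (c ^+ 2 * c ^+ 2).
  split=> //; first by rewrite rmorphM rmorphXn /= mulf_neq0 ?expf_neq0.
  by rewrite 4!rmorphM rmorphXn /= valueC.
move=> a; rewrite !inE => h.
have [l ->] : exists l : C, a = l%:P%:P.
  by move: h; do ![case/orP]; move/eqP => ->; eexists.
by rewrite der_yC /der_x !derivC polyC0.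
Qed.

End OneChart.

Lemma surface_point : exists v, U v.
Proof.
have [x [y g]] := exists_nonzero_value (chart_den_neq0 true true).
by exists (chart_point true true x y); apply/chart_pointP.
Qed.

(** The Jacobian determinant is not zero, so that the relations between X and Y
    are closed under differentiation. *)
Lemma phi_const_inj a : phi a%:P = 0 -> a = 0.
Proof.
have [chi chiE] := chart_morphism_exists true true.
have [x [y g]] := exists_nonzero_value (chart_den_neq0 true true).
have [j j0 jac] := chart_jacobian chiE g.
have yC k : der_y (k%:P%:P : C2) = 0 by rewrite der_yC derivC polyC0.
have xC k : der_x (k%:P%:P : C2) = 0 by rewrite /der_x derivC.
have ker b : phi b%:P = 0 -> phi (der_x b)%:P = 0 /\ phi (der_y b)%:P = 0.
  move=> b0; have : subst (chi X) (chi Y) b = 0 by rewrite -(chart_phi chiE) b0 rmorph0.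
  move/(unramified_kernel (@derivation_y C) (@derivation_x C) yC xC j0 jac) => [hx hy].
  by split; apply: (chart_morphism_inj chiE); rewrite (chart_phi chiE).
apply: (@der_closed_trivial C (fun b => phi b%:P = 0)) => [b /ker []|b /ker []|c] //.
have [v Uv] := surface_point; move/(congr1 (fun b : B => fun_at b v)).
rewrite fun_at0 phiE // map_polyC hornerC => c0.
by rewrite -(valueC (fun_at X v) (fun_at Y v) c).
Qed.

Lemma phi_X : phi 'X = p.
Proof. by apply: fun_at_inj => v Uv; rewrite phiE // map_polyX hornerX. Qed.

Lemma chart_phi_horner e1 e2 (chi : {rmorphism B -> Fr}) :
    is_chart_morphism e1 e2 chi ->
  forall q, chi (phi q) = (map_poly (subst (chi X) (chi Y)) q).[chi p].
Proof.
move=> chiE q; have phi_p := phi_X; have phi_a := chart_phi chiE.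
elim/poly_ind: q => [|q a IH]; first by rewrite !rmorph0 horner0.
rewrite !rmorphD !rmorphM /= IH phi_a map_polyX map_polyC /=.
by rewrite hornerD hornerM hornerX hornerC -phi_p.
Qed.

Variables al be ga : 'I_3 -> C.
Hypothesis coords_inv : forall y0 y1 y2 : C,
  let L := a0 * y0 + a1 * y1 + a2 * y2 in let m := m0 * y0 + m1 * y1 + m2 * y2 in
  [/\ y0 = L * al 0 + (y0 - y1) * be 0 + m * ga 0,
      y1 = L * al 1 + (y0 - y1) * be 1 + m * ga 1 &
      y2 = L * al 2 + (y0 - y1) * be 2 + m * ga 2].

Lemma surface_coordinates u1 u2 s w : (u1 != 0) || (u2 != 0) -> (s != 0) || (w != 0) ->
    U (blowup_pt u1 u2 s w) ->
  let x := fun_at X (blowup_pt u1 u2 s w) in let y := fun_at Y (blowup_pt u1 u2 s w) in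
  let c := conic u1 u2 s w in
  [/\ kmap0 u1 u2 s w / c = al 0 + x * be 0 + y * ga 0,
      kmap1 u1 u2 s w / c = al 1 + x * be 1 + y * ga 1 &
      kmap2 u1 u2 s w / c = al 2 + x * be 2 + y * ga 2].
Proof.
move=> u0 sw0 Uv x y c; have c0 : c != 0.
  by move: Uv; rewrite UP // mulf_eq0 negb_or => /andP [].
have := coords_inv (kmap0 u1 u2 s w / c) (kmap1 u1 u2 s w / c) (kmap2 u1 u2 s w / c).
cbv zeta.
have -> : a0 * (kmap0 u1 u2 s w / c) + a1 * (kmap1 u1 u2 s w / c)
    + a2 * (kmap2 u1 u2 s w / c) = 1.
  by rewrite !mulrA -!mulrDl divff.
have -> : m0 * (kmap0 u1 u2 s w / c) + m1 * (kmap1 u1 u2 s w / c)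
    + m2 * (kmap2 u1 u2 s w / c) = y by rewrite /y YE // !mulrA -!mulrDl.
have -> : kmap0 u1 u2 s w / c - kmap1 u1 u2 s w / c = x by rewrite /x XE // mulrBl.
by rewrite !mul1r.
Qed.

Definition plane_coord i : C2 := (al i)%:P%:P + 'X * (be i)%:P%:P + 'X%:P * (ga i)%:P%:P.

Lemma value_plane_coord x y i : value x y (plane_coord i) = al i + x * be i + y * ga i.
Proof.
transitivity (value x y (al i)%:P%:P + value x y 'X * value x y (be i)%:P%:P
  + value x y 'X%:P * value x y (ga i)%:P%:P); last by rewrite !valueC valueX valueY.
by rewrite /plane_coord (@rmorphD {poly {poly C}} C) (@rmorphD {poly {poly C}} C)
  (@rmorphM {poly {poly C}} C) (@rmorphM {poly {poly C}} C).
Qed.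

Lemma chart_plane_coord e1 e2 (chi : {rmorphism B -> Fr}) :
    is_chart_morphism e1 e2 chi ->
  [/\ (chart_k0 e1 e2)%:F / (chart_conic e1 e2)%:F = chi (phi (plane_coord 0)%:P),
      (chart_k1 e1 e2)%:F / (chart_conic e1 e2)%:F = chi (phi (plane_coord 1)%:P) &
      (chart_k2 e1 e2)%:F / (chart_conic e1 e2)%:F = chi (phi (plane_coord 2)%:P)].
Proof.
move=> chiE.
have main k i : (forall x y, value x y (chart_den e1 e2) != 0 ->
    let v := chart_point e1 e2 x y in
    value x y k / value x y (chart_conic e1 e2) =
    al i + fun_at X v * be i + fun_at Y v * ga i) ->
    k%:F / (chart_conic e1 e2)%:F = chi (phi (plane_coord i)%:P).
  move=> h; apply: (eq_of_values (chart_den_neq0 e1 e2)) => x y g.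
  pose v := chart_point e1 e2 x y; have Uv : U v by exact/chart_pointP.
  exists (value (fun_at X v) (fun_at Y v) (plane_coord i)).
    rewrite value_plane_coord -h //; exists k, (chart_conic e1 e2).
    by split=> //; move: g; rewrite rmorphM mulf_eq0 negb_or => /andP [].
  by have := chiE (phi (plane_coord i)%:P) x y g; rewrite -/v phiE // map_polyC hornerC.
split; apply: main => x y g v; rewrite value_chart_conic;
  have [E0 E1 E2] := value_chart_kmap e1 e2 x y; rewrite ?E0 ?E1 ?E2;
  by have [] := surface_coordinates (point_u_neq0 e1 y) (point_u_neq0 e2 x)
    ((chart_pointP e1 e2 x y).2 g).
Qed.

(** The coordinates t and s of the standard chart, hence all rational functions
    on the surface, are algebraic over the fractions in X and Y. *)
Lemma phi_algebraic : exists2 q, q != 0 & phi q = 0.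
Proof.
have [chi chiE] := chart_morphism_exists true true.
pose theta : {rmorphism C2 -> Fr} := subst (chi X) (chi Y).
have thetaE a : theta a = chi (phi a%:P) by rewrite (chart_phi chiE).
have theta_inj a : theta a = 0 -> a = 0.
  by rewrite thetaE => /(chart_morphism_inj chiE) /phi_const_inj.
have [psi psiE] := fraction_lift theta_inj.
have [E0 E1 E2] := chart_plane_coord chiE.
have [x [y g]] := exists_nonzero_value (chart_den_neq0 true true).
have c0 : (chart_conic true true)%:F^-1 != 0 :> Fr.
  by rewrite invr_eq0 tofrac_eq0; apply: (@value_neq0 C x y);
    move: g; rewrite rmorphM mulf_eq0 negb_or => /andP [].
have six : 6 != 0 :> Fr.
  rewrite -(rmorph_nat (@tofrac C2)) tofrac_eq0.
  apply: contraTneq (natU_poly (natU_poly (@natU_C C)) 5) => ->.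
  by rewrite unitr0.
have [S0 S1 S2] := standard_chart_kmap.
have [] := @fiber_algebraic {fraction C2} Fr psi (plane_coord 0)%:F (plane_coord 1)%:F
  (plane_coord 2)%:F ('X%:P)%:F 'X%:F _ six c0.
- by rewrite S0 E0 psiE thetaE.
- by rewrite S1 E1 psiE thetaE.
- by rewrite S2 E2 psiE thetaE.
move=> alg_t alg_s.
have alg_const k : algebraicOver psi (k%:P%:P : C2)%:F.
  have -> : (k%:P%:P : C2)%:F = psi (k%:P%:P : C2)%:F; last exact: algebraic_id.
  by rewrite psiE; symmetry; exact: substC.
have [P P0 rP] : algebraicOver psi (chi p).
  have [n [d [_ ->]]] := fraction_numden (chi p).
  exact: (@algebraic_generators C {fraction C2} Fr psi (@tofrac C2) alg_const alg_s alg_t n d).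
have [k [q [k0 qE]]] := clear_denominators P; exists q.
  apply: contraNneq P0 => q0; move/eqP: qE; rewrite q0 rmorph0 eq_sym scaler_eq0.
  by rewrite tofrac_eq0 (negbTE k0).
apply: (chart_morphism_inj chiE); rewrite (chart_phi_horner chiE).
have -> : map_poly theta q = map_poly psi (map_poly (@tofrac C2) q).
  by rewrite -map_poly_comp; apply: eq_map_poly => a; rewrite -psiE.
by rewrite qE map_polyZ /= hornerZ; move/eqP: rP => ->; rewrite mulr0.
Qed.

Hypothesis coords_inv' : [/\ a0 * al 0 + a1 * al 1 + a2 * al 2 = 1,
  a0 * ga 0 + a1 * ga 1 + a2 * ga 2 = 0, al 0 = al 1 & ga 0 = ga 1] /\
  (m0 * al 0 + m1 * al 1 + m2 * al 2 = 0 /\ m0 * ga 0 + m1 * ga 1 + m2 * ga 2 = 1).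

Lemma double_point_dir (z : C) : (1 - z != 0) || (- 1 - z != 0).
Proof.
rewrite -negb_and; apply/negP => /andP [/eqP h /eqP h'].
have /eqP : (2 : C) = 0 by transitivity ((1 - z) - (- 1 - z)); [ring | rewrite h h' subrr].
by rewrite Num.Theory.pnatr_eq0.
Qed.

(** Over X = 0, a square root is left to be chosen in the equations of a
    preimage. *)
Lemma double_point y z : let eta := al 0 + y * ga 0 in let zeta := al 2 + y * ga 2 in
    z != 0 -> eta != 0 -> eta * (3 * z ^+ 2 + 1) = 4 * zeta ->
  let v := blowup_pt (1 - z) (- 1 - z) 1 z in
  [/\ U v, fun_at X v = 0, fun_at Y v = y & conic (1 - z) (- 1 - z) 1 z = 4 / eta].
Proof.
move=> eta zeta z0 eta0 zE v; have [E0 E1 E2 EN] := double_point_values z.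
have [[aal aga al01 ga01] [mal mga]] := coords_inv'.
have E2' : 3 * z ^+ 2 + 1 = 4 / eta * zeta by rewrite mulrAC -zE [eta * _]mulrC mulfK.
have E4 : 4 = 4 / eta * eta by rewrite divfK.
have four : 4 != 0 :> C by rewrite Num.Theory.pnatr_eq0.
have cE : conic (1 - z) (- 1 - z) 1 z = 4 / eta.
  transitivity (4 / eta * ((a0 * al 0 + a1 * al 1 + a2 * al 2)
     + y * (a0 * ga 0 + a1 * ga 1 + a2 * ga 2))).
    rewrite /conic_form E0 E1 E2 E2' {1 2}E4 /eta /zeta -al01 -ga01; ring.
  by rewrite aal aga mulr0 addr0 mulr1.
have mE : mform (1 - z) (- 1 - z) 1 z = 4 / eta * y.
  transitivity (4 / eta * ((m0 * al 0 + m1 * al 1 + m2 * al 2)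
     + y * (m0 * ga 0 + m1 * ga 1 + m2 * ga 2))).
    rewrite /conic_form E0 E1 E2 E2' {1 2}E4 /eta /zeta -al01 -ga01; ring.
  by rewrite mal mga add0r mulr1.
have c0 : 4 / eta != 0 by rewrite mulf_neq0 ?invr_eq0.
have u0 := double_point_dir z; have s0 : ((1 : C) != 0) || (z != 0) by rewrite oner_neq0.
have Uv : U v by rewrite UP // EN cE !mulf_neq0 ?invr_eq0 // Num.Theory.pnatr_eq0.
split=> //.
  by rewrite XE // E0 E1 subrr mul0r.
by rewrite YE // cE mE mulrC mulKf.
Qed.

(** The function u1 x1 / conic takes different values at the two points of a
    fibre over X = 0. If it is a fraction d' / d, then d vanishes on the line X
    = 0, and d' as well; both can be divided by X, which contradicts the
    minimality of d. *)
Lemma phi_not_birational :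
  ~ forall b : B, exists c1 c2 : C2, c2 != 0 /\ phi c2%:P * b = phi c1%:P.
Proof.
pose c (i : 'I_2) (j : 'I_3) : C := ((i == 0) && (j == 0))%:R.
have [b bE] := bilinear_fraction c; move/(_ b) => [c1 [c2 c12]].
have [|d [d0 [d' dE]] dmin] := @exists_min_size _
  (fun d : C2 => d != 0 /\ exists d', phi d%:P * b = phi d'%:P).
  by exists c2; case: c12 => ? ?; split=> //; exists c1.
have bz y z : let eta := al 0 + y * ga 0 in let zeta := al 2 + y * ga 2 in
    z != 0 -> eta != 0 -> eta * (3 * z ^+ 2 + 1) = 4 * zeta ->
    value 0 y d * ((1 - z) / (4 / eta)) = value 0 y d'.
  move=> eta zeta z0 eta0 zE; have [Uv vX vY cE] := double_point z0 eta0 zE.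
  have E := congr1 (fun b => fun_at b (blowup_pt (1 - z) (- 1 - z) 1 z)) dE.
  rewrite fun_atM !phiE // !map_polyC !hornerC vX vY in E.
  rewrite -[RHS]E; congr (_ * _); rewrite bE ?double_point_dir ?oner_neq0 // cE.
  by rewrite meval_bilinear /c /=; congr (_ / _); ring.
have pol (k l : C) : (k != 0) || (l != 0) -> k%:P + l *: 'X != 0.
  apply: contraTneq => h; have h' t : k + l * t = 0.
    by rewrite -(horner0 t) -h !hornerE.
  have k0 : k = 0 by rewrite -(h' 0) mulr0 addr0.
  by rewrite k0 -(h' 1) k0 add0r mulr1 eqxx.
have [inv0 _ inv2] := coords_inv 1 1 0.
have eta_neq0 : (al 0 != 0) || (ga 0 != 0).
  rewrite -negb_and; apply/negP => /andP [/eqP h /eqP h']; move/eqP: inv0.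
  by rewrite h h' subrr mul0r !mulr0 !addr0 oner_eq0.
have zeta_neq0 : (4 * al 2 - al 0 != 0) || (4 * ga 2 - ga 0 != 0).
  rewrite -negb_and; apply/negP => /andP []; rewrite !subr_eq0 => /eqP h /eqP h'.
  move/eqP: (oner_neq0 C); apply; rewrite inv0 -h -h' -[RHS](mulr0 4) [in RHS]inv2; ring.
have pick (e : {poly C}) : e != 0 -> exists y z, [/\ e.[y] != 0, z != 0, al 0 + y * ga 0 != 0 &
    (al 0 + y * ga 0) * (3 * z ^+ 2 + 1) = 4 * (al 2 + y * ga 2)].
  move=> e0; have [|y] := @exists_nonroot C (e * ((al 0)%:P + ga 0 *: 'X)
      * ((4 * al 2 - al 0)%:P + (4 * ga 2 - ga 0) *: 'X)).
    by rewrite !mulf_neq0 ?pol.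
  rewrite !hornerM !mulf_eq0 !negb_or !hornerE.
  move=> /andP [/andP [ey ly] ky].
  have three : 3 != 0 :> C by rewrite Num.Theory.pnatr_eq0.
  pose k := (4 * al 2 - al 0 + (4 * ga 2 - ga 0) * y) / (3 * (al 0 + ga 0 * y)).
  have [z zk] : exists z, z ^+ 2 = k by exists (Num.Theory.sqrtC k); exact: Num.Theory.sqrtCK.
  have k0 : k != 0 by rewrite mulf_neq0 // invr_eq0 mulf_neq0.
  exists y, z; rewrite ey [y * ga 0]mulrC ly; split=> //.
    by apply: contraNneq k0 => z0; rewrite -zk z0 expr0n.
  by rewrite zk /k; field.
have val0 y e : value 0 y e = e.[0%:P].[y] by [].
have [dz|dz] := eqVneq (d.[0%:P]) 0; last first.
  have [y [z [dy z0 eta0 zE]]] := pick _ dz.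
  have := bz y (- z); rewrite oppr_eq0 sqrrN => /(_ z0 eta0 zE).
  rewrite -(bz y z z0 eta0 zE) val0 => /(mulfI dy)/mulIf h.
  have /eqP : z + z = 0.
    transitivity ((1 - - z) - (1 - z)); first by ring.
    by rewrite h ?subrr // invr_eq0 mulf_neq0 ?invr_eq0 // Num.Theory.pnatr_eq0.
  by rewrite -mulr2n Num.Theory.mulrn_eq0 (negbTE z0).
have d'z : d'.[0%:P] = 0.
  apply/eqP; apply: contraT => /pick [y [z [dy z0 eta0 zE]]].
  by move: dy; rewrite -val0 -(bz y z z0 eta0 zE) val0 dz horner0 mul0r eqxx.
have [|e eE] := factor_theorem d 0%:P _; first exact/eqP.
have [|e' e'E] := factor_theorem d' 0%:P _; first exact/eqP.
rewrite polyC0 subr0 in eE e'E.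
have e0 : e != 0 by apply: contraNneq d0 => e0; rewrite eE e0 mul0r.
suff /dmin : e != 0 /\ exists d', phi e%:P * b = phi d'%:P by rewrite eE size_mulX // ltnn.
split=> //; exists e'.
have : phi ('X)%:P * (phi e%:P * b - phi e'%:P) = 0.
  by move: dE; rewrite eE e'E !polyCM !rmorphM mulrBr mulrA [phi ('X)%:P * _]mulrC
    [phi ('X)%:P * phi e'%:P]mulrC => ->; rewrite subrr.
case/B_domain => [/phi_const_inj/eqP|/eqP]; first by rewrite polyX_eq0.
by rewrite subr_eq0 => /eqP.
Qed.

Hypothesis p_generic : (exists c1 c2 : C2, phi c2%:P != 0 /\ phi c2%:P * p = phi c1%:P) ->
  forall b : B, exists c1 c2 : C2, c2 != 0 /\ phi c2%:P * b = phi c1%:P.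

(** By Gauss's lemma, the kernel is generated by the primitive part of an
    element of minimal degree. The degree is not 1, for otherwise p, hence all
    functions, would be fractions in X and Y. *)
Lemma kernel_generator : exists f, [/\ primitive f, prime_elt f, (2 < size f)%N,
  (forall q, phi q = 0 <-> divides f q) &
  forall q, q != 0 -> phi q = 0 -> (size f <= size q)%N].
Proof.
have [q0 q00 q0K] := phi_algebraic.
have [|r [r0 rK] rmin] := @exists_min_size _ (fun q => q != 0 /\ phi q = 0).
  by exists q0.
have fC := @factorial_C2 C; have [c [f [c0 pf rE]]] := content fC r0.
have fK : phi f = 0.
  move: rK; rewrite rE rmorphM => /B_domain [/phi_const_inj /eqP|//].
  by rewrite (negbTE c0).
have f0 : f != 0 by apply: contraNneq r0 => f0; rewrite rE f0 mulr0.
have fmin q : q != 0 -> phi q = 0 -> (size f <= size q)%N.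
  move=> q0' qK; apply: leq_trans (rmin q (conj q0' qK)).
  by rewrite rE size_Cmul ?c0.
have fker q : phi q = 0 <-> divides f q.
  split=> [qK|[k ->]]; last by rewrite rmorphM fK mulr0.
  have [|||d d0 fd] := @minimal_size_divides _ (fun q => phi q = 0) f _ _ fK f0 _ q qK.
  - by move=> a b aK bK; rewrite rmorphB aK bK subrr.
  - by move=> a b aK; rewrite rmorphM aK mulr0.
  - by move=> a aK a0'; exact: fmin.
  exact: primitive_divides_cancel pf d0 fd.
exists f; split=> //.
  split=> // [|a b /fker].
    apply/negP => fu; have [v Uv] := surface_point.
    have : phi (f^-1 * f) = 0 by rewrite rmorphM fK mulr0.
    rewrite mulVr // rmorph1 => /(congr1 (fun b : B => fun_at b v)).
    by rewrite fun_at1 // fun_at0 => /eqP; rewrite oner_eq0.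
  by rewrite rmorphM => /B_domain [/fker|/fker]; [left | right].
rewrite ltnNge; apply/negP => sf; apply: phi_not_birational; apply: p_generic.
have fE : f = f`_1 *: 'X + (f`_0)%:P.
  apply/polyP => -[|[|i]]; rewrite coefD coefZ coefX coefC /= ?mulr0 ?mulr1 ?add0r ?addr0 //.
  by rewrite nth_default // (leq_trans sf).
exists (- f`_0), f`_1; split.
  apply: contraNneq f0 => /phi_const_inj f1; move: fK.
  rewrite fE f1 scale0r add0r => /phi_const_inj ->.
  by rewrite polyC0.
apply/eqP; rewrite -subr_eq0 polyCN rmorphN opprK -phi_X -rmorphM -rmorphD.
by rewrite mul_polyC -fE fK.
Qed.

(** If f'(p) had no zero it would be a constant k, and f' - k would be a
    relation of smaller degree than f; it is not zero, because f' is not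
    constant. *)
Lemma ramification_point (f : {poly C2}) : (2 < size f)%N ->
    (forall q, q != 0 -> phi q = 0 -> (size f <= size q)%N) ->
  phi f^`() != 0 /\ exists2 v, U v & fun_at (phi f^`()) v = 0.
Proof.
move=> sf fmin; have natU : forall n, (n.+1%:R : C2) \is a GRing.unit.
  exact/natU_poly/natU_poly/natU_C.
have sdf := size_deriv_natU f natU.
have sdf2 k : (size (f^`() - k%:P%:P%:P)%R < size f)%N.
  apply: leq_ltn_trans (size_polyD _ _) _; rewrite size_polyN gtn_max sdf.
  rewrite prednK ?leqnn ?(leq_trans _ sf) //=.
  by rewrite (leq_ltn_trans (size_polyC_leq1 _)) // (ltn_trans _ sf).
have key k : phi (f^`() - k%:P%:P%:P) = 0 -> False.
  move=> h; have [e|/fmin /(_ h)] := eqVneq (f^`() - k%:P%:P%:P) 0; last by rewrite leqNgt sdf2.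
  have : (size f^`() <= 1)%N by rewrite (subr0_eq e); exact: size_polyC_leq1.
  by rewrite sdf -subn1 leq_subLR leqNgt sf.
split.
  by apply/eqP => h; apply: (key 0); rewrite !polyC0 subr0.
apply: contrapT => no; have [|k kE] := @unit_constant (phi f^`()).
  by move=> v Uv; apply/eqP => h; apply: no; exists v.
apply: (key k); apply: fun_at_inj => v Uv.
rewrite rmorphB fun_atB fun_at0 kE // phiE // map_polyC hornerC.
by rewrite -{1}(valueC (fun_at X v) (fun_at Y v) k); exact: subrr.
Qed.

(** At a zero of f'(p), the formal derivative in p is compatible with the
    relation f, and there is a curve along which f'(p) vanishes. *)
Theorem image_singular :
  (exists (h : C2) (beta : B) (q1 q2 q3 : {poly C2}), let eta := phi h%:P in
    [/\ exists q, beta = phi q,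
        (beta - phi q1 * eta) * (beta - phi q2 * eta) = phi q3 * eta ^+ 2 &
        forall g, beta <> phi g * eta]) /\
  exists2 v, U v & forall q r, phi q = phi r ->
    fun_at (phi q^`()) v = fun_at (phi r^`()) v.
Proof.
have [f [pf primef sf fker fmin]] := kernel_generator.
have [df0 [v Uv dfv]] := ramification_point sf fmin; split; last first.
  exists v => // q r qr; have /fker [k kE] : phi (q - r) = 0 by rewrite rmorphB qr subrr.
  have -> : q = k * f + r by rewrite -kE subrK.
  have fK : phi f = 0 by apply/fker; exact: divides_refl.
  by rewrite derivD derivM !rmorphD !rmorphM fK mulr0 add0r fun_atD fun_atM dfv mulr0 add0r.
have [e1 [e2 [x [y [g vE]]]]] := chart_cover Uv.
have [chi chiE] := chart_morphism_exists e1 e2.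
have [j j0 jac] := chart_jacobian chiE g.
apply: (@ramified_not_normal C B phi chi (chi X) (chi Y) x y j (chart_phi chiE) _ _ _ j0 jac f).
- by exists X.
- by exists Y.
- by move=> b; exists (fun_at b (chart_point e1 e2 x y)); exact: chiE.
- exact: pf.
- exact: primef.
- exact: ltnW sf.
- exact: fker.
- by apply: contraNneq df0 => /(chart_morphism_inj chiE) ->.
by rewrite -dfv vE; exact: chiE.
Qed.

End AbstractSurface.

(** * Normality and ramification *)

(** The fraction beta / eta is a root of a monic polynomial of degree 2. *)
Lemma quadratic_not_normal (D : comPzRingType) (beta eta t1 t2 t3 : D) :
    (beta - t1 * eta) * (beta - t2 * eta) = t3 * eta ^+ 2 ->
    (forall g, beta <> g * eta) -> ~ normal_domain D.
Proof.
move=> quad nd [K [iota [[inj _] normal]]].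
have inj0 b : iota b = 0 -> b = 0 by rewrite -(rmorph0 iota) => /inj.
have quad' : (iota beta - iota t1 * iota eta) * (iota beta - iota t2 * iota eta) =
    iota t3 * iota eta ^+ 2 by rewrite -rmorphXn -!rmorphM -!rmorphB -!rmorphM quad.
have eta0 : iota eta != 0.
  apply/eqP => h; move: quad'; rewrite h !mulr0 !subr0 expr0n mulr0 => /eqP.
  rewrite mulf_eq0 orbb => /eqP /inj0 b0; case: (nd 0); by rewrite b0 mul0r.
pose q : {poly K} := \poly_(i < 3) iota [:: t1 * t2 - t3; - (t1 + t2); 1]`_i.
have [|d zE] := normal (iota beta / iota eta).
  exists q; split.
  - by rewrite monicE lead_coef_poly //= (rmorph1 iota) ?oner_neq0.
  - by move=> i; rewrite coef_poly; case: ifP => _; eexists; first done; rewrite -(rmorph0 iota).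
  rewrite /root /q horner_poly !big_ord_recr big_ord0 /= expr0 expr1 !mulr1 add0r.
  apply/eqP; apply: (mulIf (expf_neq0 2 eta0)); rewrite mul0r -[RHS](subrr (iota t3 * iota eta ^+ 2)).
  rewrite -{1}quad' !rmorphB rmorphN rmorphM rmorphD rmorph1. field; exact: eta0.
by apply: (nd d); apply: inj; rewrite rmorphM -zE divfK.
Qed.

(** The dual numbers C[eps], the pair (x, y) being x + y eps. *)
Definition dual (C : comNzRingType) : Type := (C * C)%type.

Section Dual.
Variable C : comNzRingType.

HB.instance Definition _ := GRing.Zmodule.copy (dual C) (C * C)%type.

Definition dual_one : dual C := (1, 0).
Definition dual_mul (u v : dual C) : dual C := (u.1 * v.1, u.1 * v.2 + u.2 * v.1).

Fact dual_mulA : associative dual_mul.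
Proof. by case=> [a b] [c d] [e f]; congr pair => /=; ring. Qed.
Fact dual_mulC : commutative dual_mul.
Proof. by case=> [a b] [c d]; congr pair => /=; ring. Qed.
Fact dual_mul1 : left_id dual_one dual_mul.
Proof. by case=> [a b]; congr pair => /=; ring. Qed.
Fact dual_mulD : left_distributive dual_mul +%R.
Proof. by case=> [a b] [c d] [e f]; congr pair => /=; ring. Qed.

HB.instance Definition _ := GRing.Zmodule_isComPzRing.Build (dual C)
  dual_mulA dual_mulC dual_mul1 dual_mulD.

End Dual.

(** Both e and e + d eps lift e to the dual numbers, and they agree on A. *)
Lemma tangent_vector_ramified (A D : comPzRingType) (f : {rmorphism A -> D}) (C : comNzRingType)
    (e : {rmorphism D -> C}) (d : D -> C) (t : D) :
    (forall b c, d (b - c) = d b - d c) ->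
    (forall b c, d (b * c) = e b * d c + d b * e c) ->
    (forall a, d (f a) = 0) -> d t != 0 ->
  ~ formally_unramified f.
Proof.
move=> dB dM df dt unr.
pose g1 b : dual C := (e b, 0); pose g2 b : dual C := (e b, d b).
have g1Z : zmod_morphism g1 by move=> b c; congr pair; rewrite ?rmorphB //= subr0.
have g1M : monoid_morphism g1.
  split=> [|b c]; congr pair; rewrite ?rmorph1 ?rmorphM //=; by rewrite mulr0 mul0r addr0.
have g2Z : zmod_morphism g2 by move=> b c; congr pair; rewrite ?rmorphB.
have d1 : d 1 = 0 by rewrite -(rmorph1 f).
have g2M : monoid_morphism g2.
  by split=> [|b c]; congr pair; rewrite ?rmorph1 ?rmorphM.
pose Z1 := GRing.isZmodMorphism.Build D (dual C) g1 g1Z.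
pose M1 := GRing.isMonoidMorphism.Build D (dual C) g1 g1M.
pose Z2 := GRing.isZmodMorphism.Build D (dual C) g2 g2Z.
pose M2 := GRing.isMonoidMorphism.Build D (dual C) g2 g2M.
apply/negP: dt; rewrite negbK; apply/eqP.
have inI (u v w : dual C) : (u + v).1 = u.1 + v.1 /\ (u * v).1 = u.1 * v.1 by [].
have /(congr1 snd) : g1 t = g2 t; last by [].
apply: (@unr (dual C) [pred u : dual C | u.1 == 0] _ _ _ (HB.pack_for {rmorphism D -> dual C} g1 Z1 M1)
  (HB.pack_for {rmorphism D -> dual C} g2 Z2 M2)).
- by rewrite inE.
- move=> u v w /eqP v0 /eqP w0; apply/eqP.
  by transitivity (u.1 * v.1 + w.1); rewrite // v0 w0 mulr0 addr0.
- move=> [u1 u2] [v1 v2] /eqP /= -> /eqP /= ->; congr pair; by rewrite /= !(mul0r, mulr0, addr0).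
- by move=> b; congr pair; rewrite df.
by move=> b; apply/eqP; exact: subrr.
Qed.

Section AdjoinedSubring.
Variables (B : comPzRingType) (A : subringClosed B) (p : B).
Variables (E : comNzRingType) (phi : {rmorphism {poly E} -> B}).
Hypothesis A_phi : forall b, b \in A <-> exists c, b = phi c%:P.
Hypothesis phi_X : phi 'X = p.

Lemma adjoin_range b : b \in adjoin A p <-> exists q, b = phi q.
Proof.
split=> [/asboolP|[q ->]]; last first.
  apply/asboolP => D [D1 DB DM] AD pD.
  have D0 : 0 \in D by rewrite -(subrr 1); exact: DB.
  have DD x y : x \in D -> y \in D -> x + y \in D.
    by move=> xD yD; rewrite -[y]opprK; apply: (DB) => //; rewrite -sub0r; exact: DB.
  elim/poly_ind: q => [|q c IH]; first by rewrite rmorph0.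
  rewrite rmorphD rmorphM phi_X; apply: DD; first exact: DM.
  by apply: AD; apply/A_phi; exists c.
move=> /(_ (fun b => `[< exists q, b = phi q >])) h; apply/asboolP; apply: h.
- split=> [|x y /asboolP [q ->] /asboolP [r ->]|x y /asboolP [q ->] /asboolP [r ->]];
    apply/asboolP.
  + by exists 1; rewrite rmorph1.
  + by exists (q - r); rewrite rmorphB.
  by exists (q * r); rewrite rmorphM.
- by move=> x /A_phi [c ->]; apply/asboolP; exists c%:P.
by apply/asboolP; exists 'X.
Qed.

Lemma adjoin_not_normal h q q1 q2 q3 : let eta := phi h in
    (phi q - phi q1 * eta) * (phi q - phi q2 * eta) = phi q3 * eta ^+ 2 ->
    (forall g, phi q <> phi g * eta) ->
  ~ normal_domain (subring_of (adjoin A p)).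
Proof.
move=> eta quad nd; pose D := subring_of (adjoin A p).
pose el q' : D := Sub (phi q') ((adjoin_range _).2 (ex_intro _ q' erefl)).
apply: (@quadratic_not_normal D (el q) (el h) (el q1) (el q2) (el q3)).
  exact: val_inj.
move=> g /(congr1 val) /=; have [q' ->] := (adjoin_range _).1 (valP g).
exact: nd.
Qed.

(** The hypothesis makes the formal derivative of polynomials a tangent vector
    at the point e, which is trivial on A but not on p. *)
Lemma adjoin_ramified (C : comNzRingType) (e : {rmorphism B -> C}) :
    (forall q r, phi q = phi r -> e (phi q^`()) = e (phi r^`())) ->
  ~ formally_unramified (adjoin_incl A p).
Proof.
move=> wd; pose D := subring_of (adjoin A p).
have D_phi (x : D) : exists q, val x = phi q by exact: (adjoin_range _).1 (valP x).
have [poly polyE] := choice D_phi.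
pose d (x : D) := e (phi (poly x)^`()).
have dE x q : val x = phi q -> d x = e (phi q^`()).
  by move=> xE; apply: wd; rewrite -polyE.
pose X : D := Sub (phi 'X) ((adjoin_range _).2 (ex_intro _ 'X erefl)).
apply: (@tangent_vector_ramified _ D (adjoin_incl A p) C (e \o val : {rmorphism D -> C}) d X).
- move=> x y; rewrite (dE (x - y) (poly x - poly y)); first by rewrite derivB !rmorphB.
  by rewrite !rmorphB -!polyE.
- move=> x y; rewrite (dE (x * y) (poly x * poly y)); last by rewrite !rmorphM -!polyE.
  by rewrite derivM !rmorphD !rmorphM addrC -!polyE.
- move=> x; have [c cE] := (A_phi _).1 (valP x).
  by rewrite (dE _ c%:P) // derivC !rmorph0.
by rewrite (dE _ 'X) // derivX !rmorph1 oner_neq0.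
Qed.

(** The quotients of elements of A form a field, which contains p. *)
Lemma primitive_fraction (K : fieldType) (iota : {rmorphism B -> K}) : injective iota ->
    primitive_element A iota p ->
    (exists c1 c2, phi c2%:P != 0 /\ phi c2%:P * p = phi c1%:P) ->
  forall b : B, exists c1 c2, c2 != 0 /\ phi c2%:P * b = phi c1%:P.
Proof.
move=> iota_inj p_primitive [d1 [d2 [d20 pE]]] b.
have inj0 b' : iota b' = 0 -> b' = 0 by rewrite -(rmorph0 iota) => /iota_inj.
pose t c := iota (phi c%:P).
have tB c c' : t (c - c') = t c - t c' by rewrite /t polyCB !rmorphB.
have tM c c' : t (c * c') = t c * t c' by rewrite /t polyCM !rmorphM.
have t0 : t 0 = 0 by rewrite /t !rmorph0.
have t1 : t 1 = 1 by rewrite /t !rmorph1.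
pose fracA : {pred K} := fun x => `[< exists c1 c2, t c2 != 0 /\ x = t c1 / t c2 >].
suff /asboolP [c1 [c2 [c20 bE]]] : iota b \in fracA.
  exists c1, c2; split; first by apply: contraNneq c20 => ->; rewrite t0.
  by apply: iota_inj; rewrite rmorphM bE mulrC divfK.
have t_d2 : t d2 != 0 by apply: contraNneq d20 => /inj0 ->.
apply: (@p_primitive fracA) => [|x y /A_phi [c1 ->] /A_phi [c2 ->] c20|].
- split=> [|x y /asboolP [c1 [c2 [c20 ->]]] /asboolP [e1 [e2 [e20 ->]]]|
            x y /asboolP [c1 [c2 [c20 ->]]] /asboolP [e1 [e2 [e20 ->]]]]; apply/asboolP.
  + by exists 1, 1; rewrite t1 divff oner_neq0.
  + exists (c1 * e2 - e1 * c2), (c2 * e2).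
    by rewrite tB !tM mulf_neq0 // subf_div.
  have [e10|e10] := eqVneq (t e1) 0.
    by exists 0, 1; rewrite e10 t1 t0 oner_neq0 !mul0r invr0 mulr0.
  by exists (c1 * e2), (c2 * e1); rewrite !tM mulf_neq0 // invf_div mulf_div.
- by apply/asboolP; exists c1, c2.
apply/asboolP; exists d1, d2; split=> //.
by rewrite /t -pE rmorphM mulrC mulKf.
Qed.

End AdjoinedSubring.

Lemma fun_at_morphism (C : fieldType) n k (gr : 'I_n -> 'I_k) (U : set 'rV[C]_n) v : U v ->
  exists e : {rmorphism regular_ring gr U -> C}, forall b, e b = fun_at b v.
Proof.
move=> Uv; pose e b := @fun_at C n k gr U b v.
have eZ : zmod_morphism e by move=> x y; exact: fun_atB.
have eM : monoid_morphism e by split=> [|x y]; [exact: fun_at1 | exact: fun_atM].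
pose ZM := GRing.isZmodMorphism.Build (regular_ring gr U) C e eZ.
pose MM := GRing.isMonoidMorphism.Build (regular_ring gr U) C e eM.
by exists (HB.pack_for {rmorphism regular_ring gr U -> C} e ZM MM).
Qed.

(** * The affine plane *)

(** For a suitable linear form M, the functions (y0 - y1) / L and M / L are
    affine coordinates on the complement of the line L = 0: as a is not
    proportional to (1, -1, 0), the forms L and y0 - y1 are independent. *)
Lemma plane_coordinates (C : fieldType) (a0 a1 a2 : C) : (a2 != 0) || (a0 + a1 != 0) ->
  exists (m0 m1 m2 : C) (al be ga : 'I_3 -> C),
  [/\ m1 * a2 - m2 * a1 + (m0 * a2 - m2 * a0) != 0,
   (forall y0 y1 y2 : C,
      let L := a0 * y0 + a1 * y1 + a2 * y2 in let m := m0 * y0 + m1 * y1 + m2 * y2 in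
      [/\ y0 = L * al 0 + (y0 - y1) * be 0 + m * ga 0,
          y1 = L * al 1 + (y0 - y1) * be 1 + m * ga 1 &
          y2 = L * al 2 + (y0 - y1) * be 2 + m * ga 2]),
   [/\ a0 * al 0 + a1 * al 1 + a2 * al 2 = 1,
       a0 * ga 0 + a1 * ga 1 + a2 * ga 2 = 0, al 0 = al 1 & ga 0 = ga 1],
   m0 * al 0 + m1 * al 1 + m2 * al 2 = 0 /\ m0 * ga 0 + m1 * ga 1 + m2 * ga 2 = 1 &
   a0 * be 0 + a1 * be 1 + a2 * be 2 = 0].
Proof.
have [a20|a20 /= s0] := eqVneq a2 0; last first.
  exists 1, 0, 0, (fun i : 'I_3 => [:: 0; 0; a2^-1]`_i), (fun i : 'I_3 => [:: 0; -1; a1 / a2]`_i),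
    (fun i : 'I_3 => [:: 1; 1; - ((a0 + a1) / a2)]`_i) => /=.
  split; [|move=> y0 y1 y2; split| split| split|]; try by field.
  by rewrite (_ : _ + _ = a2) //; ring.
set s := a0 + a1; move=> /= s0.
exists 0, 0, 1, (fun i : 'I_3 => [:: s^-1; s^-1; 0]`_i), (fun i : 'I_3 => [:: a1 / s; a1 / s - 1; 0]`_i),
  (fun i : 'I_3 => [:: 0; 0; 1]`_i) => /=; rewrite a20.
split; [|move=> y0 y1 y2; split| split| split|]; try by rewrite /s; field.
by rewrite !(mul0r, mul1r, sub0r) -opprD oppr_eq0 addrC.
Qed.

Section Plane.
Variables (C : numClosedFieldType) (a al be ga : 'I_3 -> C) (m0 m1 m2 : C).
Local Notation C2 := {poly {poly C}}.

Definition affine_plane : set 'rV[C]_3 :=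
  [set y | y != 0 /\ \sum_(i < 3) a i * y 0 i != 0].

Local Notation V := affine_plane.
Local Notation L y := (\sum_(i < 3) a i * y 0 i).
Local Notation M y := (m0 * y 0 0 + m1 * y 0 1 + m2 * y 0 2).
Local Notation A := (regular_ring P2_grading V).

Hypothesis coords_inv : forall y0 y1 y2 : C,
  let L := a 0 * y0 + a 1 * y1 + a 2 * y2 in let m := m0 * y0 + m1 * y1 + m2 * y2 in
  [/\ y0 = L * al 0 + (y0 - y1) * be 0 + m * ga 0,
      y1 = L * al 1 + (y0 - y1) * be 1 + m * ga 1 &
      y2 = L * al 2 + (y0 - y1) * be 2 + m * ga 2].
Hypothesis aal : a 0 * al 0 + a 1 * al 1 + a 2 * al 2 = 1.
Hypothesis abe : a 0 * be 0 + a 1 * be 1 + a 2 * be 2 = 0.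
Hypothesis aga : a 0 * ga 0 + a 1 * ga 1 + a 2 * ga 2 = 0.

Let plane_ptE x y i : chart_pt (plane_coord al be ga) x y 0 i = al i + x * be i + y * ga i.
Proof. by rewrite mxE value_plane_coord. Qed.

Let plane_ptV x y : V (chart_pt (plane_coord al be ga) x y).
Proof.
have LE : L (chart_pt (plane_coord al be ga) x y) = 1.
  rewrite sum3 !plane_ptE; transitivity ((a 0 * al 0 + a 1 * al 1 + a 2 * al 2)
    + x * (a 0 * be 0 + a 1 * be 1 + a 2 * be 2) + y * (a 0 * ga 0 + a 1 * ga 1 + a 2 * ga 2)).
    by ring.
  by rewrite aal abe aga !mulr0 !addr0.
split; last by rewrite LE oner_neq0.
apply/eqP => h; have /eqP : 1 = 0 :> C; last by rewrite oner_eq0.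
by rewrite -LE h big1 // => i _; exact: mulr0.
Qed.

(** In lowest terms, g has no denominator: it has a value everywhere on the
    plane. *)
Lemma plane_polynomial (g : A) : exists c : C2, forall y, V y ->
  fun_at g y = value ((y 0 0 - y 0 1) / L y) (M y / L y) c.
Proof.
have [u uE] := @chart_fraction C 3 1 P2_grading V (plane_coord al be ga) 1 (oner_neq0 _)
  (fun x y _ => plane_ptV x y) g.
have v1 x y : value x y (1 : C2) != 0 by rewrite (rmorph1 (value x y)) oner_neq0.
have [x y _|n [m [m0' uE' _ md]]] := @reduced_denominator C 1 u.
  by eexists; apply: uE; exact: v1.
have mu : m \is a GRing.unit.
  apply: contraT => mnu; have [q pq /(md _ pq)] := exists_prime_divisor (@factorial_C2 C) m0' mnu.
  by move/(prime_ndiv_unit pq); case; exact: unitr1.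
have [k k0 mE] := unit_C2 mu.
exists (k^-1%:P%:P * n) => y Vy; have [y0 L0] := Vy.
set s := (_ - _) / _; set t := _ / L y.
transitivity (fun_at g (chart_pt (plane_coord al be ga) s t)).
  symmetry; apply: (@fun_at_rescale _ _ _ _ _ g (fun=> (L y)^-1)) => //.
  - by move=> j; rewrite invr_eq0.
  move=> i; rewrite plane_ptE /s /t; have := coords_inv (y 0 0) (y 0 1) (y 0 2).
  have LE : a 0 * y 0 0 + a 1 * y 0 1 + a 2 * y 0 2 = L y by rewrite sum3.
  cbv zeta; rewrite LE => -[E0 E1 E2].
  by case: (ord3P i) => ->; [rewrite {3}E0 | rewrite {3}E1 | rewrite {2}E2]; field.
apply: has_value_inj (uE s t (v1 s t)) _; exists n, m; split=> //.
  by rewrite mE valueC.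
by rewrite (@rmorphM {poly {poly C}} C (value s t)) /= mE !valueC mulrC.
Qed.

Lemma polynomial_plane (c : C2) : exists g : A, forall y, V y ->
  fun_at g y = value ((y 0 0 - y 0 1) / L y) (M y / L y) c.
Proof.
have lin (k : 'I_3 -> C) : exists2 G : {mpoly C[3]}, multihomog P2_grading (fun=> 1%N) G &
    forall y : 'rV[C]_3, G.@[y 0] = \sum_(i < 3) k i * y 0 i.
  exists (\sum_(i < 3) k i *: 'X_i).
    by apply: multihomog_sum => i; apply: multihomogZ => mm h j; rewrite (multihomogX P2_grading h) !ord1.
  by move=> y; rewrite rmorph_sum; apply: eq_bigr => i _; rewrite /= mevalZ mevalXU.
have [H hH HE] := lin a.
have frac (k : 'I_3 -> C) : exists b : A, forall y, V y ->
    fun_at b y = (\sum_(i < 3) k i * y 0 i) / L y.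
  have [G hG GE] := lin k.
  have [y [_ Ly]|b bE] := @regular_fraction C 3 1 P2_grading V _ G H hG hH; first by rewrite HE.
  by exists b => y Vy; rewrite bE // GE HE.
have [X XE] := frac (fun i : 'I_3 => [:: 1; -1; 0]`_i).
have [Y YE] := frac (fun i : 'I_3 => [:: m0; m1; m2]`_i).
have [phi phiE] := @evaluation_exists C 3 1 P2_grading V X Y 0.
exists (phi c%:P) => y Vy; rewrite phiE // map_polyC hornerC XE // YE //.
congr (value (_ / _) (_ / _) c); rewrite sum3 //=.
by rewrite mul1r mulN1r mul0r addr0.
Qed.

End Plane.

(** * The subring generated by a primitive element *)

Section AdjoinedElement.
Variables (C : numClosedFieldType) (a : 'I_3 -> C) (U : set 'rV[C]_(3 + 2)).
Local Notation C2 := {poly {poly C}}.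
Local Notation B := (regular_ring P2xP1_grading U).
Local Notation conic := (conic_form (a 0) (a 1) (a 2)).
Local Notation V := (affine_plane a).
Hypothesis U_param : forall v, U v -> exists u1 u2 s w,
  [/\ v = blowup_pt u1 u2 s w, (u1 != 0) || (u2 != 0) & (s != 0) || (w != 0)].
Hypothesis UP : forall u1 u2 s w : C, (u1 != 0) || (u2 != 0) -> (s != 0) || (w != 0) ->
  U (blowup_pt u1 u2 s w) <-> nodal_form u1 u2 s w * conic u1 u2 s w != 0.
Hypothesis no_fiber : forall u1 u2 : C, (u1 != 0) || (u2 != 0) ->
  conic u1 u2 0 1 = 0 -> conic u1 u2 1 0 != 0.
Hypothesis line : (a 2 != 0) || (a 0 + a 1 != 0).
Variable F : 'rV[C]_(3 + 2) -> 'rV[C]_3.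
Hypothesis FE : forall u1 u2 s w, F (blowup_pt u1 u2 s w) =
  \row_i [:: kmap0 u1 u2 s w; kmap1 u1 u2 s w; kmap2 u1 u2 s w]`_i.

Lemma image_in_plane v : U v -> V (F v).
Proof.
move=> Uv; have [u1 [u2 [s [w [vE u0 sw0]]]]] := U_param Uv; rewrite vE in Uv *.
have LE : \sum_(i < 3) a i * F (blowup_pt u1 u2 s w) 0 i = conic u1 u2 s w.
  by rewrite FE sum3 !mxE.
have L0 : conic u1 u2 s w != 0.
  by move: Uv; rewrite UP // mulf_eq0 negb_or => /andP [].
split; last by rewrite LE.
apply: contraNneq L0 => h; rewrite -LE h big1 // => i _; exact: mulr0.
Qed.

Variables (K : fieldType) (iota : {rmorphism B -> K}) (A : subringClosed B) (p : B).
Hypothesis iota_inj : injective iota.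
Hypothesis image_A : forall b, b \in A <-> exists g : regular_ring P2_grading V,
  forall v, U v -> fun_at b v = fun_at g (F v).
Hypothesis p_primitive : primitive_element A iota p.

Theorem adjoin_not_normal_ramified :
  ~ normal_domain (subring_of (adjoin A p)) /\ ~ formally_unramified (adjoin_incl A p).
Proof.
have inj0 b : iota b = 0 -> b = 0 by rewrite -(rmorph0 iota) => /iota_inj.
have B_domain (b b' : B) : b * b' = 0 -> b = 0 \/ b' = 0.
  move=> /(congr1 iota) /eqP; rewrite rmorphM rmorph0 mulf_eq0.
  by case/orP => /eqP /inj0; [left | right].
have [m0 [m1 [m2 [al [be [ga [indep inv [aal aga al01 ga01] mm abe]]]]]]] := plane_coordinates line.
have frac (m : 'I_3 -> C) : exists b : B, forall v, U v ->
    fun_at b v = (\sum_(i < 3) m i * F v 0 i) / (\sum_(i < 3) a i * F v 0 i).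
  have [b bE] := bilinear_fraction U_param UP (conic_coef m); exists b => v Uv.
  have [u1 [u2 [s [w [vE u0 sw0]]]]] := U_param Uv; rewrite vE in Uv *.
  by rewrite bE // meval_conic_coef FE !sum3 !mxE.
have [X XE'] := frac (fun i : 'I_3 => [:: 1; -1; 0]`_i).
have [Y YE'] := frac (fun i : 'I_3 => [:: m0; m1; m2]`_i).
have [phi phiE] := evaluation_exists X Y p.
have XE v : U v -> fun_at X v = (F v 0 0 - F v 0 1) / (\sum_(i < 3) a i * F v 0 i).
  by move=> /XE' ->; rewrite sum3 /= mul1r mulN1r mul0r addr0.
have YE v : U v -> fun_at Y v = (m0 * F v 0 0 + m1 * F v 0 1 + m2 * F v 0 2)
    / (\sum_(i < 3) a i * F v 0 i) by move=> /YE' ->; rewrite sum3.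
have A_phi b : b \in A <-> exists c : C2, b = phi c%:P.
  split=> [/image_A [g gE]|[c ->]]; last first.
    have [g gE] := polynomial_plane a m0 m1 m2 c; apply/image_A; exists g => v Uv.
    by rewrite gE -?XE -?YE ?phiE ?map_polyC ?hornerC //; exact: image_in_plane.
  have [c cE] := plane_polynomial inv aal abe aga g; exists c; apply: fun_at_inj => v Uv.
  by rewrite gE // cE -?XE -?YE ?phiE ?map_polyC ?hornerC //; exact: image_in_plane.
have phi_X : phi 'X = p.
  by apply: fun_at_inj => v Uv; rewrite phiE // map_polyX hornerX.
have p_generic := primitive_fraction A_phi iota_inj p_primitive.
have L0 u1 u2 s w : (u1 != 0) || (u2 != 0) -> (s != 0) || (w != 0) ->
    \sum_(i < 3) a i * F (blowup_pt u1 u2 s w) 0 i = conic u1 u2 s w.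
  by move=> u0 sw0; rewrite FE sum3 !mxE.
have [|||[h [beta [q1 [q2 [q3 [[q betaE] quad nd]]]]]] [v Uv vE]] :=
  image_singular U_param UP no_fiber B_domain indep _ _ phiE inv _ p_generic.
- by move=> u1 u2 s w u0 sw0 Uv; rewrite XE // L0 // FE !mxE.
- by move=> u1 u2 s w u0 sw0 Uv; rewrite YE // L0 // FE !mxE.
- by [].
split.
  by rewrite betaE in quad nd; exact: (adjoin_not_normal A_phi phi_X quad nd).
have [e eE] := @fun_at_morphism C _ _ P2xP1_grading U v Uv.
by apply: (adjoin_ramified A_phi phi_X (e := e)) => q' r qr; rewrite !eE; exact: vE.
Qed.

End AdjoinedElement.

Theorem corollary2 (R : realType) (a : 'I_3 -> R[i])
    (a_generic : kulikov_generic a)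
    (K : fieldType) (iota : {rmorphism kulikov_ring a -> K})
    (iota_frac : is_fraction_field iota)
    (p : kulikov_ring a)
    (p_primitive : primitive_element (kulikov_image a) iota p) :
  ~ normal_domain (subring_of (adjoin (kulikov_image a) p)) /\
  ~ unramified (adjoin_incl (kulikov_image a) p).
Proof.
have [iota_inj _] := iota_frac.
have U_param v : kulikov_surface a v -> exists u1 u2 s w,
    [/\ v = blowup_pt u1 u2 s w, (u1 != 0) || (u2 != 0) & (s != 0) || (w != 0)].
  by case=> /blowup_param.
pose UP u1 u2 s w := @kulikov_surfaceP R a u1 u2 s w a_generic.
pose no_fiber u1 u2 := @generic_conic_no_fiber R a a_generic u1 u2.
have inP := @image_in_plane R[i] a (kulikov_surface a) U_param
  UP (@kulikov_map R) (@kulikov_map_blowup_pt R).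
have imageE (b : kulikov_ring a) : b \in kulikov_image a <->
    exists g : regular_ring P2_grading (affine_plane a),
    forall v, kulikov_surface a v -> fun_at b v = fun_at g (kulikov_map v).
  split=> [/asboolP [g gE]|[g gE]].
    exists g => v Uv; pose y := exist (kulikov_plane a) (kulikov_map v) (inP v Uv).
    by have := gE (exist _ v Uv) y erefl; rewrite (fun_atE b) (fun_atE g).
  apply/asboolP; exists g => s y sy; rewrite !fun_atE sy; apply: gE.
  exact: (svalP s).
have [nn nu] := @adjoin_not_normal_ramified R[i] a (kulikov_surface a) U_param
  UP no_fiber (generic_line a_generic)
  (@kulikov_map R) (@kulikov_map_blowup_pt R) K iota (kulikov_image a) p iota_inj imageE p_primitive.
by split=> // -[_ /nu].
Qed.
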